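(* Let $\alpha>0$, $p\ge 0$, $\beta>0$, $C\ge 1$, let $\tau_n>0$ satisfy $n\tau_n^2\to\infty$, let $\lambda_i=\tau_n^2 i^{-1-2\alpha}$ and $C^{-1}i^{-p}\le\kappa_i\le C i^{-p}$ for all $i\in\mathbb N$, and let $\mu_0\in S^\beta$. Let $L$ be an $N(0,\Lambda)$-measurable linear functional whose representer $(l_i)$ is contained in $S^q$ for some $q\ge-\beta$. Define $$\varepsilon_n=(n\tau_n^2)^{-\left(\frac{\beta+q}{1+2\alpha+2p}\wedge 1\right)}+\tau_n\,(n\tau_n^2)^{-\left(\frac{1/2+\alpha+q}{1+2\alpha+2p}\wedge\frac12\right)} .$$ Then, for every sequence $M_n\to\infty$, $$\mathrm E_{\mu_0}\Pi_n\big(\mu:\ |L\mu-L\mu_0|\ge M_n\varepsilon_n\,\big|\,Y\big)\to 0\qquad(n\to\infty),$$ and the convergence is uniform over $\mu_0$ in balls $\{\mu_0\in S^\beta:\|\mu_0\|_\beta\le R\}$ for every $R>0$. In particular: (i) If $\tau_n\equiv1$, then $\varepsilon_n\asymp n^{-(\beta\wedge(1/2+\alpha)+q)/(1+2\alpha+2p)}\vee n^{-1/2}$. (ii) If $q\le p$, $\beta+q\le 1+2\alpha+2p$ and $\tau_n\asymp n^{(1/2+\alpha-\beta)/(2\beta+2p)}$, then $\varepsilon_n\asymp n^{-(\beta+q)/(2\beta+2p)}$. (iii) If $q\le p$ and $\beta+q>1+2\alpha+2p$, then $\varepsilon_n\gg n^{-(\beta+q)/(2\beta+2p)}$ for every scaling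 $\tau_n$. (iv) If $q\ge p$ and $\tau_n\gtrsim n^{(1/2+\alpha-\tilde\beta+p-q)/(2\tilde\beta+2q)}$, where $\tilde\beta=\beta\wedge(1+2\alpha+2p-q)$, then $\varepsilon_n\asymp n^{-1/2}$.
   Context: Setting. $H_1,H_2$ are separable Hilbert spaces with norms $\|\cdot\|_1,\|\cdot\|_2$ and inner products $\langle\cdot,\cdot\rangle_1,\langle\cdot,\cdot\rangle_2$; $K:H_1\to H_2$ is a known injective continuous linear operator with adjoint $K^T$. For $\mu\in H_1$ one observes $Y=K\mu+n^{-1/2}Z$, $Z$ the iso-Gaussian process of $H_2$; this means that $Y=(Y_h:h\in H_2)$ is a Gaussian process with $\mathrm E Y_h=\langle K\mu,h\rangle_2$ and $\mathrm{cov}(Y_h,Y_{h'})=n^{-1}\langle h,h'\rangle_2$. $\mathrm E_{\mu_0}$ is expectation when $\mu=\mu_0$. For a continuous linear $B:H_2\to H_1$, $BY$ is the process $(BY)_h=Y_{B^Th}$, $h\in H_1$, identified with a random element of $H_1$ when such an element exists with $\langle BY,h\rangle_1=(BY)_h$. Prior and posterior. The prior on $\mu$ is the Gaussian distribution $N(0,\Lambda)$ on $H_1$. The operators $K^TK$ and $\Lambda$ have the same eigenfunctions $(e_i)_{i\in\mathbb N}$, an orthonormal basis of $H_1$, with eigenvalues $(\kappa_i^2)$ and $(\lambda_i)$, respectively ($\kappa_i>0$); the prior may depend on $n$ through $\tau_n$. The posterior $\Pi_n(\cdot\,|\,Y)$ is $N(AY,S_n)$ with $A=\Lambda K^T(n^{-1}I+K\Lambda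 K^T)^{-1}$ and $S_n=\Lambda-A(n^{-1}I+K\Lambda K^T)A^T$. In coordinates $\mu=\sum_i\mu_ie_i$, with $Ke_i=\kappa_if_i$ and $Y_i=Y_{f_i}$, under the posterior the $\mu_i$ are independent $N\big(n\lambda_i\kappa_iY_i/(1+n\lambda_i\kappa_i^2),\ \lambda_i/(1+n\lambda_i\kappa_i^2)\big)$. Linear functionals. An $N(0,\Lambda)$-measurable linear functional is a Borel measurable map $L:H_1\to\mathbb R$ that is linear on a measurable linear subspace $\underline H_1\subset H_1$ with $N(0,\Lambda)(\underline H_1)=1$. Then $L\Lambda^{1/2}:H_1\to\mathbb R$ is a continuous linear map, identified with an element of $H_1$ with coordinates $((L\Lambda^{1/2})_i)$ relative to $(e_i)$; the representer of $L$ is the sequence $l_i=(L\Lambda^{1/2})_i/\sqrt{\lambda_i}$ (so $\sum_il_i^2\lambda_i<\infty$; if $L\mu=\langle\mu,l\rangle_1$ with $l\in H_1$, then $(l_i)$ are the coordinates of $l$). The posterior distribution of $L\mu$ is $N(LAY,s_n^2)$ with $LAY=\sum_i l_in\lambda_i\kappa_iY_i/(1+n\lambda_i\kappa_i^2)$ and $s_n^2=\sum_il_i^2\lambda_i/(1+n\lambda_i\kappa_i^2)$. For $\mu_0\in S^\beta$, $L\mu_0$ is understood as $\sum_il_i\mu_{0,i}$, with $\mu_{0,i}$ the coordinates of $\mu_0$. Sobolev spaces. For $r\in\mathbb R$ and a sequence $(\mu_i)$, $\|\mu\|_r^2=\sum_i\mu_i^2i^{2r}$, and $\mu\in S^r$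 means $\|\mu\|_r<\infty$; elements $\mu=\sum_i\mu_ie_i$ of $H_1$ are identified with their coordinate sequences. Notation. $a\wedge b=\min(a,b)$, $a\vee b=\max(a,b)$; $a_n\asymp b_n$ means $|a_n/b_n|$ is bounded away from $0$ and $\infty$ as $n\to\infty$; $a_n\gtrsim b_n$ means $b_n/a_n$ is bounded; $a_n\gg b_n$ means $b_n/a_n\to0$.
   Formalization: In (iii) the strict relation ≫ is stated only for q < p; for q = p it is replaced by ≳, because ≫ fails there (q = p, τ_n ≡ 1 gives ε_n ≍ n^{-1/2}, the same order as n^{-(β+q)/(2β+2p)}). *)

(* Defs.v *)
From HB Require Import structures.
From mathcomp Require Import all_boot all_order all_algebra.
From mathcomp Require Import all_classical all_reals all_analysis.

Set Implicit Arguments.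
Unset Strict Implicit.
Unset Printing Implicit Defensive.

Import Order.TTheory GRing.Theory Num.Theory.
Import numFieldNormedType.Exports.

Local Open Scope classical_set_scope.
Local Open Scope ring_scope.

(** Real Hilbert spaces are encoded as a [completeNormedModType R] together
    with an inner product inducing its norm. *)

Definition is_inner_product (R : realType) (H : normedModType R)
    (ip : H -> H -> R) : Prop :=
  [/\ forall x y, ip x y = ip y x,
      forall (a : R) x y z, ip (a *: x + y) z = a * ip x z + ip y z
    & forall x, ip x x = `|x| ^+ 2].

Definition separable_space (T : topologicalType) : Prop :=
  exists2 D : set T, countable D & dense D.

Definition orthonormal_basis (R : realType) (H : normedModType R)
    (ip : H -> H -> R) (e : nat -> H) : Prop :=
  (forall i j, ip (e i) (e j) = (i == j)%:R) /\
  (forall x, series (fun i => ip x (e i) *: e i) @ \oo --> x).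

Definition is_adjoint (R : realType) (H1 H2 : normedModType R)
    (ip1 : H1 -> H1 -> R) (ip2 : H2 -> H2 -> R)
    (T : H1 -> H2) (T' : H2 -> H1) : Prop :=
  forall x y, ip2 (T x) y = ip1 x (T' y).

Definition is_sqrt_operator (R : realType) (H : normedModType R)
    (ip : H -> H -> R) (T T' : H -> H) : Prop :=
  [/\ is_adjoint ip ip T' T',
      forall x, 0 <= ip (T' x) x
    & forall x, T' (T' x) = T x].

Definition borel (H : ptopologicalType) := g_sigma_algebraType (@open H).

(** The normal law with mean [m] and variance [v].  The library's
    [normal_prob] takes the standard deviation and is not the Dirac mass when
    that is [0]. *)
Definition normal_law (R : realType) (m v : R) (A : set R) : \bar R :=
  if 0 < v then normal_prob m (Num.sqrt v) A else \d_m A.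

Definition has_normal_law (R : realType) d (T : measurableType d)
    (P : probability T R) (X : T -> R) (m v : R) : Prop :=
  forall A : set R, measurable A -> P (X @^-1` A) = normal_law m v A.

(** [N(m, S)] is the law all of whose one-dimensional marginals [<x, h>] are
    normal with mean [<m, h>] and variance [<S h, h>]. *)
Definition is_gaussian (R : realType) (H : normedModType R)
    (ip : H -> H -> R) (g : set (borel H) -> \bar R) (m : H) (S : H -> H) :
    Prop :=
  forall (h : H) (A : set R), measurable A ->
    g [set x | A (ip x h)] = normal_law (ip m h) (ip (S h) h) A.

Definition is_gaussian_process (R : realType) d (T : measurableType d)
    (P : probability T R) (I : Type) (Y : I -> T -> R) : Prop :=
  forall (k : nat) (a : 'I_k -> R) (h : 'I_k -> I),
    exists m v : R,
      has_normal_law P (fun w => \sum_(j < k) a j * Y (h j) w) m v.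

(** The law of [Y = x + n^(-1/2) Z], with [Z] the iso-Gaussian process. *)
Definition is_signal_in_white_noise (R : realType) (H : normedModType R)
    (ip : H -> H -> R) d (T : measurableType d) (P : probability T R)
    (n : nat) (x : H) (Y : H -> T -> R) : Prop :=
  [/\ is_gaussian_process P Y,
      forall h, 'E_P[Y h]%E = (ip x h)%:E
    & forall h h', covariance P (Y h) (Y h') = (n%:R^-1 * ip h h')%:E].

Section posterior.
Context {R : realType} {H1 H2 : completeNormedModType R}.
Variables (ip1 : H1 -> H1 -> R).
Variables (n : nat) (K : H1 -> H2) (KT : H2 -> H1) (Lam : H1 -> H1).

(** Covariance operator of [Y] when [mu] is drawn from [N(0, Lam)]. *)
Definition marginal_cov (y : H2) : H2 := n%:R^-1 *: y + K (Lam (KT y)).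

(** [A = Lam K^T (n^-1 I + K Lam K^T)^-1], [Minv] being the inverse. *)
Definition is_posterior_gain (A : H2 -> H1) : Prop :=
  exists Minv : H2 -> H2,
    [/\ cancel Minv marginal_cov, cancel marginal_cov Minv
      & forall y, A y = Lam (KT (Minv y))].

(** [AT] stands for the adjoint of [A]. *)
Definition posterior_cov (A : H2 -> H1) (AT : H1 -> H2) (h : H1) : H1 :=
  Lam h - A (marginal_cov (AT h)).

(** The process [BY] is given by [(BY)_h = Y_(B^T h)], with [BT] standing for
    [B^T]; it is identified with an [H1]-valued random element. *)
Definition represents_process d (T : measurableType d) (P : probability T R)
    (Y : H2 -> T -> R) (BT : H1 -> H2) (BY : T -> H1) : Prop :=
  forall h : H1, {ae P, forall w, ip1 (BY w) h = Y (BT h) w}.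

End posterior.

Definition is_measurable_linear_functional (R : realType)
    (H : completeNormedModType R) (g : probability (borel H) R) (L : H -> R) :
    Prop :=
  measurable_fun [set: borel H] (L : borel H -> R) /\
  exists V : set (borel H),
    [/\ measurable V, g V = 1%E, V 0,
        forall (a : R) (x y : H), V x -> V y -> V (a *: x + y)
      & forall (a : R) (x y : H), V x -> V y -> L (a *: x + y) = a * L x + L y].

(** [l_i = (L Lam^(1/2))_i / sqrt lambda_i]; the element identified with the
    continuous linear functional [L Lam^(1/2)] has [i]th coordinate
    [L (Lam^(1/2) e_i)]. *)
Definition representer (R : realType) (H : normedModType R) (e : nat -> H)
    (Lam_half : H -> H) (lambda : nat -> R) (L : H -> R) (i : nat) : R :=
  L (Lam_half (e i)) / Num.sqrt (lambda i).

(** Index [i : nat] stands for the index [i + 1] of the sequences indexed by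
    the positive integers. *)

Definition sobolev_norm (R : realType) (r : R) (u : nat -> R) : \bar R :=
  sqrte (\sum_(0 <= i <oo) (u i ^+ 2 * i.+1%:R `^ (2 * r))%:E)%E.

Definition sobolev (R : realType) (r : R) : set (nat -> R) :=
  [set u | (sobolev_norm r u < +oo)%E].

Definition basis_coord (R : realType) (H : normedModType R) (ip : H -> H -> R)
    (e : nat -> H) (x : H) (i : nat) : R := ip x (e i).

Definition pairing (R : realType) (l u : nat -> R) : R :=
  limn (series (fun i => l i * u i)).

Definition prior_eigenvalue (R : realType) (alpha tau : R) (i : nat) : R :=
  tau ^+ 2 * i.+1%:R `^ (- 1 - 2 * alpha).

Definition rate (R : realType) (alpha p beta q : R) (tau : nat -> R) (n : nat) :
    R :=
  let D := 1 + 2 * alpha + 2 * p in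
  let x := n%:R * tau n ^+ 2 in
  x `^ (- Num.min ((beta + q) / D) 1) +
  tau n * x `^ (- Num.min ((2^-1 + alpha + q) / D) 2^-1).

Definition asymp_eq (R : realType) (a b : nat -> R) : Prop :=
  exists c C : R, 0 < c /\ \forall n \near \oo, c <= `|a n / b n| <= C.

Definition asymp_gtrsim (R : realType) (a b : nat -> R) : Prop :=
  exists C : R, \forall n \near \oo, `|b n / a n| <= C.

Definition asymp_gg (R : realType) (a b : nat -> R) : Prop :=
  (fun n => b n / a n) @ \oo --> (0 : R).

(* Main.v *)
Require Import Defs.
From HB Require Import structures.
From mathcomp Require Import all_boot all_order all_algebra.
From mathcomp Require Import all_classical all_reals all_analysis.
From mathcomp Require Import measurable_realfun.
From mathcomp Require Import ring lra.

Set Implicit Arguments.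
Unset Strict Implicit.
Unset Printing Implicit Defensive.

Import Order.TTheory GRing.Theory Num.Theory.
Import numFieldNormedType.Exports.

Local Open Scope classical_set_scope.
Local Open Scope ring_scope.

(** Averaging the posterior over the data turns the risk into [Q {mu : M_n eps_n
    <= |L mu - L mu0|}] for a single Borel probability [Q] on [H1], the mixture
    of the posteriors.  Since the posterior mean is linear in the data, [Q] is
    Gaussian: its mean is [m0 = A K mu0] and its covariance, posterior spread
    plus sampling variance of the posterior mean, is
    [Lam - A K Lam K^T A^T].  Everything is diagonal in the basis [e]: with
    [y_i = n lam_i kappa_i^2] and [a_i = y_i / (1 + y_i)], the coordinates of
    [m0] are [a_i mu0_i] and the variances are
    [lam_i (1 - a_i^2) <= 2 lam_i / (1 + y_i)].  Hence [L mu - L mu0] should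
    have bias [- sum l_i mu0_i / (1 + y_i)] and variance at most
    [2 sum l_i^2 lam_i / (1 + y_i)].  The interpolation [1 + y >= y^th], for
    [0 <= th <= 1], bounds the bias by the first term of the rate ([bias_le]) and
    the variance by the square of the second one ([error_variance_le]), up to
    constants, and Chebyshev's inequality bounds the risk by a constant over
    [M_n^2] ([chebyshev_rate_le]).

    What has to be justified is the use of coordinates for [L], which is only
    measurable, and linear on a subspace [V] of full prior measure.

    - [V] has full measure for the centred version of [Q].  The prior is the
      law of [z + A K x] for independent [z], of the centred law, and [x], of
      the prior law; so some translate of [V] has full measure, and by symmetry
      the translation is by an element of [V] ([convolution_full_subspace]).
      The mean [m0], being in the range of [Lam], is in [V] too: the prior is
      invariant under reflections which move points along a given direction of
      that range ([full_subspace_cov]).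

    - The second moment of [L] is at most the supremum of the variances of its
      truncations [sum_(i < N) l_i mu_i] ([functional_second_moment]).  Changing
      the signs of all coordinates of index at least [N] preserves the measure,
      and it moves a bounded measurable function little in mean when [N] is
      large ([refl_stable_bounded]).  But [L mu] plus its value at the
      reflected point is twice the truncation, so that the characteristic
      function of [L] is the limit of those of the truncations
      ([cos_functional_cvg]).

    - [L m0 = sum l_i a_i mu0_i].  The remainders of the expansion of [L] have
      second moments tending to 0 under the prior, and the reflections transfer
      this to the values at the points of the range of [Lam]
      ([functional_cov_cvg]).

    Gaussian measures on [H1] are handled through their characteristic
    functions, which determine them ([borel_probability_ext]).  The
    comparisons of the rate with powers of [n] are computations with exponents.
    When [q <= p] and [beta + q] exceeds [1 + 2 alpha + 2 p], the rate is
    [x^-1 + n^(-1/2) x^g] with [x = n tau^2] and [g >= 0]; its infimum over [x]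
    is, up to a constant, its value where the two terms balance. *)

(** * Normal laws and their characteristic functions *)

Lemma bounded_integrable (R : realType) d (T : measurableType d)
    (mu : probability T R) (f : T -> R) (c : R) :
  measurable_fun setT f -> (forall x, `|f x| <= c) ->
  mu.-integrable setT (EFin \o f).
Proof.
move=> mf fc; apply: measurable_bounded_integrable => //.
  by rewrite -ge0_fin_numE// fin_num_measure.
exists c; split; first exact: num_real.
by move=> M cM x _; exact: le_trans (fc x) (ltW cM).
Qed.

Section real_integrable.
Context (R : realType) d (T : measurableType d) (mu : {measure set T -> \bar R}).
Implicit Types (f g : T -> R).

Lemma integrableD_EFin f g : mu.-integrable setT (EFin \o f) ->
  mu.-integrable setT (EFin \o g) ->
  mu.-integrable setT (EFin \o (fun x => f x + g x)).
Proof. by move=> fi gi; exact: (integrableD measurableT fi gi). Qed.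

Lemma integrableB_EFin f g : mu.-integrable setT (EFin \o f) ->
  mu.-integrable setT (EFin \o g) ->
  mu.-integrable setT (EFin \o (fun x => f x - g x)).
Proof. by move=> fi gi; exact: (integrableB measurableT fi gi). Qed.

Lemma integrableZ_EFin (k : R) f : mu.-integrable setT (EFin \o f) ->
  mu.-integrable setT (EFin \o (fun x => k * f x)).
Proof. by move=> fi; exact: (integrableZl measurableT k fi). Qed.

End real_integrable.

Lemma integral_EFin_Rintegral (R : realType) d (T : measurableType d)
    (mu : probability T R) (f : T -> R) :
  mu.-integrable setT (EFin \o f) ->
  (\int[mu]_x (f x)%:E)%E = (\int[mu]_x f x)%:E.
Proof. by move=> fi; rewrite /Rintegral fineK//; exact: integrable_fin_num. Qed.

Lemma Rintegral_bounded_cvg (R : realType) d (T : measurableType d)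
    (mu : probability T R) (f_ : nat -> T -> R) (f : T -> R) (c : R) :
  (forall n, measurable_fun setT (f_ n)) -> measurable_fun setT f ->
  (forall n x, `|f_ n x| <= c) -> (forall x, f_ ^~ x @ \oo --> f x) ->
  \int[mu]_x f_ n x @[n --> \oo] --> \int[mu]_x f x.
Proof.
move=> mf_ mf fc f_f.
have [|||||i1 _ h] := @dominated_convergence _ _ _ mu setT measurableT
  (fun n => EFin \o f_ n) (EFin \o f) (EFin \o cst c).
- by move=> n; exact/measurable_EFinP.
- exact/measurable_EFinP.
- by apply: aeW => x _; apply: cvg_EFin; [exact: nearW | exact: f_f].
- by apply: (@bounded_integrable _ _ _ _ (cst c) `|c|).
- by apply: aeW => x n _; rewrite /= lee_fin.
apply: fine_cvg; rewrite fineK; first exact: h.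
exact: integrable_fin_num.
Qed.

Section normal_characteristic_function.
Context {R : realType}.
Implicit Types a c m s t th x : R.
Local Notation leb := (@lebesgue_measure R).

(** The density agrees almost everywhere with the Radon-Nikodym derivative, both
    having the same integrals over all measurable sets. *)
Lemma integral_normal_prob m s (f : R -> \bar R) :
  (normal_prob m s).-integrable setT f ->
  (\int[normal_prob m s]_x f x = \int[leb]_x (f x * (normal_pdf m s x)%:E))%E.
Proof.
move=> fi; have dom := normal_prob_dominates m s.
have mpdf : measurable_fun setT (EFin \o normal_pdf m s).
  by apply: measurableT_comp => //; exact: measurable_normal_pdf.
have rn : ae_eq leb setT (Radon_Nikodym (charge_of_finite_measure (normal_prob m s)) leb) (EFin \o normal_pdf m s).
  apply: integral_ae_eq => //; first exact: Radon_Nikodym_integrable.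
  by move=> E _ mE; rewrite -Radon_Nikodym_integral.
rewrite -(Radon_Nikodym_change_of_variables dom)//.
apply: ae_eq_integral => //.
- apply: emeasurable_funM; first exact: measurable_int fi.
  by apply: (measurable_int leb); exact: Radon_Nikodym_integrable.
- apply: emeasurable_funM; first exact: measurable_int fi.
  exact: mpdf.
- exact: ae_eqe_mul2l rn.
Qed.

Lemma normal_pdf_derive m s x : s != 0 ->
  is_derive x 1 (normal_pdf m s) (- (x - m) / s ^+ 2 * normal_pdf m s x).
Proof.
move=> s0; rewrite normal_pdfE// /normal_fun.
apply: is_derive_eq.
rewrite /GRing.scale/=.
have h : s ^+ 2 != 0 by rewrite sqrf_eq0.
rewrite -[_ *+ 2]mulr_natr.
set E := expR _; set pk := normal_peak s.
by field.
Qed.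

(** The tails of [|x - m|] times the density are absorbed by the density of a
    normal law with twice the variance. *)
Lemma centered_normal_pdf_le m s x : 0 < s ->
  `|x - m| * normal_pdf m s x <=
  s * normal_peak s / normal_peak (Num.sqrt 2 * s)
    * normal_pdf m (Num.sqrt 2 * s) x.
Proof.
move=> s0; have s20 : 0 < Num.sqrt 2 * s by rewrite mulr_gt0// sqrtr_gt0.
have p1 : 0 < normal_peak s by rewrite normal_peak_gt0// gt_eqF.
have p2 : 0 < normal_peak (Num.sqrt 2 * s) by rewrite normal_peak_gt0// gt_eqF.
rewrite !normal_pdfE ?gt_eqF// [leRHS]mulrA mulfVK ?gt_eqF//.
rewrite mulrCA [s * _]mulrC -!mulrA ler_pM2l//.
rewrite /normal_fun exprMn sqr_sqrtr//.
set z := (x - m).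
have -> : - z ^+ 2 / (s ^+ 2 *+ 2)
    = - z ^+ 2 / (2 * s ^+ 2 *+ 2) + - z ^+ 2 / (2 * s ^+ 2 *+ 2).
  by field; rewrite gt_eqF.
rewrite expRD mulrA ler_pM2r ?expR_gt0//.
rewrite mulNr expRN ler_pdivrMr ?expR_gt0//.
have := expR_ge1Dx (z ^+ 2 / (2 * s ^+ 2 *+ 2)).
set y := expR _ => hy.
have : s * (1 + z ^+ 2 / (2 * s ^+ 2 *+ 2)) <= s * y by rewrite ler_pM2l.
apply: le_trans; rewrite -(real_normK (num_real z)).
have -> : s * (1 + `|z| ^+ 2 / (2 * s ^+ 2 *+ 2))
    = `|z| + (`|z| / 2 - s) ^+ 2 / s by field; rewrite gt_eqF.
by rewrite lerDl divr_ge0// ?sqr_ge0// ltW.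
Qed.

Lemma integrable_mul_normal_pdf m s (f : R -> R) c :
  measurable_fun setT f -> (forall x, `|f x| <= c) ->
  leb.-integrable setT (fun x => (f x * normal_pdf m s x)%:E).
Proof.
move=> mf fc.
have ki : leb.-integrable setT (fun x => (c * normal_pdf m s x)%:E).
  under eq_fun do rewrite EFinM.
  by apply: integrableZl => //; exact: integrable_normal_pdf.
apply: le_integrable ki => //=.
  apply/measurable_EFinP; apply: measurable_funM => //.
  exact: measurable_normal_pdf.
move=> x _; rewrite lee_fin !normrM ler_wpM2r//.
exact: le_trans (fc x) (ler_norm _).
Qed.

Lemma integrable_centered_normal_pdf m s (f : R -> R) c : 0 < s ->
  measurable_fun setT f -> (forall x, `|f x| <= c) ->
  leb.-integrable setT (fun x => (f x * (x - m) * normal_pdf m s x)%:E).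
Proof.
move=> s0 mf fc.
pose k := s * normal_peak s / normal_peak (Num.sqrt 2 * s).
have ki := @integrable_mul_normal_pdf m (Num.sqrt 2 * s) (cst (c * k)) `|c * k|
  (measurable_cst _) (fun=> lexx _).
apply: le_integrable ki => //=.
- apply/measurable_EFinP; apply: measurable_funM; last exact: measurable_normal_pdf.
  by apply: measurable_funM => //; exact: measurable_funB.
- move=> x _; rewrite lee_fin !normrM.
  rewrite !(ger0_norm (normal_pdf_ge0 _ _ _)) -!mulrA.
  have h := centered_normal_pdf_le m x s0.
  apply: ler_pM => //; first by rewrite mulr_ge0// normal_pdf_ge0.
    exact: le_trans (fc x) (ler_norm _).
  apply: le_trans h _; rewrite !mulrA ler_wpM2r ?normal_pdf_ge0//.
  by rewrite -!normrM ler_norm.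
Qed.

(** A form of integration by parts on the whole line: the decay of [F] at
    infinity makes the boundary terms vanish.  The fundamental theorem applies
    on [`[-n, n]], and dominated convergence lets [n] tend to infinity. *)
Lemma Rintegral_derive_eq0 (F f : R -> R) (a c : R) :
  (forall x, is_derive x 1 F (f x)) -> continuous f ->
  leb.-integrable setT (EFin \o f) ->
  (forall x, `|x - a| * `|F x| <= c) ->
  (\int[leb]_x (f x)%:E = 0)%E.
Proof.
move=> dF cf intf Fc.
have c0 : 0 <= c by apply: le_trans (Fc 0); rewrite mulr_ge0.
have F0 (y : nat -> R) : (forall n, `|y n| = n.+1%:R) -> F \o y @ \oo --> 0.
  move=> yn; apply/cvgr0Pnorm_le => e e0; near=> n.
  have h : c / e < `|y n - a|.
    apply: lt_le_trans (lerB_dist _ _); rewrite yn ltrBrDr.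
    apply: (@le_lt_trans _ _ n%:R); last by rewrite ltr_nat.
    near: n; exact: nbhs_infty_ger.
  rewrite leNgt; apply/negP => eF.
  have ya : 0 < `|y n - a| by apply: le_lt_trans h; rewrite divr_ge0// ltW.
  have := Fc (y n); rewrite leNgt => /negP; apply.
  by rewrite ltr_pdivrMr// in h; apply: lt_trans h _; rewrite ltr_pM2l.
pose f_ n (x : R) : \bar R := ((f \_ `[- n.+1%:R, n.+1%:R]) x)%:E.
have mf : measurable_fun setT f by exact: continuous_measurable_fun.
have mf_ n : measurable_fun setT (f_ n).
  apply/measurable_EFinP; apply/(measurable_restrict _ _ _) => //.
  exact: measurable_funTS.
have [||||i1 _ h] := @dominated_convergence _ _ _ leb setT measurableT
  f_ (EFin \o f) (abse \o (EFin \o f)) mf_.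
- exact/measurable_EFinP.
- apply: aeW => x _; apply: cvg_EFin; first exact: nearW.
  apply: cvg_near_cst; near=> n.
  rewrite /f_ /= patchE ifT// inE/= in_itv/= -ler_norml.
  apply: (@le_trans _ _ n%:R); last by rewrite ler_nat.
  near: n; exact: nbhs_infty_ger.
- exact: integrable_abse intf.
- apply: aeW => x n _; rewrite /f_ /= lee_fin patchE.
  by case: ifP => // _; rewrite normr0.
have hE n : (\int[leb]_x f_ n x = (F n.+1%:R - F (- n.+1%:R))%:E)%E.
  rewrite /f_.
  transitivity (\int[leb]_(x in `[(- n.+1%:R)%R, n.+1%:R%R]) (f x)%:E)%E.
    rewrite [RHS]integral_mkcond; apply: eq_integral => x _.
    by rewrite restrict_EFin.
  have cF : continuous F.
    by move=> x; apply: differentiable_continuous; apply/derivable1_diffP; case: (dF x).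
  rewrite (@continuous_FTC2 _ f F)//.
  - by rewrite gtrN.
  - exact: continuous_subspaceT.
  - split.
    + by move=> x _; case: (dF x).
    + exact/cvg_at_right_filter/cF.
    + exact/cvg_at_left_filter/cF.
  - by move=> x _; rewrite derive1E; apply: derive_val.
have h0 : (\int[leb]_x f_ n x)%E @[n --> \oo] --> 0%E.
  under eq_fun do rewrite hE.
  apply: cvg_EFin; first exact: nearW.
  rewrite -[X in _ --> X](subrr 0); apply: cvgB.
    by apply: (F0 (fun n => n.+1%:R)) => n; rewrite normr_nat.
  by apply: (F0 (fun n => - n.+1%:R)) => n; rewrite normrN normr_nat.
by rewrite -(cvg_lim _ h)//; exact: cvg_lim.
Unshelve. all: by end_near. Qed.

Let phi m s th t := \int[leb]_x (cos (t * (x - m) + th) * normal_pdf m s x).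

Let measurable_phase (f : R -> R) m t th : continuous f ->
  measurable_fun setT (fun x => f (t * (x - m) + th)).
Proof.
move=> cf; apply: measurableT_comp; first exact: continuous_measurable_fun.
apply: measurable_funD => //; apply: measurable_funM => //.
exact: measurable_funB.
Qed.

Let sin_le1 x : `|sin x| <= 1.
Proof. by rewrite ler_norml sin_geN1 sin_le1. Qed.

Let cos_le1 x : `|cos x| <= 1.
Proof. by rewrite ler_norml cos_geN1 cos_le1. Qed.

(** Differentiation under the integral sign, then integration by parts. *)
Let derive_phi m s th t : 0 < s ->
  is_derive t 1 (phi m s th) (- (s ^+ 2 * t) * phi m s th t).
Proof.
move=> s0.
pose f u x := cos (u * (x - m) + th) * normal_pdf m s x.
have df (u x : R) : is_derive u 1 (f ^~ x)
    (- (sin (u * (x - m) + th) * (x - m) * normal_pdf m s x)).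
  by rewrite /f; apply: is_derive_eq; rewrite /GRing.scale/=; ring.
have intf (u : R) : leb.-integrable setT (EFin \o f u).
  apply: (@integrable_mul_normal_pdf m s (fun x => cos (u * (x - m) + th)) 1) => //.
  exact: (measurable_phase _ _ _ (@continuous_cos R)).
have intG : leb.-integrable setT (EFin \o (fun x => `|1 * (x - m) * normal_pdf m s x|)).
  have : leb.-integrable setT (EFin \o (fun x => 1 * (x - m) * normal_pdf m s x)).
    by apply: (@integrable_centered_normal_pdf _ _ (cst 1) 1) => // x; rewrite normr1.
  by move=> /integrable_abse.
have d1f (u x : R) : partial1of2 f u x =
    - (sin (u * (x - m) + th) * (x - m) * normal_pdf m s x).
  by rewrite partial1of2E; apply: derive_val.
have Gub (u x : R) : `]t - 1, t + 1[%classic u -> setT x ->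
    `|partial1of2 f u x| <= `|1 * (x - m) * normal_pdf m s x|.
  move=> _ _; rewrite d1f normrN !normrM normr1 -!mulrA mul1r ler_piMl//.
have tI : `]t - 1, t + 1[%classic t by rewrite /= in_itv/= gtrBl ltrDl ltr01.
have h1 := derivable_under_integral measurableT tI (fun u _ => intf u)
  (fun u x _ _ => @ex_derive _ _ _ _ _ _ _ (df u x)) (fun x => normr_ge0 _) intG Gub.
have h2 := differentiation_under_integral measurableT tI (fun u _ => intf u)
  (fun u x _ _ => @ex_derive _ _ _ _ _ _ _ (df u x)) (fun x => normr_ge0 _) intG Gub.
apply: DeriveDef; first exact: h1.
rewrite -derive1E [LHS]h2.
under eq_Rintegral do rewrite d1f.
have i1 : leb.-integrable setT
    (EFin \o (fun x => sin (t * (x - m) + th) * (x - m) * normal_pdf m s x)).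
  by apply: integrable_centered_normal_pdf => //; exact: (measurable_phase _ _ _ (@continuous_sin R)).
pose g x := t * f t x - s ^- 2 * (sin (t * (x - m) + th) * (x - m) * normal_pdf m s x).
have ig : leb.-integrable setT (EFin \o g).
  by apply: integrableB_EFin; apply: integrableZ_EFin.
have := @Rintegral_derive_eq0 (fun x => sin (t * (x - m) + th) * normal_pdf m s x) g m
  `|s * normal_peak s / normal_peak (Num.sqrt 2 * s)
    * normal_peak (Num.sqrt 2 * s)|.
have sn0 : s != 0 by rewrite gt_eqF.
have := fun x => normal_pdf_derive m x sn0.
move=> dp /(_ _ _ ig) H.
have {}H : (\int[leb]_x (g x)%:E = 0)%E.
  apply: H.
  - move=> x; apply: is_derive_eq; rewrite /GRing.scale/= /g /f; field => //.
  - have cp := continuous_normal_pdf (m := m) sn0.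
    have cph (h : R -> R) : continuous h -> continuous (fun x => h (t * (x - m) + th)).
      move=> ch x; apply: (@continuous_comp _ _ _ (fun x => t * (x - m) + th) h); last exact: ch.
      by apply: cvgD; [apply: cvgM; [exact: cvg_cst|apply: cvgB; [exact: cvg_id|exact: cvg_cst]]|exact: cvg_cst].
    move=> x; rewrite /g /f; apply: cvgB; (apply: cvgM; first exact: cvg_cst).
      by apply: cvgM; [exact/cph/continuous_cos|exact: cp].
    apply: cvgM; last exact: cp.
    apply: cvgM; first exact/cph/continuous_sin.
    by apply: cvgB; [exact: cvg_id|exact: cvg_cst].
  - move=> x; rewrite normrM (ger0_norm (normal_pdf_ge0 _ _ _)).
    apply: le_trans (ler_norm _).
    apply: (@le_trans _ _ (`|x - m| * normal_pdf m s x)).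
      by rewrite ler_wpM2l// ler_piMl// normal_pdf_ge0.
    apply: le_trans (centered_normal_pdf_le m x s0) _.
    rewrite ler_wpM2l//; first by rewrite divr_ge0 ?normal_peak_ge0// mulr_ge0 ?normal_peak_ge0// ltW.
    by apply: normal_pdf_ub; rewrite gt_eqF// mulr_gt0// sqrtr_gt0.
have : \int[leb]_x g x = 0 by rewrite /Rintegral H.
rewrite /g RintegralB//; last 2 first.
- exact/integrableZ_EFin/intf.
- exact: integrableZ_EFin.
rewrite RintegralZl// RintegralZl// => /eqP; rewrite subr_eq0 => /eqP e1.
under eq_Rintegral do rewrite -mulN1r.
rewrite RintegralZl//.
rewrite -/(phi m s th t) in e1.
by rewrite mulN1r mulNr -mulrA e1 mulrA mulfV ?mul1r// expf_neq0.
Qed.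

(** The characteristic function, through its cosine with an arbitrary phase: it
    solves the differential equation [phi' = - s^2 t phi]. *)
Lemma normal_prob_cos m s th t : 0 < s ->
  (\int[normal_prob m s]_x (cos (t * x + th))%:E =
   (cos (t * m + th) * expR (- (t ^+ 2 * s ^+ 2 / 2)))%:E)%E.
Proof.
move=> s0.
have phiE r : phi m s r t = cos r * expR (- (t ^+ 2 * s ^+ 2 / 2)).
  pose W u := phi m s r u * expR (u ^+ 2 * s ^+ 2 / 2).
  have dW (u : R) : is_derive u 1 W 0.
    have := derive_phi m r u s0 => dphi; rewrite /W.
    by apply: is_derive_eq; rewrite /GRing.scale/=; field.
  have : W t = W 0 by exact: is_derive_0_is_cst.
  rewrite /W {2}/phi; under eq_Rintegral do rewrite mul0r add0r.
  rewrite RintegralZl//; last exact: integrable_normal_pdf.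
  rewrite [X in cos r * X]/Rintegral integral_normal_pdf/= mulr1.
  rewrite expr0n/= !mul0r expR0 mulr1 expRN => <-.
  by rewrite mulfK// gt_eqF// expR_gt0.
have mf : measurable_fun setT (fun x : R => cos (t * x + th)).
  apply: measurableT_comp; first exact: continuous_measurable_fun (@continuous_cos R).
  by apply: measurable_funD => //; apply: measurable_funM.
rewrite integral_normal_prob//; last first.
  exact: (bounded_integrable (normal_prob m s) mf (fun x => cos_le1 _)).
have e1 : leb.-integrable setT (EFin \o (fun x => cos (t * x + th) * normal_pdf m s x)).
  exact: (@integrable_mul_normal_pdf m s (fun x => cos (t * x + th)) 1).
under eq_integral do rewrite -EFinM.
rewrite -(fineK (integrable_fin_num _ e1))//; congr EFin.
rewrite -phiE /phi /Rintegral; congr fine.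
by apply: eq_integral => x _; rewrite /=; congr (cos _ * _)%:E; ring.
Qed.

(** The degenerate law, of variance 0, is covered by the same formula. *)
Lemma normal_law_cos d (T : measurableType d) (P : probability T R)
    (X : T -> R) m v th t :
  measurable_fun setT X -> 0 <= v -> has_normal_law P X m v ->
  \int[P]_x cos (t * X x + th) =
    cos (t * m + th) * expR (- (t ^+ 2 * v / 2)).
Proof.
move=> mX v0 PX.
pose X' : T -> measurableTypeR R := X.
have mX' : measurable_fun setT X' by exact: mX.
have mf : measurable_fun setT (fun x : measurableTypeR R => cos (t * x + th)).
  apply: measurableT_comp; first exact: continuous_measurable_fun (@continuous_cos R).
  by apply: measurable_funD => //; apply: measurable_funM.
have -> : \int[P]_x cos (t * X x + th) =
    fine (\int[pushforward P X']_y (cos (t * y + th))%:E)%E.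
  rewrite integral_pushforward//; first exact/measurable_EFinP.
  apply: (@bounded_integrable _ _ _ _ _ 1); last by move=> x; exact: cos_le1.
  exact: (measurableT_comp mf mX').
have [v_gt0|] := boolP (0 < v).
  have -> : (\int[pushforward P X']_y (cos (t * y + th))%:E =
      \int[normal_prob m (Num.sqrt v)]_y (cos (t * y + th))%:E)%E.
    apply: eq_measure_integral => A mA _.
    by rewrite /= /pushforward [LHS]PX// /normal_law v_gt0.
  by rewrite normal_prob_cos ?sqrtr_gt0// sqr_sqrtr.
rewrite -leNgt => vle0; have {vle0} vE : v = 0 by apply/eqP; rewrite eq_le vle0.
have -> : (\int[pushforward P X']_y (cos (t * y + th))%:E =
    \int[(@dirac _ (measurableTypeR R) m R)]_y (cos (t * y + th))%:E)%E.
  apply: eq_measure_integral => A mA _.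
  by rewrite /= /pushforward [LHS]PX// /normal_law vE ltxx.
rewrite integral_dirac//; last exact/measurable_EFinP.
by rewrite diracT mul1e/= vE mulr0 mul0r oppr0 expR0 mulr1.
Qed.

End normal_characteristic_function.

(** * Moments from the characteristic function *)

Section second_moment.
Context {R : realType} d (T : measurableType d) (P : probability T R).
Implicit Types (X : T -> R) (x v t : R).

Lemma normr_sin_le x : `|sin x| <= `|x|.
Proof.
have pos (y : R) : 0 < y -> `|sin y| <= y.
  move=> y0.
  have cs : {within `[0, y], continuous (@sin R)}.
    by apply: continuous_subspaceT => z; exact: continuous_sin.
  have [c _] := @MVT _ (@sin R) (@cos R) 0 y y0 (fun z _ => is_derive_sin z) cs.
  rewrite sin0 !subr0 => ->.
  by rewrite normrM (gtr0_norm y0) ler_piMl ?cos_max// ltW.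
have [x0|x0|<-] := ltgtP 0 x.
- by rewrite [leRHS]gtr0_norm// pos.
- by rewrite -normrN -sinN [leRHS]ltr0_norm// pos// oppr_gt0.
- by rewrite sin0 normr0.
Qed.

Lemma onem_cos x : 1 - cos x = sin (x / 2) ^+ 2 *+ 2.
Proof.
have -> : x = (x / 2) *+ 2 by rewrite -mulr_natr mulfVK.
rewrite cos_mulr2n cos2sin2.
have -> : x / 2 *+ 2 / 2 = x / 2 by rewrite -mulr_natr mulfVK.
by ring.
Qed.

Lemma cvg_sin_quotient x : n.+1%:R * sin (x / n.+1%:R) @[n --> \oo] --> x.
Proof.
pose g (h : R) := sin (h * x).
have dg : is_derive (0 : R) 1 g x.
  by rewrite /g; apply: is_derive_eq; rewrite /GRing.scale/= mul0r cos0; ring.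
have : h^-1 *: (g (h + 0) - g 0) @[h --> 0^'] --> x.
  have [hd hv] := dg.
  by move: hd => /cvg_ex[l hl]; have := hl; rewrite /derive in hv;
    have := cvg_lim _ hl; rewrite -hv => <- //; under eq_fun do rewrite scaler1.
move=> /cvgr_dnbhsP /(_ (fun n => n.+1%:R^-1)) h.
have {}h : n.+1%:R^-1^-1 *: (g (n.+1%:R^-1 + 0) - g 0) @[n --> \oo] --> x.
  by apply: h; split => [n|]; [rewrite invr_eq0 pnatr_eq0|exact: cvg_harmonic].
apply: cvg_trans h; apply: near_eq_cvg; apply: nearW => n.
by rewrite /g addr0 mul0r sin0 subr0 invrK /GRing.scale/= [_^-1 * x]mulrC.
Qed.

Let measurable_sin_scaled X a b : measurable_fun setT X ->
  measurable_fun setT (fun w => a * sin (X w / b)).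
Proof.
move=> mX; apply: measurable_funM => //; apply: measurableT_comp.
  exact: continuous_measurable_fun (@continuous_sin R).
exact: measurable_funM.
Qed.

Let measurable_cos_scaled X t : measurable_fun setT X ->
  measurable_fun setT (fun w => cos (t * X w)).
Proof.
move=> mX; apply: measurableT_comp.
  exact: continuous_measurable_fun (@continuous_cos R).
exact: measurable_funM.
Qed.

(** Fatou's lemma applied to [(1 - cos (t X)) / t^2], as [t] tends to 0: the
    characteristic function controls the second moment. *)
Lemma second_moment_le_of_cos X v : measurable_fun setT X ->
  (forall t, expR (- (t ^+ 2 * v / 2)) <= \int[P]_w cos (t * X w)) ->
  (\int[P]_w (X w ^+ 2)%:E <= v%:E)%E.
Proof.
move=> mX Xcf.
(* [f n] tends to [X ^ 2], and is [(1 - cos (t X)) / t ^ 2] up to scaling, with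
   [t = 2 / (n + 1)]. *)
pose f n w : R := (n.+1%:R * sin (X w / n.+1%:R)) ^+ 2.
have mf n : measurable_fun setT (f n).
  exact: measurable_funX (measurable_sin_scaled _ _ mX).
have fE n w : f n w = n.+1%:R ^+ 2 / 2 * (1 - cos (2 / n.+1%:R * X w)).
  rewrite onem_cos /f exprMn.
  have n0 : n.+1%:R != 0 :> R by rewrite pnatr_eq0.
  move: n0; set k := n.+1%:R => n0.
  have -> : 2 / k * X w / 2 = X w / k by field.
  by field.
have -> : (\int[P]_w (X w ^+ 2)%:E = \int[P]_w limn_einf (fun n => (f n w)%:E))%E.
  apply: eq_integral => w _; apply/esym.
  have h : (f n w)%:E @[n --> \oo] --> (X w ^+ 2)%:E.
    apply: cvg_EFin; first exact: nearW.
    by apply: cvgM; exact: cvg_sin_quotient.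
  by rewrite is_cvg_limn_einfE; [exact: cvg_lim | apply/cvg_ex; eexists; exact: h].
have h := @fatou _ _ _ P setT measurableT (fun n w => (f n w)%:E)
  (fun n => (measurable_EFinP _ _).2 (mf n)) _.
apply: le_trans (h _) _; first by move=> n w _; rewrite lee_fin sqr_ge0.
have hn n : (\int[P]_w (f n w)%:E <= v%:E)%E.
  have ic t : P.-integrable setT (EFin \o (fun w => cos (t * X w))).
    by apply: (@bounded_integrable _ _ _ _ _ 1) => [|w]; [exact: measurable_cos_scaled|exact: cos_max].
  have i1 : P.-integrable setT (EFin \o (fun w : T => 1 : R)).
    by apply: (@bounded_integrable _ _ _ _ _ 1) => // w; rewrite normr1.
  have i2 t : P.-integrable setT (EFin \o (fun w : T => 1 - cos (t * X w))).
    exact: integrableB_EFin.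
  have iE : P.-integrable setT (EFin \o f n).
    have -> : f n = (fun w => n.+1%:R ^+ 2 / 2 * (1 - cos (2 / n.+1%:R * X w))).
      by apply/funext => w; exact: fE.
    exact/integrableZ_EFin/i2.
  rewrite integral_EFin_Rintegral// lee_fin.
  under eq_Rintegral do rewrite fE.
  rewrite RintegralZl// RintegralB// Rintegral_cst//.
  rewrite [X in fine X]probability_setT mul1r.
  have := Xcf (2 / n.+1%:R).
  set I := \int[P]_x cos _ => hI.
  have hE := le_trans (expR_ge1Dx (- ((2 / n.+1%:R) ^+ 2 * v / 2))) hI.
  have {}hE : 1 - I <= (2 / n.+1%:R) ^+ 2 * v / 2.
    by rewrite lerBlDr [_ + I]addrC -lerBlDr.
  have n0 : n.+1%:R != 0 :> R by rewrite pnatr_eq0.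
  apply: (@le_trans _ _ (n.+1%:R ^+ 2 / 2 * ((2 / n.+1%:R) ^+ 2 * v / 2))).
    by rewrite ler_pM2l// divr_gt0// exprn_gt0.
  by rewrite le_eqVlt; apply/orP; left; apply/eqP; field.
rewrite limn_einf_lim; apply: lime_le; first exact: is_cvg_einfs.
apply: nearW => n; apply: le_trans (hn n).
by apply: ereal_inf_lbound; exists n => /=.
Qed.

Lemma integrable_of_second_moment X (v : R) : measurable_fun setT X ->
  (\int[P]_w (X w ^+ 2)%:E <= v%:E)%E ->
  P.-integrable setT (EFin \o X) /\ P.-integrable setT (EFin \o (fun w => X w ^+ 2)).
Proof.
move=> mX X2.
have i2 : P.-integrable setT (EFin \o (fun w => X w ^+ 2)).
  apply/integrableP; split.
    exact/measurable_EFinP/measurable_funX.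
  under eq_integral do rewrite /= ger0_norm ?sqr_ge0//.
  exact: le_lt_trans X2 (ltry _).
split => //.
have i1 : P.-integrable setT (EFin \o (fun w : T => 1 : R)).
  by apply: (@bounded_integrable _ _ _ _ _ 1) => // w; rewrite normr1.
apply: le_integrable (integrableD measurableT i1 i2) => //.
  exact/measurable_EFinP.
move=> w _; rewrite /= lee_fin [leRHS]ger0_norm ?addr_ge0 ?sqr_ge0//.
rewrite -(real_normK (num_real (X w))).
by have := sqr_ge0 (`|X w| - 1); nra.
Qed.

(** A normal law determines its parameters: its mean is found by
    differentiating the sine of the characteristic function at 0, its variance
    by squeezing the second moment between two bounds on the cosine. *)
Lemma normal_law_moments X (m v a b : R) : measurable_fun setT X -> 0 <= v ->
  has_normal_law P X m v -> 'E_P[X]%E = a%:E -> covariance P X X = b%:E ->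
  m = a /\ v = b.
Proof.
move=> mX v0 PX EX covX.
pose X0 w := X w - m.
have mX0 : measurable_fun setT X0 by exact: measurable_funB.
have cf th t : \int[P]_w cos (t * X0 w + th) = cos th * expR (- (t ^+ 2 * v / 2)).
  have := @normal_law_cos _ _ _ P X m v (th - t * m) t mX v0 PX.
  rewrite (_ : t * m + (th - t * m) = th); last by ring.
  move=> <-.
  by apply: eq_Rintegral => w _; congr cos; rewrite /X0; ring.
have cf0 t : \int[P]_w cos (t * X0 w) = expR (- (t ^+ 2 * v / 2)).
  have := cf 0 t; rewrite cos0 mul1r => <-.
  by apply: eq_Rintegral => w _; rewrite addr0.
have X2 : (\int[P]_w (X0 w ^+ 2)%:E <= v%:E)%E.
  by apply: second_moment_le_of_cos => // t; rewrite cf0.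
have [i1 i2] := integrable_of_second_moment mX0 X2.
have iX : P.-integrable setT (EFin \o X).
  have ic : P.-integrable setT (EFin \o (fun w : T => m)).
    by apply: (@bounded_integrable _ _ _ _ _ `|m|) => // w.
  apply: eq_integrable (integrableD measurableT i1 ic) => // w _.
  by rewrite /= -EFinD /X0 subrK.
have X0E : \int[P]_w X0 w = 0.
  pose f n w : R := n.+1%:R * sin (X0 w / n.+1%:R).
  have mf n : measurable_fun setT (f n) by exact: measurable_sin_scaled.
  have [||||_ _ h] := @dominated_convergence _ _ _ P setT measurableT
    (fun n => EFin \o f n) (EFin \o X0) (abse \o (EFin \o X0)) (fun n => (measurable_EFinP _ _).2 (mf n)).
  - exact/measurable_EFinP.
  - by apply: aeW => w _; apply: cvg_EFin; [exact: nearW|exact: cvg_sin_quotient].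
  - exact: integrable_abse i1.
  - apply: aeW => w n _; rewrite /= lee_fin /f normrM normr_nat.
    apply: le_trans (ler_wpM2l _ (normr_sin_le _)) _ => //.
    by rewrite normrM normfV normr_nat mulrCA mulfV ?mulr1// pnatr_eq0.
  have f0 n : (\int[P]_w (f n w)%:E = 0)%E.
    have isin : P.-integrable setT (EFin \o (fun w => sin (X0 w / n.+1%:R))).
      apply: (@bounded_integrable _ _ _ _ _ 1) => [|w]; last exact: sin_max.
      by have := measurable_sin_scaled 1 n.+1%:R mX0; under eq_fun do rewrite mul1r.
    rewrite integral_EFin_Rintegral; last first.
      exact: integrableZ_EFin.
    rewrite /f RintegralZl//; apply/eqP; rewrite -[0]/(0%:E) eqe mulf_eq0; apply/orP; right.
    have := cf (- (pi / 2)) n.+1%:R^-1.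
    rewrite cosN cos_pihalf mul0r => h0; apply/eqP; rewrite -[RHS]h0.
    apply: eq_Rintegral => w _; rewrite -sinDpihalf.
    by congr sin; rewrite mulrC; ring.
  rewrite /Rintegral -(cvg_lim _ h)//.
  rewrite (_ : (fun n => _) = cst 0%E) ?lim_cst//.
  by apply/funext => n; exact: f0.
have ic (k : R) : P.-integrable setT (EFin \o (fun w : T => k)).
  by apply: (@bounded_integrable _ _ _ _ _ `|k|) => // w.
have mE : m = a.
  move: EX; rewrite unlock integral_EFin_Rintegral// => -[<-].
  have := @RintegralB _ _ _ P setT X (cst m) measurableT iX (ic m).
  rewrite -/X0 [LHS]X0E Rintegral_cst// [X in fine X]probability_setT mulr1.
  by move=> /eqP; rewrite eq_sym subr_eq0 => /eqP.
split => //.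
have {covX}bE : \int[P]_w (X0 w ^+ 2) = b.
  move: covX; rewrite unlock unlock.
  rewrite -[X in cst (fine X)]/(\int[P]_w (X w)%:E)%E.
  have -> : (\int[P]_w (X w)%:E)%E = m%:E by rewrite mE -EX unlock.
  rewrite /Rintegral => e; rewrite -[RHS]/(fine b%:E) -e; congr fine.
apply/eqP; rewrite eq_le; apply/andP; split; last first.
  move: X2; rewrite integral_EFin_Rintegral// bE lee_fin.
  by [].
have key (t : R) : 1 - expR (- (t ^+ 2 * v / 2)) <= t ^+ 2 / 2 * b.
  have iC : P.-integrable setT (EFin \o (fun w => cos (t * X0 w))).
    by apply: (@bounded_integrable _ _ _ _ _ 1) => [|w]; [exact: measurable_cos_scaled|exact: cos_max].
  have iC1 : P.-integrable setT (EFin \o (fun w => 1 - cos (t * X0 w))).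
    exact: (integrableB_EFin (ic 1)).
  have <- : \int[P]_w (1 - cos (t * X0 w)) = 1 - expR (- (t ^+ 2 * v / 2)).
    rewrite RintegralB// ?cf0 ?Rintegral_cst// ?[X in fine X]probability_setT ?mul1r//.
  rewrite -bE -RintegralZl//; apply: le_Rintegral => //.
    exact: integrableZ_EFin.
  move=> w _; rewrite onem_cos.
  have := normr_sin_le (t * X0 w / 2); move=> /(lerXn2r 2 (normr_ge0 _) (normr_ge0 _)).
  rewrite !real_normK ?num_real// => h.
  apply: (@le_trans _ _ ((t * X0 w / 2) ^+ 2 *+ 2)); first by rewrite lerMn2r.
  by rewrite le_eqVlt; apply/orP; left; apply/eqP; field.
have b0 : 0 <= b by rewrite -bE; apply: Rintegral_ge0 => w _; exact: sqr_ge0.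
rewrite leNgt; apply/negP => vb.
(* If [b < v], then [key] fails at [t ^ 2 = 2 s], because
   [exp (- s v) <= 1 / (1 + s v)]; the addition of 1 keeps the denominator
   positive. *)
pose s := (v - b) / (v * b + 1) / 2.
have vb0 : 0 <= v * b by rewrite mulr_ge0.
have s0 : 0 < s.
  by apply: divr_gt0 => //; apply: divr_gt0; rewrite ?subr_gt0// ltr_wpDl.
have := key (Num.sqrt (2 * s)); rewrite sqr_sqrtr; last by rewrite mulr_ge0// ltW.
have -> : 2 * s * v / 2 = s * v by field.
have -> : 2 * s / 2 * b = s * b by field.
have h1 : expR (- (s * v)) <= (1 + s * v)^-1.
  rewrite expRN lef_pV2 ?posrE ?expR_gt0 ?expR_ge1Dx//.
  by rewrite ltr_wpDr// mulr_ge0// ltW.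
have sv0 : 0 <= s * v by rewrite mulr_ge0// ltW.
have h2 : (1 + s * v)^-1 * (1 + s * v) = 1 by rewrite mulVf// gt_eqF// ltr_wpDr.
move=> h3.
have h4 : 1 - s * b <= (1 + s * v)^-1 by lra.
have h5 : (1 - s * b) * (1 + s * v) <= 1.
  by rewrite -[leRHS]h2 ler_pM2r// ltr_wpDr.
have h6 : s * (v - b) <= s * (s * (v * b)) by nra.
rewrite ler_pM2l// in h6.
have h7 : s * (v * b + 1) = (v - b) / 2.
  by rewrite /s; field; rewrite gt_eqF// ltr_wpDl.
nra.
Qed.

End second_moment.

(** * Inner products and orthonormal bases *)

Section inner_product.
Context {R : realType} {H : normedModType R} (ip : H -> H -> R).
Hypothesis hip : is_inner_product ip.
Implicit Types (x y z h : H) (a : R).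

Lemma ipC x y : ip x y = ip y x. Proof. by case: hip. Qed.

Lemma ip0l y : ip 0 y = 0.
Proof.
by case: hip => _ hl _; have := hl (-1) 0 0 y; rewrite scaler0 addr0 mulN1r addNr.
Qed.

Lemma ipDl x y z : ip (x + y) z = ip x z + ip y z.
Proof. by case: hip => _ hl _; have := hl 1 x y z; rewrite scale1r mul1r. Qed.

Lemma ipZl a x z : ip (a *: x) z = a * ip x z.
Proof.
by case: hip => _ hl _; have := hl a x 0 z; rewrite addr0 ip0l addr0.
Qed.

Lemma ipNl x z : ip (- x) z = - ip x z.
Proof. by rewrite -scaleN1r ipZl mulN1r. Qed.

Lemma ipBl x y z : ip (x - y) z = ip x z - ip y z.
Proof. by rewrite ipDl ipNl. Qed.

Lemma ipDr x y z : ip x (y + z) = ip x y + ip x z.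
Proof. by rewrite ipC ipDl !(ipC x). Qed.

Lemma ipZr a x y : ip x (a *: y) = a * ip x y.
Proof. by rewrite ipC ipZl ipC. Qed.

Lemma ipNr x y : ip x (- y) = - ip x y.
Proof. by rewrite ipC ipNl ipC. Qed.

Lemma ipBr x y z : ip x (y - z) = ip x y - ip x z.
Proof. by rewrite ipDr ipNr. Qed.

Lemma ip0r x : ip x 0 = 0. Proof. by rewrite ipC ip0l. Qed.

Lemma ip_suml n (f : 'I_n -> H) z : ip (\sum_(i < n) f i) z = \sum_(i < n) ip (f i) z.
Proof.
elim: n f => [|n IH] f; first by rewrite !big_ord0 ip0l.
by rewrite !big_ord_recr/= ipDl IH.
Qed.

Lemma ip_sumr n (f : 'I_n -> H) z : ip z (\sum_(i < n) f i) = \sum_(i < n) ip z (f i).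
Proof. by rewrite ipC ip_suml; apply: eq_bigr => i _; rewrite ipC. Qed.

Lemma ipxx x : ip x x = `|x| ^+ 2. Proof. by case: hip. Qed.

Lemma ipxx_ge0 x : 0 <= ip x x. Proof. by rewrite ipxx sqr_ge0. Qed.

Lemma ipxx_eq0 x : ip x x = 0 -> x = 0.
Proof. by rewrite ipxx => /eqP; rewrite sqrf_eq0 normr_eq0 => /eqP. Qed.

Lemma ip_norm_le x y : `|ip x y| <= `|x| * `|y|.
Proof.
have [->|y0] := eqVneq y 0; first by rewrite ip0r !normr0 mulr0.
have yy : 0 < ip y y by rewrite ipxx exprn_gt0// normr_gt0.
have := ipxx_ge0 (x - (ip x y / ip y y) *: y).
rewrite ipBl !ipBr !ipZl !ipZr (ipC y x).
set b := ip x y; set c := ip y y => h.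
have {}h : b ^+ 2 <= ip x x * c.
  have e : ip x x - b / c * b - (b / c * b - b / c * (b / c * c)) = ip x x - b ^+ 2 / c.
    by field; rewrite gt_eqF.
  by rewrite e subr_ge0 ler_pdivrMr// in h.
rewrite -(ler_pXn2r (n := 2))// ?nnegrE ?mulr_ge0//.
by rewrite real_normK ?num_real// exprMn -!ipxx.
Qed.

Lemma ip_continuous h : continuous (ip ^~ h).
Proof.
move=> x; apply/cvgrPdist_le => eps e0.
near=> y; rewrite -ipBl; apply: le_trans (ip_norm_le _ _) _.
have h1 : 0 < `|h| + 1 by rewrite ltr_wpDl.
apply: (@le_trans _ _ (`|x - y| * (`|h| + 1))); first by rewrite ler_wpM2l// lerDl.
rewrite -ler_pdivlMr//.
near: y; apply: cvgr_dist_le; first exact: cvg_id.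
by rewrite divr_gt0.
Unshelve. all: by end_near. Qed.

Variable e : nat -> H.
Hypothesis e_onb : orthonormal_basis ip e.

Lemma onb_ip i j : ip (e i) (e j) = (i == j)%:R. Proof. by case: e_onb. Qed.

Definition onb_proj (N : nat) x : H := \sum_(i < N) ip x (e i) *: e i.

Lemma onb_proj_cvg x : onb_proj ^~ x @ \oo --> x.
Proof.
case: e_onb => _ /(_ x); rewrite /series /onb_proj.
by under eq_fun do rewrite big_mkord.
Qed.

Lemma onb_proj_coord N x i : ip (onb_proj N x) (e i) = (i < N)%:R * ip x (e i).
Proof.
rewrite /onb_proj ip_suml.
under eq_bigr do rewrite ipZl onb_ip.
case: ltnP => iN.
  rewrite (bigD1 (Ordinal iN))//= eqxx mulr1 mul1r big1 ?addr0// => j ji.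
  by rewrite (_ : (j : nat) == i = false) ?mulr0//; apply: contraNF ji => /eqP ji; apply/eqP/val_inj.
rewrite mul0r big1// => j _; rewrite (_ : (j : nat) == i = false) ?mulr0//.
by apply/negbTE; rewrite neq_ltn (leq_trans (ltn_ord j) iN).
Qed.

Lemma onb_proj_ip N x y : ip (onb_proj N x) y = \sum_(i < N) ip x (e i) * ip y (e i).
Proof. by rewrite ip_suml; apply: eq_bigr => i _; rewrite ipZl (ipC (e i)). Qed.

Lemma onb_ext x y : (forall i, ip x (e i) = ip y (e i)) -> x = y.
Proof.
move=> xy; have h : onb_proj ^~ x = onb_proj ^~ y.
  by apply/funext => N; apply: eq_bigr => i _; rewrite xy.
have h1 := @onb_proj_cvg x; rewrite h in h1.
exact: (cvg_unique _ h1 (@onb_proj_cvg y)).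
Qed.

Lemma parseval_cvg x y :
  (fun N => \sum_(i < N) ip x (e i) * ip y (e i)) @ \oo --> ip x y.
Proof.
have := @cvg_comp _ _ _ (onb_proj ^~ x) (ip ^~ y) _ _ _ (@onb_proj_cvg x) (@ip_continuous y x).
apply: cvg_trans; rewrite (_ : _ \o _ = (fun N => \sum_(i < N) ip x (e i) * ip y (e i)))//.
by apply/funext => N; rewrite /= onb_proj_ip.
Qed.

End inner_product.

(** * Borel sets of a separable Hilbert space *)

Section borel_space.
Context {R : realType} {H : completeNormedModType R} (ip : H -> H -> R).
Hypothesis hip : is_inner_product ip.
Variable e : nat -> H.
Hypothesis e_onb : orthonormal_basis ip e.
Hypothesis sepH : separable_space H.

Lemma measurable_fun_gt d (T : measurableType d) (f : T -> R) :
  (forall y, measurable [set x | y < f x]) -> measurable_fun setT f.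
Proof.
move=> mf; apply: (measurability _ (RGenOInfty.measurableE R)) => _ [_ [y ->] <-]; rewrite setTI; have := mf y; congr measurable.
by apply/seteqP; split => x /=; rewrite in_itv/= andbT.
Qed.

Lemma continuous_measurable_borel (f : H -> R) : continuous f ->
  measurable_fun setT (f : borel H -> R).
Proof.
move=> cf; apply: measurable_fun_gt => y; apply: sub_sigma_algebra.
by apply: (@open_comp _ _ f [set z | y < z]); [move=> z _; exact: cf|exact: open_gt].
Qed.

Lemma measurable_ip h : measurable_fun setT (ip ^~ h : borel H -> R).
Proof. have h1 := continuous_measurable_borel (ip_continuous hip (h:=h)). exact: h1. Qed.

(** Finite intersections of coordinate half-spaces: a generating class stable
    under intersection. *)
Definition half_spaces (s : seq (nat * R)) : set H :=
  [set x | all (fun j => j.2 < ip x (e j.1)) s].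

Lemma half_spaces_cat s t : half_spaces (s ++ t) = half_spaces s `&` half_spaces t.
Proof. by apply/seteqP; split=> x; rewrite /half_spaces/= all_cat => /andP. Qed.

Lemma half_spaces_setI_closed : setI_closed (range half_spaces).
Proof. by move=> _ _ [s _ <-] [t _ <-]; exists (s ++ t) => //; rewrite half_spaces_cat. Qed.

Lemma measurable_half_spaces s : measurable (half_spaces s : set (borel H)).
Proof.
elim: s => [|[i y] s IH].
  rewrite (_ : half_spaces [::] = setT)//; by apply/seteqP; split.
rewrite -cat1s half_spaces_cat; apply: measurableI => //.
have := measurable_ip (e i) measurableT (measurable_itv `]y, +oo[).
rewrite setTI; congr measurable; apply/seteqP; split => x /=;
  by rewrite /half_spaces /= in_itv/= !andbT.
Qed.

Let HS := g_sigma_algebraType (range half_spaces).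

Let measurable_coord i : measurable_fun setT (ip ^~ (e i) : HS -> R).
Proof.
apply: measurable_fun_gt => y; apply: sub_sigma_algebra.
by exists [:: (i, y)] => //; apply/seteqP; split => x /=;
  rewrite /half_spaces /= andbT.
Qed.

Let measurable_dist z : measurable_fun setT ((fun x => `|x - z| ^+ 2) : HS -> R).
Proof.
apply: (measurable_fun_cvg (h := fun N (x : HS) => \sum_(i < N) (ip (x : H) (e i) - ip z (e i)) ^+ 2)).
  move=> N; apply: measurable_sum => i.
  by apply: measurable_funX; apply: measurable_funB => //; exact: measurable_coord.
move=> x _; rewrite -(ipxx hip).
have := @parseval_cvg _ _ _ hip _ e_onb (x - z) (x - z).
by under eq_fun do under eq_bigr do rewrite -expr2 (ipBl hip).
Qed.

Let measurable_ball z r : measurable (ball z r : set HS).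
Proof.
have [r0|r0] := leP r 0.
  rewrite (_ : ball z r = set0); first exact: measurable0.
  by rewrite -subset0 => x /=; rewrite -ball_normE /= => h; have := le_lt_trans (normr_ge0 _) h; rewrite ltNge r0.
have := measurable_dist z measurableT (measurable_itv `]-oo, r ^+ 2[).
rewrite setTI; congr measurable; apply/seteqP; split => x /=; rewrite -ball_normE /= in_itv/=.
  by rewrite ltr_pXn2r ?nnegrE ?(ltW r0)// distrC.
by rewrite distrC ltr_pXn2r ?nnegrE ?(ltW r0)//.
Qed.

(** The squared distance to a point is a limit of functions of finitely many
    coordinates, so balls are in the generated sigma-algebra; by separability
    every open set is a countable union of balls. *)
Lemma borel_half_spaces : @measurable _ (borel H) = <<s range half_spaces >>.
Proof.
apply/seteqP; split => A.
  apply: smallest_sub; first exact: smallest_sigma_algebra.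
  move=> U oU; have [D cD dD] := sepH.
  pose F (k : nat) := \bigcup_(z in D `&` [set z | ball z k.+1%:R^-1 `<=` U]) ball z k.+1%:R^-1.
  have -> : U = \bigcup_k F k.
    apply/seteqP; split => x; last by move=> [k _ [z [_ zU] /zU]].
    move=> Ux.
    have /nbhs_ballP [r /= r0 xr] : nbhs x U by exact: open_nbhs_nbhs.
    have [k kr] : exists k : nat, k.+1%:R^-1 < r / 2.
      have := @cvg_harmonic R; move=> /cvgrPdist_lt /(_ (r / 2)).
      rewrite divr_gt0// => /(_ isT) [N _ /(_ N (leqnn _))] /=.
      by rewrite sub0r normrN ger0_norm ?invr_ge0//; exists N.
    have [z [zx Dz]] : ball x (k.+1%:R^-1) `&` D !=set0.
      apply: dD; last exact: ball_open.
      by exists x; apply: ballxx; rewrite invr_gt0.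
    exists k => //; exists z; last exact: ball_sym.
    split => //= y zy; apply: xr.
    apply: (@le_ball _ _ _ (k.+1%:R^-1 + k.+1%:R^-1)); last exact: (ball_triangle zx zy).
    by rewrite ltW// [ltRHS]splitr ltrD.
  apply: (@bigcupT_measurable _ HS) => k; rewrite /F.
  set D' := (X in \bigcup_(z in X) _).
  have [->|/set0P[r Dr]] := eqVneq D' set0; first by rewrite bigcup_set0.
  have /countable_injP[f injf] : countable D'.
    by apply: (sub_countable _ cD); apply: subset_card_le => z [].
  rewrite -(injpinv_image (cst r) injf) bigcup_image.
  by apply: (@bigcup_measurable _ HS) => m _; exact: measurable_ball.
apply: smallest_sub; first exact: sigma_algebra_measurable.
by move=> _ [s _ <-]; exact: measurable_half_spaces.
Qed.

Lemma measurable_fun_borel d (T : measurableType d) (f : T -> H) :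
  (forall i, measurable_fun setT (fun x => ip (f x) (e i))) ->
  measurable_fun setT (f : T -> borel H).
Proof.
move=> mf; apply: (measurability _ borel_half_spaces) => _ [_ [s _ <-] <-].
rewrite setTI; elim: s => [|[i y] s IH].
  rewrite (_ : _ @^-1` _ = setT)//; by apply/seteqP; split.
rewrite -cat1s half_spaces_cat preimage_setI; apply: measurableI => //.
have := mf i measurableT _ (measurable_itv `]y, +oo[).
rewrite setTI; congr measurable; apply/seteqP; split => x /=;
  by rewrite /half_spaces /= in_itv/= !andbT.
Qed.

End borel_space.

(** * Uniqueness of a measure with given characteristic function *)

Section sign_polynomials.
Context {R : realType}.

(** Newton's iteration [a |-> a (3 - a ^ 2) / 2], whose attracting fixed points
    are 1 and -1. *)
Fixpoint sign_poly (n : nat) : {poly R} :=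
  if n is m.+1 then (3 / 2) *: sign_poly m - 2^-1 *: (sign_poly m) ^+ 3 else 'X.

Lemma sign_polyS n (u : R) :
  (sign_poly n.+1).[u] = (sign_poly n).[u] * (3 - (sign_poly n).[u] ^+ 2) / 2.
Proof. by rewrite /= hornerD hornerN !hornerZ horner_exp; field. Qed.

Lemma sign_poly_norm n (u : R) : `|u| <= 1 -> `|(sign_poly n).[u]| <= 1.
Proof.
move=> u1; elim: n => [|n]; first by rewrite hornerX.
rewrite sign_polyS; set a := (sign_poly n).[u]; rewrite !ler_norml => /andP[h1 h2].
have e1 : 1 - a * (3 - a ^+ 2) / 2 = (1 - a) ^+ 2 * ((2 + a) / 2) by field.
have e2 : 1 + a * (3 - a ^+ 2) / 2 = (1 + a) ^+ 2 * ((2 - a) / 2) by field.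
have h3 : 0 <= 1 - a * (3 - a ^+ 2) / 2.
  by rewrite e1 mulr_ge0 ?sqr_ge0//; lra.
have h4 : 0 <= 1 + a * (3 - a ^+ 2) / 2.
  by rewrite e2 mulr_ge0 ?sqr_ge0//; lra.
by apply/andP; split; lra.
Qed.

Lemma sign_polyN n (u : R) : (sign_poly n).[- u] = - (sign_poly n).[u].
Proof.
elim: n => [|n IH]; first by rewrite !hornerX.
by rewrite !sign_polyS IH; field.
Qed.

Lemma sign_poly0 n : (sign_poly n).[0 : R] = 0.
Proof.
by elim: n => [|n IH]; [rewrite hornerX|rewrite sign_polyS IH mul0r mul0r].
Qed.

(** The distance to 1 shrinks at least by the factor [1 - u / 2], because the
    iterates increase. *)
Lemma sign_poly_cvg (u : R) : 0 < u -> u <= 1 ->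
  (fun n => (sign_poly n).[u]) @ \oo --> (1 : R).
Proof.
move=> u0 u1.
have h n : 0 <= 1 - (sign_poly n).[u] <= (1 - u / 2) ^+ n /\ u <= (sign_poly n).[u].
  elim: n => [|n [/andP[h1 h2] h3]].
    by rewrite hornerX expr0; split => //; apply/andP; split; lra.
  rewrite sign_polyS [_ ^+ n.+1]exprS; set a := (sign_poly n).[u] in h1 h2 h3 *.
  have e : 1 - a * (3 - a ^+ 2) / 2 = (1 - a) * ((1 - a) * (2 + a) / 2) by field.
  have a1 : a <= 1 by lra.
  split; last by nra.
  rewrite e; apply/andP; split; first by apply: mulr_ge0 => //; nra.
  rewrite [(1 - u / 2) * _]mulrC; apply: ler_pM => //; nra.
have g0 : (fun n => (1 - u / 2) ^+ n) @ \oo --> (0 : R).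
  by apply: cvg_expr; rewrite ger0_norm; lra.
have h0 : (fun n => 1 - (sign_poly n).[u]) @ \oo --> (0 : R).
  apply: (squeeze_cvgr _ (cvg_cst 0) g0).
  by apply: nearW => n; case: (h n).
have h1 : (fun n => 1 - (1 - (sign_poly n).[u])) @ \oo --> (1 - 0 : R).
  by apply: cvgB => //; exact: cvg_cst.
by move: h1; rewrite subr0; under eq_fun do rewrite subKr.
Qed.

(** Polynomials converging boundedly on [`[-1, 1]] to the indicator of the
    positive numbers. *)
Definition pos_poly n : {poly R} := 2^-1 *: (sign_poly n ^+ 2 + sign_poly n).

Lemma pos_poly_norm n (u : R) : `|u| <= 1 -> `|(pos_poly n).[u]| <= 1.
Proof.
move=> /(sign_poly_norm n); rewrite /pos_poly !hornerE.
set a := (sign_poly n).[u]; rewrite !ler_norml => /andP[h1 h2].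
by apply/andP; split; nra.
Qed.

Lemma pos_poly_cvg (u : R) : `|u| <= 1 ->
  (fun n => (pos_poly n).[u]) @ \oo --> ((0 < u)%R%:R : R).
Proof.
move=> u1.
have E n : (pos_poly n).[u] = 2^-1 * ((sign_poly n).[u] * (sign_poly n).[u] + (sign_poly n).[u]).
  by rewrite /pos_poly !hornerE expr2.
have lim (l : R) : (fun n => (sign_poly n).[u]) @ \oo --> l ->
    (fun n => (pos_poly n).[u]) @ \oo --> 2^-1 * (l * l + l).
  move=> h; under eq_fun do rewrite E.
  by apply: cvgM; [exact: cvg_cst|apply: cvgD => //; exact: cvgM].
move: u1; rewrite ler_norml => /andP[u1 u2].
have [u0|u0|u0] := ltgtP 0 u.
- by have := lim _ (sign_poly_cvg u0 u2); rewrite (_ : 2^-1 * _ = 1)//; field.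
- have nu0 : 0 < - u by lra.
  have nu1 : - u <= 1 by lra.
  have : (fun n => - (sign_poly n).[- u]) @ \oo --> (- 1 : R).
    by apply: cvgN; exact: sign_poly_cvg.
  under eq_fun do rewrite sign_polyN opprK.
  by move=> /lim; rewrite (_ : 2^-1 * _ = 0)//; field.
- have : (fun n => (sign_poly n).[u]) @ \oo --> (0 : R).
    by rewrite -u0; under eq_fun do rewrite sign_poly0; exact: cvg_cst.
  by move=> /lim; rewrite (_ : 2^-1 * _ = 0)//; field.
Qed.

End sign_polynomials.

Section cos_determining.
Context {R : realType} d (T : measurableType d) (m1 m2 : probability T R).
Variables (X : T -> R).
Hypothesis mX : measurable_fun setT X.
Implicit Types (G : T -> R) (t th s y c : R) (p : {poly R}).

(** Bounded weights [G] for which the two signed measures of densities [G]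
    have the same characteristic function along [X]. *)
Definition same_cos G := [/\ measurable_fun setT G, exists c, forall w, `|G w| <= c
  & forall t th, \int[m1]_w (G w * cos (t * X w + th)) =
                 \int[m2]_w (G w * cos (t * X w + th))].

Let mcos t th : measurable_fun setT (fun w => cos (t * X w + th)).
Proof.
apply: measurableT_comp; first exact: continuous_measurable_fun (@continuous_cos R).
by apply: measurable_funD => //; exact: measurable_funM.
Qed.

Let int_same_cos (m : probability T R) G c t th : measurable_fun setT G ->
  (forall w, `|G w| <= c) ->
  m.-integrable setT (EFin \o (fun w => G w * cos (t * X w + th))).
Proof.
move=> mG Gc; apply: (@bounded_integrable _ _ _ _ _ c) => [|w].
  exact: measurable_funM.
by rewrite normrM (le_trans _ (Gc w))// ler_piMr// cos_max.
Qed.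

Lemma same_cosD G1 G2 : same_cos G1 -> same_cos G2 -> same_cos (fun w => G1 w + G2 w).
Proof.
move=> [mG1 [c1 b1] e1] [mG2 [c2 b2] e2]; split.
- exact: measurable_funD.
- exists (c1 + c2) => w; apply: le_trans (ler_normD _ _) _; exact: lerD.
- move=> t th; under eq_Rintegral do rewrite mulrDl.
  under [RHS]eq_Rintegral do rewrite mulrDl.
  rewrite !RintegralD ?e1 ?e2//; try exact: int_same_cos b1; exact: int_same_cos b2.
Qed.

Lemma same_cosZ k G : same_cos G -> same_cos (fun w => k * G w).
Proof.
move=> [mG [c b] e]; split.
- exact: measurable_funM.
- by exists (`|k| * c) => w; rewrite normrM ler_wpM2l.
- move=> t th; under eq_Rintegral do rewrite -mulrA.
  under [RHS]eq_Rintegral do rewrite -mulrA.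
  by rewrite !RintegralZl ?e//; exact: int_same_cos b.
Qed.

Lemma same_cosM s y G : same_cos G -> same_cos (fun w => G w * cos (s * X w + y)).
Proof.
move=> [mG [c b] e]; split.
- exact: measurable_funM.
- by exists c => w; rewrite normrM (le_trans _ (b w))// ler_piMr// cos_max.
- move=> t th.
  have E w : G w * cos (s * X w + y) * cos (t * X w + th) =
      2^-1 * (G w * cos ((s + t) * X w + (y + th))) + 2^-1 * (G w * cos ((s - t) * X w + (y - th))).
    rewrite (_ : (s + t) * X w + (y + th) = (s * X w + y) + (t * X w + th)); last by ring.
    rewrite (_ : (s - t) * X w + (y - th) = (s * X w + y) - (t * X w + th)); last by ring.
    move: (s * X w + y) (t * X w + th) => a1 a2.
    by rewrite cosB cosD; field.
  under eq_Rintegral do rewrite E.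
  under [RHS]eq_Rintegral do rewrite E.
  rewrite !RintegralD//; do ?by apply/integrableZ_EFin/(int_same_cos _ _ _ _ b).
  by rewrite !RintegralZl ?e//; exact: int_same_cos b.
Qed.

Lemma same_cos_cvg (G_ : nat -> T -> R) G c :
  (forall n, same_cos (G_ n)) -> (forall n w, `|G_ n w| <= c) ->
  (forall w, G_ ^~ w @ \oo --> G w) -> same_cos G.
Proof.
move=> sG bG cG.
have mG : measurable_fun setT G.
  by apply: (measurable_fun_cvg (h := G_)) => // n; case: (sG n).
split => //.
  exists c => w; have h : `|G_ n w| @[n --> \oo] --> `|G w| by apply: cvg_norm; exact: cG.
  rewrite -(cvg_lim _ h)//; apply: limr_le; first by apply/cvg_ex; eexists; exact: h.
  exact: nearW.
move=> t th.
have h (m : probability T R) : \int[m]_w (G_ n w * cos (t * X w + th)) @[n --> \oo] -->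
    \int[m]_w (G w * cos (t * X w + th)).
  apply: (@Rintegral_bounded_cvg _ _ _ _ _ _ c).
  - by move=> n; case: (sG n) => mGn _ _; exact: measurable_funM.
  - exact: measurable_funM.
  - by move=> n w; rewrite normrM (le_trans _ (bG n w))// ler_piMr// cos_max.
  - by move=> w; apply: cvgM => //; exact: cvg_cst.
have h1 := h m1; rewrite (_ : (fun n => _) = (fun n => \int[m2]_w (G_ n w * cos (t * X w + th)))) in h1.
  by rewrite -(cvg_lim _ h1)// -[RHS](cvg_lim _ (h m2)).
by apply/funext => n; case: (sG n).
Qed.

Lemma same_cos_poly p s y G : same_cos G -> same_cos (fun w => G w * p.[cos (s * X w + y)]).
Proof.
elim/poly_ind: p G => [|p c IH] G sG.
  have := same_cosZ 0 sG; congr same_cos; apply/funext => w.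
  by rewrite horner0 mul0r mulr0.
have := same_cosD (IH _ (same_cosM s y sG)) (same_cosZ c sG).
by congr same_cos; apply/funext => w; rewrite !hornerE; ring.
Qed.

(** The indicator of [X > y] is reached from trigonometric polynomials in [X]:
    the polynomials above turn [sin ((X - y) / k)] into the indicator of its
    positivity set, a periodic set which fills the half-line as [k] grows. *)
Lemma same_cos_gt y G : same_cos G -> same_cos (fun w => G w * (y < X w)%R%:R).
Proof.
move=> sG; have [mG [c b] _] := sG.
have cS k w : sin ((X w - y) / k.+1%:R) = cos (k.+1%:R^-1 * X w + (- (y / k.+1%:R) - pi / 2)).
  by rewrite -sinDpihalf; congr sin; field; rewrite addrC natr1 pnatr_eq0.
have Nc (u : R) (G' : T -> R) w (f : R) : `|G' w| <= c -> `|f| <= 1 -> `|G' w * f| <= c.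
  by move=> h1 h2; rewrite normrM (le_trans _ h1)// ler_piMr.
apply: (@same_cos_cvg (fun k w => G w * (0 < sin ((X w - y) / k.+1%:R))%R%:R) _ c).
- move=> k.
  apply: (@same_cos_cvg (fun n w => G w * (pos_poly n).[sin ((X w - y) / k.+1%:R)]) _ c).
  + move=> n; have := same_cos_poly (pos_poly n) k.+1%:R^-1 (- (y / k.+1%:R) - pi / 2) sG.
    by congr same_cos; apply/funext => w; rewrite cS.
  + by move=> n w; apply: (Nc 0) => //; apply: pos_poly_norm; exact: sin_max.
  + by move=> w; apply: cvgM; [exact: cvg_cst|apply: pos_poly_cvg; exact: sin_max].
- by move=> k w; apply: (Nc 0) => //; case: (0 < _)%R; rewrite ?normr1 ?normr0.
- move=> w; apply: cvgM; first exact: cvg_cst.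
  apply: cvg_near_cst; near=> k.
  have k0 : 0 < k.+1%:R :> R by [].
  have hk : `|(X w - y) / k.+1%:R| < pi.
    rewrite normrM normfV normr_nat ltr_pdivrMr// -ltr_pdivrMl ?pi_gt0//.
    apply: (@lt_trans _ _ k%:R); last by rewrite ltr_nat.
    near: k; exact: nbhs_infty_gtr.
  congr (_%:R : R); congr nat_of_bool.
  have [yX|yX|yX] := ltgtP y (X w).
  - apply/idP; apply: sin_gt0_pi; rewrite divr_gt0 ?subr_gt0//=.
    by apply: le_lt_trans hk; exact: ler_norm.
  - apply/negbTE; rewrite -leNgt -oppr_ge0 -sinN; apply: sin_ge0_pi.
    rewrite -mulNr opprB divr_ge0 ?subr_ge0 ?(ltW yX)//=.
    by rewrite -opprB mulNr; apply: ltW; apply: le_lt_trans hk; rewrite -normrN ler_norm.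
  - by rewrite yX subrr mul0r sin0 ltxx.
Unshelve. all: by end_near. Qed.

End cos_determining.

(** A Borel probability on a separable Hilbert space is determined by its
    characteristic function.  Indicators of half-spaces are multiplied in one
    at a time: after each of them the cosines of all functionals still have
    equal integrals, because a product of cosines is a sum of cosines. *)
Lemma borel_probability_ext (R : realType) (H : completeNormedModType R)
    (ip : H -> H -> R) (hip : is_inner_product ip) (e : nat -> H)
    (e_onb : orthonormal_basis ip e) (sepH : separable_space H)
    (g1 g2 : probability (borel H) R) :
  (forall h th, \int[g1]_x cos (ip x h + th) = \int[g2]_x cos (ip x h + th)) ->
  forall A, measurable A -> g1 A = g2 A.
Proof.
move=> g12.
have mip h := measurable_ip hip h.
have mcosip h th : measurable_fun setT (fun x : borel H => cos (ip x h + th)).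
  apply: measurableT_comp; first exact: continuous_measurable_fun (@continuous_cos R).
  by apply: measurable_funD.
pose chi s (x : borel H) : R := (all (fun j => j.2 < ip x (e j.1)) s)%:R.
have chi1 s x : `|chi s x| <= 1 by rewrite /chi; case: all; rewrite ?normr1 ?normr0.
have chiE s : chi s = \1_(half_spaces ip e s).
  apply/funext => x; rewrite indicE; congr (_%:R : R); congr nat_of_bool.
  by apply/idP/idP => [?|]; rewrite ?inE.
have mchi s : measurable_fun setT (chi s).
  by rewrite chiE; apply: measurable_indic; exact: measurable_half_spaces.
have int_chi (g : probability (borel H) R) s h th :
    g.-integrable setT (EFin \o (fun x => chi s x * cos (ip x h + th))).
  apply: (@bounded_integrable _ _ _ _ _ 1) => [|x]; first exact: measurable_funM.
  by rewrite normrM mulr_ile1// cos_max.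
have claim s : forall h th, \int[g1]_x (chi s x * cos (ip x h + th)) =
    \int[g2]_x (chi s x * cos (ip x h + th)).
  elim: s => [|[i y] s IH] h th.
    under eq_Rintegral do rewrite mul1r.
    by under [RHS]eq_Rintegral do rewrite mul1r.
  have sc : same_cos g1 g2 (ip ^~ (e i)) (fun x => chi s x * cos (ip x h + th)).
    split.
    - exact: measurable_funM.
    - by exists 1 => x; rewrite normrM mulr_ile1// cos_max.
    - move=> t r.
      have E (x : H) : chi s x * cos (ip x h + th) * cos (t * ip x (e i) + r) =
          2^-1 * (chi s x * cos (ip x (h + t *: e i) + (th + r)))
          + 2^-1 * (chi s x * cos (ip x (h - t *: e i) + (th - r))).
        rewrite (ipBr hip) (ipDr hip) (ipZr hip).
        rewrite (_ : ip x h + _ + (th + r) = (ip x h + th) + (t * ip x (e i) + r)); last by ring.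
        rewrite (_ : ip x h - _ + (th - r) = (ip x h + th) - (t * ip x (e i) + r)); last by ring.
        move: (ip x h + th) (t * ip x (e i) + r) => a1 a2.
        by rewrite cosB cosD; field.
      under eq_Rintegral do rewrite E.
      under [RHS]eq_Rintegral do rewrite E.
      rewrite !RintegralD//; do ?by apply/integrableZ_EFin/int_chi.
      rewrite !RintegralZl//; do ?exact: int_chi.
      by rewrite !IH.
  have [_ _ /(_ 0 0)] := same_cos_gt (mip (e i)) y sc.
  have E (x : H) : chi s x * cos (ip x h + th) * (y < ip x (e i))%R%:R * cos (0 * ip x (e i) + 0) =
      chi ((i, y) :: s) x * cos (ip x h + th).
    by rewrite mul0r addr0 cos0 mulr1 /chi /= mulrAC -natrM mulnb andbC.
  under eq_Rintegral do rewrite E.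
  by under [RHS]eq_Rintegral do rewrite E.
have gHS s : g1 (half_spaces ip e s) = g2 (half_spaces ip e s).
  have := claim s 0 0.
  have E (x : H) : chi s x * cos (ip x 0 + 0) = \1_(half_spaces ip e s) x.
    by rewrite (ip0r hip) addr0 cos0 mulr1 chiE.
  under eq_Rintegral do rewrite E.
  under [RHS]eq_Rintegral do rewrite E.
  have mS := measurable_half_spaces hip e s.
  rewrite /Rintegral !integral_indic// !setIT => h.
  by rewrite -(fineK (fin_num_measure g1 _ mS)) h fineK// fin_num_measure.
move=> A; rewrite (borel_half_spaces hip e_onb sepH).
pose g (n : nat) : set (borel H) := half_spaces ip e [::].
have Gm : range (half_spaces ip e) `<=` @measurable _ (borel H).
  by move=> _ [s _ <-]; exact: measurable_half_spaces.
have gG n : range (half_spaces ip e) (g n) by exists [::].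
have gT : \bigcup_k g k = setT by apply/seteqP; split => // x _; exists 0%N.
have fin n : (g1 (g n) < +oo)%E.
  by rewrite -ge0_fin_numE// fin_num_measure//; exact: (measurable_half_spaces hip e [::]).
have GE B : range (half_spaces ip e) B -> g1 B = g2 B by move=> [s _ <-].
move=> mA; exact: (@g_sigma_algebra_measure_unique _ R (borel H) _ Gm _ gG gT g1 g2
  (@half_spaces_setI_closed _ _ ip e) GE fin A mA).
Qed.

(** * Sets of probability one, images and mixtures *)

Section probability_one.
Context {R : realType} d (T : measurableType d) (P : probability T R).
Implicit Types A B : set T.

Lemma probability_one_ae A : measurable A -> P A = 1%E -> {ae P, forall x, A x}.
Proof.
move=> mA PA; exists (~` A); split => //; first exact: measurableC.
by rewrite [LHS]probability_setC// PA subee.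
Qed.

Lemma ae_nonempty (Q : T -> Prop) : {ae P, forall x, Q x} -> exists x, Q x.
Proof.
move=> [N [mN PN QN]]; apply: contrapT => h.
have NT : N = setT.
  by apply/seteqP; split => // x _; apply: QN => /= Qx; apply: h; exists x.
by have := probability_setT P; rewrite -NT PN => /esym/eqP; rewrite onee_eq0.
Qed.

Lemma Rintegral_ae_eq (f g : T -> R) :
  measurable_fun setT f -> measurable_fun setT g ->
  {ae P, forall x, f x = g x} -> \int[P]_x f x = \int[P]_x g x.
Proof.
move=> mf mg fg; rewrite /Rintegral; congr fine; apply: ae_eq_integral => //.
- exact/measurable_EFinP.
- exact/measurable_EFinP.
- by apply: filterS fg => x -> _.
Qed.

End probability_one.

Definition image_probability (R : realType) d d' (T : measurableType d)
    (T' : measurableType d') (P : probability T R) (f : T -> T')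
    (mf : measurable_fun setT f) : probability T' R :=
  distribution P (mfun_Sub (mem_set mf)).

Section image_probability.
Context {R : realType} d d' (T : measurableType d) (T' : measurableType d').
Variables (P : probability T R) (f : T -> T') (mf : measurable_fun setT f).

Lemma image_probabilityE A : image_probability P mf A = P (f @^-1` A).
Proof. by []. Qed.

Lemma Rintegral_image (h : T' -> R) c : measurable_fun setT h ->
  (forall y, `|h y| <= c) ->
  \int[image_probability P mf]_y h y = \int[P]_x h (f x).
Proof.
move=> mh hc; rewrite /Rintegral /image_probability; congr fine.
rewrite integral_pushforward//; first exact/measurable_EFinP.
apply: (@bounded_integrable _ _ _ _ _ c); last by move=> x; exact: hc.
exact: (measurableT_comp mh mf).
Qed.

End image_probability.

(** The law of the second coordinate when the first one has law [P] and the
    second one has conditional law [k]. *)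
Definition mixture (R : realType) d d' (T : measurableType d)
    (T' : measurableType d') (P : probability T R) (k : R.-pker T ~> T')
    (A : set T') : \bar R := (\int[P]_w k w A)%E.

Section mixture.
Context {R : realType} d d' (T : measurableType d) (T' : measurableType d').
Variables (P : probability T R) (k : R.-pker T ~> T').

Let mixture0 : mixture P k set0 = 0%E.
Proof. by rewrite /mixture (eq_integral (cst 0%E)) ?integral0// => w _; rewrite measure0. Qed.

Let mixture_ge0 A : (0 <= mixture P k A)%E.
Proof. exact: integral_ge0. Qed.

Let mixture_sigma_additive : semi_sigma_additive (mixture P k).
Proof.
move=> U mU tU mUU; rewrite [X in _ --> X](_ : _ =
    (\int[P]_y (\sum_(n <oo) k y (U n)))%E); last first.
  apply: eq_integral => V _.
  by apply/esym/cvg_lim => //; exact/measure_semi_sigma_additive.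
apply/cvg_closeP; split.
  by apply: is_cvg_nneseries => n _ _; exact: integral_ge0.
rewrite closeE// integral_nneseries// => n.
exact: measurable_kernel.
Qed.

HB.instance Definition _ := isMeasure.Build _ _ _ (mixture P k)
  mixture0 mixture_ge0 mixture_sigma_additive.

Let mixture_setT : mixture P k setT = 1%E.
Proof.
rewrite /mixture (eq_integral (cst 1%E)).
  by rewrite integral_cst// mul1e; exact: probability_setT.
by move=> w _; exact: prob_kernel.
Qed.

HB.instance Definition _ := Measure_isProbability.Build _ _ _ (mixture P k) mixture_setT.

Lemma integral_mixture (f : T' -> \bar R) : (forall z, 0 <= f z)%E ->
  measurable_fun setT f ->
  (\int[mixture P k]_z f z = \int[P]_w \int[k w]_z f z)%E.
Proof.
move=> f0 mf.
have mP : measurable_fun setT (fun _ : unit => P : pprobability T R) by exact: measurable_cst.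
exact: (@integral_kcomp _ _ _ unit T T' R (kprobability mP) (kernel.kernel_snd k) tt f f0 mf).
Qed.

End mixture.

(** * Gaussian measures through their characteristic function *)

(** [B h] is the variance of the functional [ip x h].  The phase [th] makes the
    cosine account for the complex exponential. *)
Definition gaussian_cf (R : realType) (H : completeNormedModType R)
    (ip : H -> H -> R) (g : probability (borel H) R) (m : H) (B : H -> R) : Prop :=
  forall h th, \int[g]_x cos (ip x h + th) = cos (ip m h + th) * expR (- (B h / 2)).

Section gaussian_cf.
Context {R : realType} {H : completeNormedModType R} (ip : H -> H -> R).
Hypothesis hip : is_inner_product ip.
Variable e : nat -> H.
Hypothesis e_onb : orthonormal_basis ip e.
Hypothesis sepH : separable_space H.
Implicit Types (g : probability (borel H) R) (m h : H) (B : H -> R).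

Lemma measurable_cos_ip h th :
  measurable_fun setT (fun x : borel H => cos (ip x h + th)).
Proof.
apply: measurableT_comp; first exact: continuous_measurable_fun (@continuous_cos R).
by apply: measurable_funD => //; exact: measurable_ip.
Qed.

Lemma is_gaussian_cf g m (S : H -> H) : (forall h, 0 <= ip (S h) h) ->
  is_gaussian ip g m S -> gaussian_cf ip g m (fun h => ip (S h) h).
Proof.
move=> S0 gG h th.
have hn : has_normal_law g (ip ^~ h : borel H -> R) (ip m h) (ip (S h) h).
  by move=> A mA; exact: gG.
have := normal_law_cos th 1 (measurable_ip hip h) (S0 h) hn.
rewrite mul1r expr1n mul1r => <-.
by apply: eq_Rintegral => x _; rewrite mul1r.
Qed.

Lemma gaussian_cf_ext g1 g2 m B : gaussian_cf ip g1 m B -> gaussian_cf ip g2 m B ->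
  forall A, measurable A -> g1 A = g2 A.
Proof.
move=> h1 h2; apply: (borel_probability_ext hip e_onb sepH) => h th.
by rewrite h1 h2.
Qed.

Lemma gaussian_cf_affine g m B (phi : H -> H)
    (mphi : measurable_fun setT (phi : borel H -> borel H)) (phiT : H -> H) (a : H) :
  (forall x h, ip (phi x) h = ip x (phiT h) + ip a h) ->
  gaussian_cf ip g m B ->
  gaussian_cf ip (image_probability g mphi) (phi m) (B \o phiT).
Proof.
move=> phiE gG h th.
rewrite (@Rintegral_image _ _ _ _ _ _ _ _ _ 1); last 2 first.
- exact: measurable_cos_ip.
- by move=> y; exact: cos_max.
under eq_Rintegral do rewrite phiE -addrA.
by rewrite gG phiE addrA.
Qed.

Lemma gaussian_cf_invariant g m B (phi : H -> H) (phiT : H -> H) (a : H) :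
  measurable_fun setT (phi : borel H -> borel H) ->
  (forall x h, ip (phi x) h = ip x (phiT h) + ip a h) ->
  phi m = m -> (forall h, B (phiT h) = B h) ->
  gaussian_cf ip g m B ->
  forall A : set (borel H), measurable A -> g (phi @^-1` A) = g A.
Proof.
move=> mphi phiE pm pB gG A mA.
rewrite -(image_probabilityE g mphi); apply: (gaussian_cf_ext _ gG mA).
have := gaussian_cf_affine mphi phiE gG.
rewrite pm (_ : B \o phiT = B)//; exact/funext.
Qed.

End gaussian_cf.

(** * Measurable linear functionals of a Gaussian measure *)

Section reflections.
Context {R : realType} {H : completeNormedModType R} (ip : H -> H -> R).
Hypothesis hip : is_inner_product ip.
Variable e : nat -> H.
Hypothesis e_onb : orthonormal_basis ip e.
Hypothesis sepH : separable_space H.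

(** The reflection fixing the first [N] basis vectors and changing the sign of
    the others. *)
Definition refl (N : nat) (x : H) : H := 2 *: onb_proj ip e N x - x.

Lemma refl_coord N x i :
  ip (refl N x) (e i) = if (i < N)%N then ip x (e i) else - ip x (e i).
Proof.
rewrite /refl (ipBl hip) (ipZl hip) (onb_proj_coord hip e_onb).
by case: ltnP => _ /=; ring.
Qed.

Lemma refl_adj N x h : ip (refl N x) h = ip x (refl N h).
Proof.
rewrite /refl (ipBl hip) (ipBr hip) (ipZl hip) (ipZr hip).
rewrite (onb_proj_ip hip) (ipC hip x (onb_proj _ _ _ _)) (onb_proj_ip hip).
by congr (2 * _ - _); apply: eq_bigr => i _; rewrite mulrC.
Qed.

Lemma measurable_refl N : measurable_fun setT (refl N : borel H -> borel H).
Proof.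
apply: (measurable_fun_borel hip e_onb sepH) => i.
under eq_fun do rewrite refl_adj.
exact: measurable_ip.
Qed.

Variable g : probability (borel H) R.
Hypothesis g_refl : forall N (A : set (borel H)), measurable A ->
  g (refl N @^-1` A) = g A.

Lemma Rintegral_refl N (f : borel H -> R) c : measurable_fun setT f ->
  (forall x, `|f x| <= c) -> \int[g]_x f (refl N x) = \int[g]_x f x.
Proof.
move=> mf fc; rewrite -(Rintegral_image g (measurable_refl N) mf fc).
rewrite /Rintegral; congr fine; apply: eq_measure_integral => A mA _.
exact: g_refl.
Qed.

(** Stability under reflection of far coordinates, for the distance in mean.
    Every bounded measurable function turns out to be stable
    ([refl_stable_bounded]). *)
Definition refl_stable (f : borel H -> R) := [/\ measurable_fun setT f,
  exists c, forall x, `|f x| <= c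
  & \int[g]_x `|f (refl N x) - f x| @[N --> \oo] --> (0 : R)].

Let bdd_int (f : borel H -> R) c : measurable_fun setT f -> (forall x, `|f x| <= c) ->
  g.-integrable setT (EFin \o f).
Proof. exact: bounded_integrable. Qed.

Let mf_refl (f : borel H -> R) N : measurable_fun setT f ->
  measurable_fun setT (fun x : borel H => f (refl N x)).
Proof. by move=> mf; exact: (measurableT_comp mf (measurable_refl N)). Qed.

Let int_diff (f f' : borel H -> R) c c' : measurable_fun setT f -> measurable_fun setT f' ->
  (forall x, `|f x| <= c) -> (forall x, `|f' x| <= c') ->
  g.-integrable setT (EFin \o (fun x => `|f x - f' x|)).
Proof.
move=> mf mf' fc fc'; apply: (@bdd_int _ (c + c')).
  by apply: measurableT_comp => //; exact: measurable_funB.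
by move=> x; rewrite normr_id (le_trans (ler_normB _ _))// lerD.
Qed.

(** Stability is closed under approximation in mean: by invariance the
    approximation error is the same before and after the reflection. *)
Lemma refl_stable_approx (f : borel H -> R) c : measurable_fun setT f ->
  (forall x, `|f x| <= c) ->
  (forall eps, 0 < eps -> exists2 f', refl_stable f' & \int[g]_x `|f x - f' x| <= eps) ->
  refl_stable f.
Proof.
move=> mf fc happ; split => //; first by exists c.
apply/cvgr0Pnorm_le => eps e0.
have e3 : 0 < eps / 3 by rewrite divr_gt0.
have [f' [mf' [c' fc'] df'] hf] := happ _ e3.
move: df' => /cvgr0Pnorm_le /(_ _ e3); apply: filterS => N hN.
have Tc (x : borel H) : `|f (refl N x)| <= c by exact: fc.
have Tc' (x : borel H) : `|f' (refl N x)| <= c' by exact: fc'.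
have i1 : g.-integrable setT (EFin \o (fun x => `|f (refl N x) - f x|)).
  exact: (int_diff (mf_refl N mf) mf Tc fc).
have i2 : g.-integrable setT (EFin \o (fun x => `|f (refl N x) - f' (refl N x)|)).
  exact: (int_diff (mf_refl N mf) (mf_refl N mf') Tc Tc').
have i3 : g.-integrable setT (EFin \o (fun x => `|f' (refl N x) - f' x|)).
  exact: (int_diff (mf_refl N mf') mf' Tc' fc').
have i4 : g.-integrable setT (EFin \o (fun x => `|f x - f' x|)).
  exact: (int_diff mf mf' fc fc').
have i23 := integrableD_EFin i2 i3.
have i234 := integrableD_EFin i23 i4.
rewrite ger0_norm; last by apply: Rintegral_ge0 => x _.
apply: (@le_trans _ _ (\int[g]_x (`|f (refl N x) - f' (refl N x)| +
    `|f' (refl N x) - f' x| + `|f x - f' x|))).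
  apply: le_Rintegral => // x _.
  rewrite [`|f x - f' x|]distrC -[X in `|X| <= _](_ : (f (refl N x) - f' (refl N x)) + (f' (refl N x) - f' x) + (f' x - f x) = _); last by ring.
  by apply: le_trans (ler_normD _ _) _; rewrite lerD2r ler_normD.
rewrite !RintegralD//.
have -> : \int[g]_x `|f (refl N x) - f' (refl N x)| = \int[g]_x `|f x - f' x|.
  apply: (@Rintegral_refl N (fun x => `|f x - f' x|) (c + c')).
    by apply: measurableT_comp => //; exact: measurable_funB.
  by move=> x; rewrite normr_id (le_trans (ler_normB _ _))// lerD.
rewrite ger0_norm in hN; last by apply: Rintegral_ge0 => x _.
have -> : eps = eps / 3 + eps / 3 + eps / 3 by field.
by rewrite !lerD.
Qed.

Lemma refl_stableD f1 f2 : refl_stable f1 -> refl_stable f2 ->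
  refl_stable (fun x => f1 x + f2 x).
Proof.
move=> [mf1 [c1 b1] d1] [mf2 [c2 b2] d2].
have mD := measurable_funD mf1 mf2.
have bD x : `|f1 x + f2 x| <= c1 + c2 by rewrite (le_trans (ler_normD _ _))// lerD.
split => //; first by exists (c1 + c2).
have d12 : (fun N => \int[g]_x `|f1 (refl N x) - f1 x| + \int[g]_x `|f2 (refl N x) - f2 x|)
    @ \oo --> (0 : R) by rewrite -[X in _ --> X]addr0; exact: cvgD.
apply: (squeeze_cvgr _ (cvg_cst 0) d12); apply: nearW => N; apply/andP; split.
  by apply: Rintegral_ge0.
have i1 : g.-integrable setT (EFin \o (fun x => `|f1 (refl N x) - f1 x|)).
  by apply: (int_diff (mf_refl N mf1) mf1 _ b1) => x; exact: b1.
have i2 : g.-integrable setT (EFin \o (fun x => `|f2 (refl N x) - f2 x|)).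
  by apply: (int_diff (mf_refl N mf2) mf2 _ b2) => x; exact: b2.
rewrite -RintegralD//; apply: le_Rintegral => //.
- by apply: (int_diff (mf_refl N mD) mD _ bD) => x; exact: bD.
- exact: integrableD_EFin.
- by move=> x _; rewrite opprD addrACA ler_normD.
Qed.

Lemma refl_stableZ k f : refl_stable f -> refl_stable (fun x => k * f x).
Proof.
move=> [mf [c b] df]; split; first exact: measurable_funM.
  by exists (`|k| * c) => x; rewrite normrM ler_wpM2l.
have h : (fun N => `|k| * \int[g]_x `|f (refl N x) - f x|) @ \oo --> (0 : R).
  by rewrite -[X in _ --> X](mulr0 `|k|); apply: cvgM => //; exact: cvg_cst.
apply: cvg_trans h; apply: near_eq_cvg; apply: nearW => N.
rewrite -RintegralZl//; last by apply: (int_diff (mf_refl N mf) mf _ b) => x; exact: b.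
by apply: eq_Rintegral => x _; rewrite -mulrBr normrM.
Qed.

(** A half-space given by finitely many coordinates is eventually unmoved; such
    sets generate the Borel sets, and the stable sets form a lambda-system. *)
Lemma refl_stable_indic (A : set (borel H)) : measurable A -> refl_stable \1_A.
Proof.
have i1 (B : set (borel H)) x : `|(\1_B x : R)| <= 1.
  by rewrite indicE; case: (_ \in _); rewrite ?normr1 ?normr0.
rewrite (borel_half_spaces hip e_onb sepH) => mA.
suff : [set B : set (borel H) | refl_stable \1_B] A by [].
apply: (@lambda_system_subset _ _ (@half_spaces_setI_closed _ _ ip e) setT _ _ _ _ A) => //.
- split => //.
  + rewrite /= (_ : \1_setT = cst 1); last by apply/funext => x; rewrite indicT.
    split => //; first by exists 1 => x; rewrite normr1.
    rewrite (_ : (fun N => _) = cst 0); first exact: cvg_cst.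
    apply/funext => N; under eq_Rintegral do rewrite subrr normr0.
    by rewrite Rintegral_cst// mul0r.
  + move=> B C CB /= hB hC.
    have := refl_stableD hB (refl_stableZ (-1) hC).
    congr refl_stable; apply/funext => x; rewrite !indicE in_setD.
    have [xC|xC] := boolP (x \in C); last by rewrite mulr0 addr0 andbT.
    by rewrite (mem_set (CB _ (set_mem xC))) /=; ring.
  + move=> F ndF hF /=.
    have mFi k : measurable (F k : set (borel H)).
      have [mk _ _] := hF k; have := mk measurableT _ (measurable_set1 1).
      rewrite setTI; congr measurable; apply/seteqP; split => x /=; rewrite indicE.
        by case: (boolP (x \in F k)) => [/set_mem//|_ /eqP]; rewrite eq_sym oner_eq0.
      by move=> /mem_set ->.
    have mU : measurable (\bigcup_k F k : set (borel H)) by exact: bigcupT_measurable.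
    apply: (@refl_stable_approx _ 1) => //.
    move=> eps e0.
    have cF : (fun k => \int[g]_x `|\1_(\bigcup_k F k) x - \1_(F k) x|) @ \oo --> (0 : R).
      have -> : (0 : R) = \int[g]_x (cst 0 x) by rewrite Rintegral_cst// mul0r.
      apply: (@Rintegral_bounded_cvg _ _ _ _ _ _ 2) => //.
      * move=> k; apply: measurableT_comp => //; apply: measurable_funB; exact: measurable_indic.
      * by move=> k x; rewrite normr_id (le_trans (ler_normB _ _))// -[leRHS]/(1 + 1) lerD.
      * move=> x; apply: cvg_near_cst.
        have [[k0 _ Fx]|nFx] := pselect ((\bigcup_k F k) x).
          exists k0 => // k /= k0k.
          have Fkx : F k x by have := ndF _ _ k0k; rewrite subsetEset => /(_ x Fx).
          by rewrite !indicE (mem_set Fkx) (mem_set (_ : (\bigcup_k F k) x)) ?subrr ?normr0//; exists k.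
        apply: nearW => k; rewrite !indicE !memNset ?subrr ?normr0// => Fx.
        by apply: nFx; exists k.
    move: cF => /cvgr0Pnorm_le /(_ _ e0) [k _ /(_ k (leqnn k)) hk].
    exists \1_(F k); first exact: hF.
    exact: le_trans (ler_norm _) hk.
- move=> _ [s _ <-] /=; have mS := measurable_half_spaces hip e s.
  split => //; first by exists 1.
  apply: cvg_near_cst; near=> N.
  have hN : all (fun j => j.1 < N)%N s.
    near: N; exists (\max_(j <- s) j.1).+1 => // M /= hM; apply/allP => j js.
    by apply: leq_ltn_trans hM; rewrite (big_rem j)//= leq_maxl.
  have h x : (\1_(half_spaces ip e s) (refl N x) : R) = \1_(half_spaces ip e s) x.
    rewrite !indicE; congr (_%:R : R); congr nat_of_bool.
    have hs : all (fun j => j.2 < ip (refl N x) (e j.1)) s = all (fun j => j.2 < ip x (e j.1)) s.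
      apply: eq_in_all => j js; rewrite refl_coord ifT//.
      exact: (allP hN).
    by apply/idP/idP; rewrite !inE /half_spaces /= hs.
  under eq_Rintegral do rewrite h subrr normr0.
  by rewrite Rintegral_cst// mul0r.
Unshelve. all: by end_near. Qed.

Import HBSimple.

(** Approximation by simple functions. *)
Lemma refl_stable_bounded (f : borel H -> R) c : measurable_fun setT f ->
  (forall x, `|f x| <= c) -> refl_stable f.
Proof.
move=> mf fc; apply: (refl_stable_approx mf fc) => eps e0.
have [s_ [_ _ hs]] := approximation_sfun_integrable measurableT (bdd_int mf fc).
have /fine_cvgP[fin /cvgr0Pnorm_le /(_ _ e0)] := hs.
move=> hs2; have [k _ /(_ k (leqnn k)) [hf hk]] := filterI fin hs2.
exists (s_ k : _ -> R); last first.
  by apply: le_trans hk; rewrite /= /Rintegral; exact: ler_norm.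
have -> : (s_ k : _ -> R) = fun x => \sum_(y <- finmap.enum_fset (fset_set (range (s_ k)))) (y * \1_(s_ k @^-1` [set y]) x).
  apply/funext => x; rewrite fimfunE fsbig_finite//=.
elim: (finmap.enum_fset _) => [|y r IH].
  under eq_fun do rewrite big_nil.
  have := refl_stableZ 0 (refl_stable_indic measurableT).
  by congr refl_stable; apply/funext => x; rewrite mul0r.
under eq_fun do rewrite big_cons.
apply: refl_stableD => //; apply: refl_stableZ; apply: refl_stable_indic.
exact: measurable_sfunP.
Qed.

End reflections.

Section linear_functional.
Context {R : realType} {H : completeNormedModType R} (ip : H -> H -> R).
Hypothesis hip : is_inner_product ip.
Variable e : nat -> H.
Hypothesis e_onb : orthonormal_basis ip e.
Hypothesis sepH : separable_space H.
Variables (g : probability (borel H) R) (B : H -> R).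
Hypothesis gB : gaussian_cf ip g 0 B.
Hypothesis B_refl : forall N h, B (refl ip e N h) = B h.
Hypothesis B_scale : forall (a : R) h, B (a *: h) = a ^+ 2 * B h.
Variables (L : H -> R) (W : set (borel H)).
Hypotheses (mL : measurable_fun setT (L : borel H -> R)) (mW : measurable W).
Hypotheses (gW : g W = 1%E) (W0 : W 0).
Hypothesis W_lin : forall (a : R) (x y : H), W x -> W y -> W (a *: x + y).
Hypothesis L_lin : forall (a : R) (x y : H), W x -> W y ->
  L (a *: x + y) = a * L x + L y.
Hypothesis W_e : forall i, W (e i).

(** The vector that represents [L] composed with the projection on the first
    [N] coordinates. *)
Definition functional_trunc N : H := \sum_(i < N) L (e i) *: e i.

Lemma subspace_scale a (x : H) : W x -> W (a *: x).
Proof. by move=> Wx; rewrite -[_ *: _]addr0; apply: W_lin. Qed.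

Lemma subspace_add (x y : H) : W x -> W y -> W (x + y).
Proof. by move=> Wx Wy; rewrite -[x]scale1r; apply: W_lin. Qed.

Lemma functional0 : L 0 = 0.
Proof.
by have := L_lin (-1) W0 W0; rewrite scaler0 addr0 mulN1r addNr.
Qed.

Lemma functional_scale a (x : H) : W x -> L (a *: x) = a * L x.
Proof. by move=> Wx; have := L_lin a Wx W0; rewrite !addr0 functional0 addr0. Qed.

Lemma functional_add (x y : H) : W x -> W y -> L (x + y) = L x + L y.
Proof. by move=> Wx Wy; have := L_lin 1 Wx Wy; rewrite scale1r mul1r. Qed.

Lemma functional_onb_proj N x : W (onb_proj ip e N x) /\
  L (onb_proj ip e N x) = ip x (functional_trunc N).
Proof.
elim: N => [|N [IH1 IH2]].
  by rewrite /onb_proj /functional_trunc !big_ord0 functional0 (ip0r hip).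
rewrite /onb_proj /functional_trunc !big_ord_recr/=.
have WS := subspace_scale (ip x (e N)) (W_e N).
split; first exact: subspace_add.
rewrite functional_add// functional_scale// IH2 (ipDr hip) (ipZr hip).
by rewrite [L (e N) * _]mulrC.
Qed.

Lemma functional_refl N x : W x ->
  L (refl ip e N x) = 2 * ip x (functional_trunc N) - L x.
Proof.
move=> Wx; have [WP LP] := functional_onb_proj N x.
rewrite /refl -scaleN1r functional_add; [|exact: subspace_scale..].
by rewrite !functional_scale// LP mulN1r.
Qed.

Lemma gaussian_refl N (A : set (borel H)) : measurable A ->
  g (refl ip e N @^-1` A) = g A.
Proof.
move=> mA; apply: (gaussian_cf_invariant hip e_onb sepH (B := B) (m := 0) (phiT := refl ip e N) (a := 0)) => //.
- exact: measurable_refl.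
- by move=> x h; rewrite (refl_adj hip) (ip0l hip) addr0.
- by rewrite /refl /onb_proj big1 ?scaler0 ?subr0// => i _; rewrite (ip0l hip) scale0r.
Qed.

Let mcosL t : measurable_fun setT (fun x : borel H => cos (t * L x)).
Proof.
apply: measurableT_comp; first exact: continuous_measurable_fun (@continuous_cos R).
exact: measurable_funM.
Qed.

Let msinL t : measurable_fun setT (fun x : borel H => sin (t * L x)).
Proof.
apply: measurableT_comp; first exact: continuous_measurable_fun (@continuous_sin R).
exact: measurable_funM.
Qed.

(** [L x + L (refl N x)] is twice the truncation of [L], almost everywhere; and
    by stability [L (refl N x)] may in the limit be replaced by [L x] under a
    bounded function, so that the truncations converge to [L] in law. *)
Lemma cos_functional_cvg t :
  (fun N => expR (- (t ^+ 2 * B (functional_trunc N) / 2))) @ \oo -->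
  \int[g]_x cos (t * L x).
Proof.
pose t2 := t / 2.
have [_ _ dc] := refl_stable_bounded hip e_onb sepH gaussian_refl (mcosL t2) (fun x => cos_max _).
have [_ _ ds] := refl_stable_bounded hip e_onb sepH gaussian_refl (msinL t2) (fun x => sin_max _).
have mr N := measurable_refl hip e_onb sepH N.
have mcr N : measurable_fun setT (fun x : borel H => cos (t2 * L (refl ip e N x))).
  exact: (measurableT_comp (mcosL t2) (mr N)).
have msr N : measurable_fun setT (fun x : borel H => sin (t2 * L (refl ip e N x))).
  exact: (measurableT_comp (msinL t2) (mr N)).
have int1 (f : borel H -> R) c : measurable_fun setT f -> (forall x, `|f x| <= c) ->
  g.-integrable setT (EFin \o f) by exact: bounded_integrable.
have E N : expR (- (t ^+ 2 * B (functional_trunc N) / 2)) =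
    \int[g]_x cos (t2 * L x + t2 * L (refl ip e N x)).
  have := gB (t *: functional_trunc N) 0.
  rewrite (ip0l hip) addr0 cos0 mul1r B_scale => <-.
  apply: Rintegral_ae_eq.
  - exact: measurable_cos_ip.
  - apply: measurableT_comp; first exact: continuous_measurable_fun (@continuous_cos R).
    apply: measurable_funD; apply: measurable_funM => //.
    exact: (measurableT_comp mL (mr N)).
  - have := probability_one_ae mW gW; apply: filterS => x Wx.
    rewrite functional_refl// (ipZr hip) addr0; congr cos; rewrite /t2.
    by field.
have cE (x : H) N : cos (t2 * L x + t2 * L (refl ip e N x)) - cos (t * L x) =
    cos (t2 * L x) * (cos (t2 * L (refl ip e N x)) - cos (t2 * L x))
    - sin (t2 * L x) * (sin (t2 * L (refl ip e N x)) - sin (t2 * L x)).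
  have -> : t * L x = t2 * L x + t2 * L x by rewrite /t2; field.
  by rewrite !cosD; ring.
have mcs N : measurable_fun setT (fun x : borel H => cos (t2 * L x + t2 * L (refl ip e N x))).
  apply: measurableT_comp; first exact: continuous_measurable_fun (@continuous_cos R).
  apply: measurable_funD; apply: measurable_funM => //.
  exact: (measurableT_comp mL (mr N)).
apply/subr_cvg0.
have dcs : (fun N => \int[g]_x `|cos (t2 * L (refl ip e N x)) - cos (t2 * L x)| +
    \int[g]_x `|sin (t2 * L (refl ip e N x)) - sin (t2 * L x)|) @ \oo --> (0 : R).
  by rewrite -[X in _ --> X]addr0; exact: cvgD.
apply: norm_cvg0; apply: (squeeze_cvgr _ (cvg_cst 0) dcs).
apply: nearW => N; rewrite normr_ge0 E/=.
have id1 : g.-integrable setT (EFin \o (fun x => `|cos (t2 * L (refl ip e N x)) - cos (t2 * L x)|)).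
  apply: (int1 _ 2); first by apply: measurableT_comp => //; exact: measurable_funB.
  by move=> x; rewrite normr_id (le_trans (ler_normB _ _))// -[leRHS]/(1 + 1) lerD// cos_max.
have id2 : g.-integrable setT (EFin \o (fun x => `|sin (t2 * L (refl ip e N x)) - sin (t2 * L x)|)).
  apply: (int1 _ 2); first by apply: measurableT_comp => //; exact: measurable_funB.
  by move=> x; rewrite normr_id (le_trans (ler_normB _ _))// -[leRHS]/(1 + 1) lerD// sin_max.
have ia : g.-integrable setT (EFin \o (fun x => cos (t2 * L x + t2 * L (refl ip e N x)))).
  by apply: (int1 _ 1) => // x; exact: cos_max.
have ib : g.-integrable setT (EFin \o (fun x => cos (t * L x))).
  by apply: (int1 _ 1) => // x; exact: cos_max.
rewrite -RintegralB// -RintegralD//.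
have iab := integrableB_EFin ia ib.
apply: le_trans (le_normr_Rintegral measurableT iab) _.
apply: le_Rintegral => //.
- exact: (integrable_abse iab).
- exact: integrableD_EFin.
- move=> x _; rewrite cE; apply: le_trans (ler_normB _ _) _; rewrite !normrM.
  by apply: lerD; rewrite ler_piMl ?cos_max ?sin_max.
Qed.

(** Let [t] be fixed: the characteristic function of [L] at [t] is a limit of
    numbers at least [exp (- t ^ 2 s / 2)]. *)
Lemma functional_second_moment (s : R) : (forall N, B (functional_trunc N) <= s) ->
  (\int[g]_x (L x ^+ 2)%:E <= s%:E)%E.
Proof.
move=> Bs; apply: second_moment_le_of_cos => // t.
have h := @cos_functional_cvg t.
rewrite -(cvg_lim _ h)//; apply: limr_ge; first by apply/cvg_ex; eexists; exact: h.
apply: nearW => N; rewrite ler_expR lerN2 ler_pM2r// ler_wpM2l ?sqr_ge0//.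
Qed.

(** The variances of the truncations stay bounded: otherwise the
    characteristic function of [L] would vanish off 0, while it is continuous
    at 0. *)
Lemma functional_variance_bounded :
  (forall N M, (N <= M)%N -> B (functional_trunc N) <= B (functional_trunc M)) ->
  exists s, forall N, B (functional_trunc N) <= s.
Proof.
move=> Bnd.
have cv1 : (fun n : nat => \int[g]_x cos (n.+1%:R^-1 * L x)) @ \oo --> (1 : R).
  have E1 : \int[g]_x (cst 1 x) = 1 :> R.
    by rewrite Rintegral_cst// mul1r; rewrite [X in fine X]probability_setT.
  rewrite -[X in _ --> X]E1.
  apply: (@Rintegral_bounded_cvg _ _ _ _ _ _ 1) => //.
  - by move=> n x; exact: cos_max.
  - move=> x; rewrite /cst -[X in _ --> X](cos0 R).
    have h : (fun n : nat => n.+1%:R^-1 * L x) @ \oo --> (0 : R).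
      by rewrite -[X in _ --> X](mul0r (L x)); apply: cvgM; [exact: cvg_harmonic|exact: cvg_cst].
    exact: (cvg_comp _ _ h (@continuous_cos R 0)).
have half0 : 0 < 2^-1 :> R by rewrite invr_gt0.
move/cvgrPdist_lt : cv1 => /(_ _ half0) [n _ /(_ n (leqnn n))] /=.
set t := n.+1%:R^-1 => ht.
have t0 : 0 < t by rewrite invr_gt0.
have ht2 : 2^-1 < \int[g]_x cos (t * L x) by move: ht; rewrite ltr_distl => /andP[]; lra.
have h := @cos_functional_cvg t.
have [N0 _ hN] : \forall N \near \oo, 2^-1 < expR (- (t ^+ 2 * B (functional_trunc N) / 2)).
  by apply: (cvgr_gt (\int[g]_x cos (t * L x))) => //; exact: h.
have fin N : (N0 <= N)%N -> B (functional_trunc N) <= 4 / t ^+ 2.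
  move=> /hN; set b := B _ => hb.
  have := expR_ge1Dx (t ^+ 2 * b / 2).
  rewrite expRN in hb.
  have E0 := expR_gt0 (t ^+ 2 * b / 2).
  move: hb; rewrite ltf_pV2 ?posrE// => hb h1.
  rewrite ler_pdivlMr ?exprn_gt0// mulrC; lra.
exists (4 / t ^+ 2) => N; have [NN|NN] := leqP N0 N; first exact: fin.
exact: le_trans (Bnd _ _ (ltnW NN)) (fin _ (leqnn _)).
Qed.

End linear_functional.

(** * Diagonal variances *)

Section diagonal_form.
Context {R : realType} {H : completeNormedModType R} (ip : H -> H -> R).
Hypothesis hip : is_inner_product ip.
Variable e : nat -> H.
Hypothesis e_onb : orthonormal_basis ip e.
Variables (D : H -> H) (b : nat -> R).
Hypothesis D_coord : forall h i, ip (D h) (e i) = b i * ip h (e i).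

Lemma diagonal_refl N h :
  ip (D (refl ip e N h)) (refl ip e N h) = ip (D h) h.
Proof.
have -> : D (refl ip e N h) = refl ip e N (D h).
  apply: (onb_ext e_onb) => i; rewrite D_coord !(refl_coord hip e_onb) D_coord.
  by case: ifP => _; ring.
rewrite (refl_adj hip); congr (ip _ _); apply: (onb_ext e_onb) => i.
by rewrite !(refl_coord hip e_onb); case: (i < N)%N; rewrite ?opprK.
Qed.

Lemma diagonal_scale a h : ip (D (a *: h)) (a *: h) = a ^+ 2 * ip (D h) h.
Proof.
have -> : D (a *: h) = a *: D h.
  by apply: (onb_ext e_onb) => i; rewrite D_coord !(ipZl hip) D_coord; ring.
by rewrite (ipZl hip) (ipZr hip); ring.
Qed.

Lemma diagonal_sum N (l : nat -> R) :
  ip (D (\sum_(i < N) l i *: e i)) (\sum_(i < N) l i *: e i) = \sum_(i < N) l i ^+ 2 * b i.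
Proof.
rewrite (ip_sumr hip); apply: eq_bigr => i _; rewrite (ipZr hip) D_coord (ip_suml hip).
rewrite (bigD1 i)//= big1 ?addr0 => [|j ji].
  by rewrite (ipZl hip) (onb_ip e_onb) eqxx mulr1; ring.
by rewrite (ipZl hip) (onb_ip e_onb) (_ : (j : nat) == i = false) ?mulr0//; exact/negbTE.
Qed.

End diagonal_form.

(** * The prior *)

Section prior.
Context {R : realType} {H : completeNormedModType R} (ip : H -> H -> R).
Hypothesis hip : is_inner_product ip.
Variable e : nat -> H.
Hypothesis e_onb : orthonormal_basis ip e.
Hypothesis sepH : separable_space H.
Variables (Lam Half : {linear H -> H}) (lam : nat -> R).
Hypothesis Half_sqrt : is_sqrt_operator ip Lam Half.
Hypothesis lam_gt0 : forall i, 0 < lam i.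
Hypothesis Lam_e : forall i, Lam (e i) = lam i *: e i.

Lemma sqrt_form x y : ip (Lam x) y = ip (Half x) (Half y).
Proof. by case: Half_sqrt => ha _ hh; rewrite -hh ha. Qed.

Lemma sqrt_selfadjoint x y : ip (Lam x) y = ip x (Lam y).
Proof. by rewrite sqrt_form (ipC hip x) sqrt_form (ipC hip). Qed.

Lemma sqrt_form_ge0 x : 0 <= ip (Lam x) x.
Proof. by rewrite sqrt_form ipxx_ge0. Qed.

(** [Half - sqrt lam] maps [e i] to a vector on which the positive operator
    [Half] acts as [- sqrt lam], and which is therefore 0. *)
Lemma sqrt_eigen i : Half (e i) = Num.sqrt (lam i) *: e i.
Proof.
case: Half_sqrt => ha hp hh.
set s := Num.sqrt (lam i); have s0 : 0 < s by rewrite sqrtr_gt0.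
pose v := Half (e i) - s *: e i.
have Hv : Half v = - s *: v.
  rewrite /v linearB linearZ/= hh Lam_e -(sqr_sqrtr (ltW (lam_gt0 i))) -/s.
  by rewrite scalerBr scalerA scaleNr expr2 mulNr scaleNr opprK addrC.
have := hp v; rewrite Hv (ipZl hip) mulNr oppr_ge0 pmulr_rle0// => vv.
have /(ipxx_eq0 hip)/eqP : ip v v = 0 by apply/eqP; rewrite eq_le vv ipxx_ge0.
by rewrite subr_eq0 => /eqP.
Qed.

Lemma sqrt_coord h i : ip (Lam h) (e i) = lam i * ip h (e i).
Proof. by rewrite sqrt_selfadjoint Lam_e (ipZr hip). Qed.

Variable nu : probability (borel H) R.
Hypothesis nu_gaussian : is_gaussian ip nu 0 Lam.

Lemma prior_cf : gaussian_cf ip nu 0 (fun h => ip (Lam h) h).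
Proof. exact: (is_gaussian_cf hip sqrt_form_ge0 nu_gaussian). Qed.

(** Reflection in the hyperplane orthogonal to [y], for the geometry in which
    the covariance is the identity. *)
Let rho (y x : H) : H := x - (2 * ip x y / ip (Lam y) y) *: Lam y.

Let rho_adj y x h : ip (rho y x) h = ip x (h - (2 * ip (Lam y) h / ip (Lam y) y) *: y).
Proof. by rewrite /rho (ipBl hip) (ipBr hip) (ipZl hip) (ipZr hip); ring. Qed.

Let measurable_rho y : measurable_fun setT (rho y : borel H -> borel H).
Proof.
apply: (measurable_fun_borel hip e_onb sepH) => i.
by under eq_fun do rewrite rho_adj; exact: measurable_ip.
Qed.

Let rho_invariant y (A : set (borel H)) : 0 < ip (Lam y) y -> measurable A ->
  nu (rho y @^-1` A) = nu A.
Proof.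
move=> c0 mA.
apply: (gaussian_cf_invariant hip e_onb sepH (m := 0) (B := fun h => ip (Lam h) h)
  (phiT := fun h => h - (2 * ip (Lam y) h / ip (Lam y) y) *: y) (a := 0)) => //.
- by move=> x h; rewrite rho_adj (ip0l hip) addr0.
- by rewrite /rho (ip0l hip) mulr0 mul0r scale0r subr0.
- move=> h; rewrite linearB linearZ/= !(ipBl hip, ipBr hip, ipZl hip, ipZr hip).
  rewrite (sqrt_selfadjoint h y) (ipC hip h (Lam y)).
  by set c := ip (Lam y) y in c0 *; field; rewrite gt_eqF.
- exact: prior_cf.
Qed.

Let hyperplane_null y : 0 < ip (Lam y) y -> {ae nu, forall x, ip x y != 0}.
Proof.
move=> c0.
exists [set x : borel H | ip x y = 0]; split.
- have := measurable_ip hip y measurableT (measurable_set1 0).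
  by rewrite setTI.
- have := nu_gaussian y (measurable_set1 0).
  rewrite /normal_law c0 => h; rewrite [LHS]h.
  apply: (normal_prob_dominates _ _ _ (measurable_set1 0) (@subset_refl _ _)).
  move=> B mB B0; apply/eqP; rewrite eq_le measure_ge0 andbT.
  by rewrite -(lebesgue_measure_set1 (0 : R)); apply: le_measure; rewrite ?inE.
- by move=> x /= /negP; rewrite negbK => /eqP.
Qed.

Variables (L : H -> R) (V : set (borel H)).
Hypotheses (mL : measurable_fun setT (L : borel H -> R)) (mV : measurable V).
Hypotheses (nuV : nu V = 1%E) (V0 : V 0).
Hypothesis V_lin : forall (a : R) (x y : H), V x -> V y -> V (a *: x + y).
Hypothesis L_lin : forall (a : R) (x y : H), V x -> V y ->
  L (a *: x + y) = a * L x + L y.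

(** A subspace of full measure contains the range of the covariance: a typical
    point and its image under the reflection differ by a multiple of
    [Lam y]. *)
Lemma full_subspace_cov y : V (Lam y).
Proof.
have [c0|c0] := ltP 0 (ip (Lam y) y); last first.
  have : ip (Half y) (Half y) = 0.
    by apply/eqP; rewrite -sqrt_form eq_le c0 sqrt_form_ge0.
  by case: Half_sqrt => _ _ hh /(ipxx_eq0 hip) h; rewrite -hh h linear0.
have aeV := probability_one_ae mV nuV.
have aeV' : {ae nu, forall x, V (rho y x)}.
  apply: (probability_one_ae (A := (rho y @^-1` V : set (borel H)))).
    by rewrite -[X in measurable X]setTI; exact: measurable_rho.
  by rewrite rho_invariant.
have [x [[Vx Vrx] xy]] : exists x : borel H, (V x /\ V (rho y x)) /\ ip x y != 0.
  by apply: (@ae_nonempty _ _ _ nu); apply: filterI; [exact: filterI|exact: hyperplane_null].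
pose k := 2 * ip x y / ip (Lam y) y.
(* [x - rho y x = k *: Lam y]. *)
have k0 : k != 0.
  by rewrite mulf_neq0 ?invr_neq0 ?(gt_eqF c0)// mulf_neq0// pnatr_eq0.
have -> : Lam y = k^-1 *: (- 1 *: rho y x + x) + 0.
  by rewrite addr0 scaleN1r /rho opprB -/k subrK scalerA mulVf// scale1r.
by apply: V_lin => //; exact: V_lin.
Qed.

Lemma full_subspace_e i : V (e i).
Proof.
have -> : e i = (lam i)^-1 *: Lam (e i) + 0.
  by rewrite addr0 Lam_e scalerA mulVf ?scale1r// gt_eqF.
by apply: V_lin => //; exact: full_subspace_cov.
Qed.

(** Both [e i] and its image under the square root are in the subspace on which
    [L] is linear. *)
Lemma representerE i : representer e Half lam L i = L (e i).
Proof.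
rewrite /representer sqrt_eigen (functional_scale V0 L_lin)//; last exact: full_subspace_e.
by rewrite mulrC mulKf// gt_eqF// sqrtr_gt0.
Qed.

Lemma prior_variance_bounded :
  exists s, forall N, \sum_(i < N) L (e i) ^+ 2 * lam i <= s.
Proof.
have dg N : ip (Lam (functional_trunc e L N)) (functional_trunc e L N) =
    \sum_(i < N) L (e i) ^+ 2 * lam i.
  exact: (diagonal_sum hip e_onb sqrt_coord N (fun i => L (e i))).
have [|s hs] := functional_variance_bounded hip e_onb sepH prior_cf
  (diagonal_refl hip e_onb sqrt_coord) (diagonal_scale hip e_onb sqrt_coord)
  mL mV nuV V0 V_lin L_lin full_subspace_e.
- move=> N M NM; rewrite !dg.
  rewrite -(big_mkord xpredT (fun i => L (e i) ^+ 2 * lam i)).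
  rewrite -(big_mkord xpredT (fun i => L (e i) ^+ 2 * lam i)) [leRHS](big_cat_nat (n := N))//=.
  by rewrite lerDl sumr_ge0// => i _; rewrite mulr_ge0 ?sqr_ge0// ltW.
- by exists s => N; have := hs N; rewrite dg.
Qed.

Let second_moment_rho y (f : borel H -> R) : 0 < ip (Lam y) y -> measurable_fun setT f ->
  (\int[nu]_x (f (rho y x) ^+ 2)%:E = \int[nu]_x (f x ^+ 2)%:E)%E.
Proof.
move=> c0 mf.
have mf2 : measurable_fun setT (fun x => (f x ^+ 2)%:E).
  exact/measurable_EFinP/measurable_funX.
transitivity (\int[image_probability nu (measurable_rho y)]_x (f x ^+ 2)%:E)%E.
  rewrite /image_probability ge0_integral_pushforward//.
  by move=> x _; rewrite lee_fin sqr_ge0.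
by apply: eq_measure_integral => A mA _; exact: rho_invariant.
Qed.

(** On the range of the covariance, [L] is given by its coordinates.  The
    remainders [L - S_M] of its expansion are again measurable linear
    functionals, whose second moments tend to 0; the reflection transfers this
    smallness to the single vector [Lam y]. *)
Lemma functional_cov_cvg y :
  (fun N => \sum_(i < N) L (e i) * ip (Lam y) (e i)) @ \oo --> L (Lam y).
Proof.
have [c0|c0] := ltP 0 (ip (Lam y) y); last first.
  have Ly : Lam y = 0.
    have : ip (Half y) (Half y) = 0.
      by apply/eqP; rewrite -sqrt_form eq_le c0 sqrt_form_ge0.
    by case: Half_sqrt => _ _ hh /(ipxx_eq0 hip) h; rewrite -hh h linear0.
  rewrite Ly (functional0 V0 L_lin); apply: cvg_near_cst; apply: nearW => N.
  by rewrite big1// => i _; rewrite (ip0l hip) mulr0.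
pose c := ip (Lam y) y.
have Ve := full_subspace_e.
have VLy := full_subspace_cov y.
pose f i := L (e i) ^+ 2 * lam i.
have f0 i : 0 <= f i by rewrite mulr_ge0 ?sqr_ge0// ltW.
pose u N := \sum_(i < N) f i.
have [s us] := prior_variance_bounded.
have und : nondecreasing_seq u.
  apply/nondecreasing_seqP => N; rewrite /u big_ord_recr/= lerDl; exact: f0.
have uub : has_ubound (range u) by exists s => _ [N _ <-]; exact: us.
have ul := nondecreasing_cvgn und uub.
set l := sup (range u) in ul.
have ule N : u N <= l by apply: ub_le_sup => //; exists N.
pose t M := functional_trunc e L M.
pose LM M x := L x - ip x (t M).
have LMe M i : LM M (e i) = (M <= i)%N%:R * L (e i).
  rewrite /LM /t /functional_trunc (ip_sumr hip).
  under eq_bigr do rewrite (ipZr hip) (onb_ip e_onb).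
  case: leqP => iM.
    rewrite mul1r big1 ?subr0// => j _; rewrite (_ : i == j = false) ?mulr0//.
    by apply/negbTE; rewrite neq_ltn (leq_trans (ltn_ord j) iM) orbT.
  rewrite (bigD1 (Ordinal iM))//= eqxx mulr1 big1 ?addr0 ?subrr ?mul0r// => j ji.
  rewrite (_ : i == j = false) ?mulr0//; apply/negbTE.
  by apply: contra ji => /eqP ij; apply/eqP/val_inj.
have mLM M : measurable_fun setT (LM M : borel H -> R).
  by apply: measurable_funB => //; exact: measurable_ip.
have LM_lin M (a : R) (x z : H) : V x -> V z -> LM M (a *: x + z) = a * LM M x + LM M z.
  by move=> Vx Vz; rewrite /LM L_lin// (ipDl hip) (ipZl hip); ring.
(* The tail of the convergent series of variances bounds the second moment. *)
have LM2 M : (\int[nu]_x (LM M x ^+ 2)%:E <= (l - u M)%:E)%E.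
  apply: (functional_second_moment hip e_onb sepH prior_cf
    (diagonal_refl hip e_onb sqrt_coord) (diagonal_scale hip e_onb sqrt_coord)
    (mLM M) mV nuV V0 V_lin (LM_lin M) Ve) => N.
  have := diagonal_sum hip e_onb sqrt_coord N (fun i => LM M (e i)) => h.
  rewrite [leLHS]h.
  under eq_bigr do rewrite LMe.
  apply: (@le_trans _ _ (u (M + N)%N - u M)); last by rewrite lerB.
  rewrite /u -(big_mkord xpredT (fun i => ((M <= i)%N%:R * L (e i)) ^+ 2 * lam i)).
  rewrite -!(big_mkord xpredT f) (big_cat_nat (n := M) (p := (M + N)%N))//= ?leq_addr//.
  rewrite [X in X - _]addrC addrK.
  apply: (@le_trans _ _ (\sum_(0 <= i < M + N) ((M <= i)%N%:R * L (e i)) ^+ 2 * lam i)).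
    rewrite [leRHS](big_cat_nat (n := N))//= ?leq_addl// lerDl sumr_ge0// => i _.
    by rewrite mulr_ge0 ?sqr_ge0// ltW.
  rewrite (big_cat_nat (n := M))//= ?leq_addr// big_nat_cond big1 ?add0r; last first.
    by move=> i /andP[/andP[_ iM] _]; rewrite leqNgt iM mul0r expr0n/= mul0r.
  rewrite big_nat_cond [leRHS]big_nat_cond; apply: ler_sum => i /andP[/andP[Mi _] _].
  by rewrite Mi mul1r.
have mip := measurable_ip hip y.
pose q := (\int[nu]_x (ip x y ^+ 2)%:E)%E.
have qc : (q <= c%:E)%E.
  apply: second_moment_le_of_cos => // r.
  have := prior_cf (r *: y) 0; rewrite (ip0l hip) addr0 cos0 mul1r.
  rewrite (diagonal_scale hip e_onb sqrt_coord) => <-.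
  by rewrite le_eqVlt; apply/orP; left; apply/eqP; apply: eq_Rintegral => x _; rewrite (ipZr hip) addr0.
have q0 : (0 < q)%E.
  rewrite lt_neqAle integral_ge0 ?andbT; last by move=> x _; rewrite lee_fin sqr_ge0.
  apply/negP => /eqP q0.
  have : (\int[nu]_x `|(ip x y ^+ 2)%:E| = 0)%E.
    rewrite q0; apply: eq_integral => x _.
    by rewrite gee0_abs// lee_fin sqr_ge0.
  move=> /(ae_eq_integral_abs _ measurableT) h.
  have /h {}h : measurable_fun setT (fun x : borel H => (ip x y ^+ 2)%:E).
    exact/measurable_EFinP/measurable_funX.
  have [x [xy hx]] : exists x : borel H, ip x y != 0 /\ (setT x -> (ip x y ^+ 2)%:E = 0%E).
    by apply: (@ae_nonempty _ _ _ nu); apply: filterI => //; exact: hyperplane_null.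
  by move: (hx Logic.I) => [] /eqP; rewrite sqrf_eq0 (negbTE xy).
have [qR qE] : exists qR : R, q = qR%:E.
  exists (fine q); rewrite fineK// ge0_fin_numE ?(ltW q0)//.
  exact: le_lt_trans qc (ltry _).
rewrite qE lte_fin in q0.
(* [LM M x - LM M (rho y x)] is [LM M (Lam y)] times [2 <x, y> / c], and both
   terms have the same second moment. *)
have key M : (2 / c) ^+ 2 * LM M (Lam y) ^+ 2 * qR <= 4 * (l - u M).
  rewrite -lee_fin.
  have -> : ((2 / c) ^+ 2 * LM M (Lam y) ^+ 2 * qR)%:E =
      (\int[nu]_x ((2 / c) ^+ 2 * LM M (Lam y) ^+ 2 * (ip x y ^+ 2))%:E)%E.
    under eq_integral do rewrite EFinM.
    rewrite ge0_integralZl//.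
    - by rewrite -/q qE.
    - exact/measurable_EFinP/measurable_funX.
    - by move=> x _; rewrite lee_fin sqr_ge0.
    - by rewrite lee_fin mulr_ge0 ?sqr_ge0.
  have mLMr : measurable_fun setT (fun x : borel H => LM M (rho y x)).
    exact: (measurableT_comp (mLM M) (measurable_rho y)).
  apply: (@le_trans _ _ (\int[nu]_x ((2 * LM M x ^+ 2)%:E + (2 * LM M (rho y x) ^+ 2)%:E))%E).
    apply: ae_ge0_le_integral => //.
    - by move=> x _; rewrite lee_fin; apply: mulr_ge0; [apply: mulr_ge0|]; exact: sqr_ge0.
    - by apply/measurable_EFinP/measurable_funM => //; exact: measurable_funX.
    - by move=> x _; rewrite -EFinD lee_fin addr_ge0// mulr_ge0 ?sqr_ge0.
    - apply: emeasurable_funD; apply/measurable_EFinP/measurable_funM => //; exact: measurable_funX.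
    - apply: filterS (probability_one_ae mV nuV) => x Vx _.
      rewrite -EFinD lee_fin.
      have -> : LM M (rho y x) = LM M x - 2 * ip x y / c * LM M (Lam y).
        have -> : rho y x = - (2 * ip x y / c) *: Lam y + x by rewrite scaleNr addrC.
        by rewrite LM_lin// mulNr addrC.
      set a := LM M (Lam y); set b := LM M x; set z := 2 * ip x y / c.
      have -> : (2 / c) ^+ 2 * a ^+ 2 * ip x y ^+ 2 = (z * a) ^+ 2.
        by rewrite /z; field; rewrite gt_eqF.
      by have := sqr_ge0 (2 * b - z * a); nra.
  rewrite ge0_integralD//; last 4 first.
  - by move=> x _; rewrite lee_fin mulr_ge0 ?sqr_ge0.
  - by apply/measurable_EFinP/measurable_funM => //; exact: measurable_funX.
  - by move=> x _; rewrite lee_fin mulr_ge0 ?sqr_ge0.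
  - by apply/measurable_EFinP/measurable_funM => //; exact: measurable_funX.
  have Z (h : borel H -> R) : measurable_fun setT h ->
      (\int[nu]_x (2 * h x ^+ 2)%:E = 2%:E * \int[nu]_x (h x ^+ 2)%:E)%E.
    move=> mh; under eq_integral do rewrite EFinM.
    rewrite ge0_integralZl//; first exact/measurable_EFinP/measurable_funX.
    by move=> x _; rewrite lee_fin sqr_ge0.
  rewrite (Z _ (mLM M)) (Z _ mLMr) (second_moment_rho c0 (mLM M)).
  have -> : (4 * (l - u M))%:E = (2%:E * (l - u M)%:E + 2%:E * (l - u M)%:E)%E.
    by rewrite -!EFinM -EFinD; congr EFin; ring.
  by apply: leeD; apply: lee_pmul => //; apply: integral_ge0 => x _; rewrite lee_fin sqr_ge0.
have lu0 : (fun M => 4 * (l - u M) / ((2 / c) ^+ 2 * qR)) @ \oo --> (0 : R).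
  rewrite -[X in _ --> X](mul0r ((2 / c) ^+ 2 * qR)^-1); apply: cvgM; last exact: cvg_cst.
  rewrite -[X in _ --> X](mulr0 4); apply: cvgM; first exact: cvg_cst.
  by rewrite -[X in _ --> X](subrr l); apply: cvgB => //; exact: cvg_cst.
have k0 : 0 < (2 / c) ^+ 2 * qR by rewrite mulr_gt0// exprn_gt0// divr_gt0.
have a2 : (fun M => LM M (Lam y) ^+ 2) @ \oo --> (0 : R).
  apply: (squeeze_cvgr _ (cvg_cst 0) lu0); apply: nearW => M.
  by rewrite sqr_ge0/= ler_pdivlMr// mulrC mulrAC; exact: key.
have a1 : (fun M => LM M (Lam y)) @ \oo --> (0 : R).
  apply/cvgr0Pnorm_le => eps e0; have e2 : 0 < eps ^+ 2 by rewrite exprn_gt0.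
  move/cvgr0Pnorm_le : a2 => /(_ _ e2); apply: filterS => M.
  by rewrite normrX ler_pXn2r// ?nnegrE// ltW.
have : (fun M => L (Lam y) - LM M (Lam y)) @ \oo --> (L (Lam y) - 0).
  by apply: cvgB => //; exact: cvg_cst.
rewrite subr0; apply: cvg_trans; apply: near_eq_cvg; apply: nearW => M.
rewrite /LM subKr /t /functional_trunc (ip_sumr hip).
by apply: eq_bigr => i _; rewrite (ipZr hip).
Qed.

End prior.

(** * Convolutions and full subspaces *)

Lemma integral_1D (R : realType) d (T : measurableType d) (P : probability T R)
    (f : T -> R) (c : R) : measurable_fun setT f -> (forall x, `|f x| <= c) ->
  (\int[P]_x (1 + f x)%:E = (1 + \int[P]_x f x)%:E)%E.
Proof.
move=> mf fc.
have fi := bounded_integrable P mf fc.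
have i1 : P.-integrable setT (EFin \o cst 1).
  by apply: (@bounded_integrable _ _ _ _ _ 1) => // x; rewrite /cst normr1.
rewrite (integral_EFin_Rintegral (integrableD_EFin i1 fi)) RintegralD//.
by rewrite Rintegral_cst// mul1r [X in fine X]probability_setT.
Qed.

Section convolution.
Context {R : realType} {H : completeNormedModType R} (ip : H -> H -> R).
Hypothesis hip : is_inner_product ip.
Variable e : nat -> H.
Hypothesis e_onb : orthonormal_basis ip e.
Hypothesis sepH : separable_space H.
Variables (nu g : probability (borel H) R) (Bnu B : H -> R) (T T' : H -> H).
Hypothesis T_adj : forall x h, ip (T x) h = ip x (T' h).
Hypotheses (nuB : gaussian_cf ip nu 0 Bnu) (gB : gaussian_cf ip g 0 B).
Hypothesis Bnu_split : forall h, Bnu h = B h + Bnu (T' h).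
Hypothesis B_opp : forall h, B (- h) = B h.

Let f (zx : borel H * borel H) : borel H := (zx.1 : H) + T zx.2.

Let mf : measurable_fun setT f.
Proof.
apply: (measurable_fun_borel hip e_onb sepH) => i.
under eq_fun do rewrite /f (ipDl hip) T_adj.
apply: measurable_funD.
- exact: (measurableT_comp (measurable_ip hip (e i)) measurable_fst).
- exact: (measurableT_comp (measurable_ip hip (T' (e i))) measurable_snd).
Qed.

Let law : probability (borel H) R := image_probability (product_measure1 g nu) mf.

Let law_cf : gaussian_cf ip law 0 Bnu.
Proof.
move=> h th.
have mc : measurable_fun setT (fun x : borel H => cos (ip x h + th)) by exact: measurable_cos_ip.
rewrite /law (@Rintegral_image _ _ _ _ _ _ _ _ _ 1)//; last by move=> y; exact: cos_max.
have mcf : measurable_fun setT (fun zx => cos (ip (f zx) h + th)).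
  exact: (measurableT_comp mc mf).
have := @integral_1D R _ _ (product_measure1 g nu) _ 1 mcf (fun x => cos_max _).
(* Adding 1 to the cosine makes Tonelli's theorem applicable. *)
rewrite fubini_tonelli1//=; last exact/measurable_EFinP/measurable_funD.
rewrite /fubini_F.
have in1 z : (\int[nu]_y (1 + cos (ip (f (z, y)) h + th))%:E =
    (1 + cos (ip z h + th) * expR (- (Bnu (T' h) / 2)))%:E)%E.
  have -> : (fun y : borel H => (1 + cos (ip (f (z, y)) h + th))%:E) =
      (fun y : borel H => (1 + cos (ip y (T' h) + (ip z h + th)))%:E).
    apply/funext => y; rewrite /f/= (ipDl hip) T_adj; congr (1 + cos _)%:E; ring.
  rewrite (integral_1D _ (c := 1)); last 2 first.
  - exact: measurable_cos_ip.
  - by move=> y; exact: cos_max.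
  by rewrite nuB (ip0l hip) add0r.
under eq_integral do rewrite in1.
set k := expR _ in in1 *.
have kc (z : borel H) : `|cos (ip z h + th) * k| <= k.
  by rewrite normrM (ger0_norm (expR_ge0 _)) ler_piMl ?expR_ge0// cos_max.
rewrite (integral_1D _ (c := k))//; last exact: measurable_funM.
rewrite RintegralZr//; last exact: (bounded_integrable _ mc (fun x => cos_max _)).
rewrite gB (ip0l hip) => -[] /addrI <-.
by rewrite /k -mulrA -expRD (Bnu_split h); congr (_ * expR _); field.
Qed.

Let law_nu (A : set (borel H)) : measurable A -> (g \x nu)%E (f @^-1` A) = nu A.
Proof. exact: (gaussian_cf_ext hip e_onb sepH law_cf nuB). Qed.

(** If [nu] is the law of [z + T x] with independent [z] and [x], of laws [g]
    and [nu], then some translate of a subspace of full [nu]-measure has full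
    [g]-measure, and by symmetry of [g] the translation is by an element of the
    subspace. *)
Lemma convolution_full_subspace (V : set (borel H)) : measurable V -> nu V = 1%E ->
  (forall (a : R) (x y : H), V x -> V y -> V (a *: x + y)) -> g V = 1%E.
Proof.
move=> mV nuV V_lin.
have mfV : measurable (f @^-1` V) by rewrite -[X in measurable X]setTI; exact: mf.
pose N := f @^-1` (~` V).
have mN : measurable N by rewrite /N preimage_setC; exact: measurableC.
have N0 : (g \x nu)%E N = 0%E.
  rewrite law_nu; last exact: measurableC.
  by rewrite probability_setC// nuV subee.
have [x Nx] : exists x : borel H, g (ysection N x) = 0%E.
  have : (\int[nu]_x `|g (ysection N x)| = 0)%E.
    rewrite -[RHS]N0.
    have := @product_measure_unique _ _ _ _ _ g nu (product_measure2 g nu).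
    by move=> ->//; [apply: eq_integral => x _; rewrite gee0_abs|exact: product_measure2E].
  move=> /(ae_eq_integral_abs _ measurableT) h.
  have /h {}h : measurable_fun setT (fun x : borel H => g (ysection N x)).
    exact: measurable_fun_ysection.
  have [x hx] := ae_nonempty h.
  by exists x; exact: (hx Logic.I).
pose V1 : set (borel H) := [set z | V (f (z, x))].
have mV1 : measurable V1.
  rewrite (_ : V1 = ~` ysection N x); first by apply: measurableC; exact: measurable_ysection.
  by apply/seteqP; split => z; rewrite /V1 /N /ysection/= inE /=; [move=> h; apply|move=> /contrapT].
have gV1 : g V1 = 1%E.
  rewrite (_ : V1 = ~` ysection N x).
    by rewrite probability_setC ?Nx ?sube0//; exact: measurable_ysection.
  by apply/seteqP; split => z; rewrite /V1 /N /ysection/= inE /=; [move=> h; apply|move=> /contrapT].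
have mopp : measurable_fun setT (-%R : borel H -> borel H).
  apply: (measurable_fun_borel hip e_onb sepH) => i.
  under eq_fun do rewrite (ipNl hip).
  by apply: measurableT_comp => //; exact: measurable_ip.
have gopp : g [set z | V1 (- z)] = 1%E.
  rewrite -gV1; apply: (gaussian_cf_invariant hip e_onb sepH (phi := -%R)
    (phiT := -%R) (a := 0) mopp _ _ B_opp gB mV1).
  - by move=> z h; rewrite (ipNl hip) (ipNr hip) (ip0l hip) addr0.
  - by rewrite oppr0.
have mV1o : measurable ([set z | V1 (- z)] : set (borel H)).
  by have := mopp measurableT _ mV1; rewrite setTI.
(* [z + T x] and [- z + T x] are in [V], hence so is half their sum. *)
have [z [Vz Vmz]] : exists z : borel H, V1 z /\ V1 (- z).
  apply: (@ae_nonempty _ _ _ g); apply: filterI.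
    exact: probability_one_ae mV1 gV1.
  exact: probability_one_ae mV1o gopp.
have V0 : V 0.
  by rewrite -[0](addNr (f (z, x))) -scaleN1r; exact: V_lin.
have VTx : V (T x).
  have -> : T x = 2^-1 *: (1 *: f (z, x) + f (- z, x)) + 0.
    rewrite addr0 scale1r /f/= addrACA subrr add0r -[X in X + X]scale1r -scalerDl scalerA.
    by rewrite -[1 + 1]/(2%:R) mulVf ?scale1r// pnatr_eq0.
  by apply: (V_lin) => //; exact: V_lin.
rewrite -gV1; congr (g _); apply/seteqP; split => y; rewrite /V1 /f/= => Vy.
  by rewrite -[y : H]scale1r; exact: V_lin.
have -> : y = - 1 *: T x + ((y : H) + T x) by rewrite scaleN1r addrCA addNr addr0.
exact: V_lin.
Qed.

End convolution.

(** * The posterior as a linear-algebraic object *)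

Section gain.
Context {R : realType} {H1 H2 : completeNormedModType R}.
Variables (ip1 : H1 -> H1 -> R) (ip2 : H2 -> H2 -> R).
Hypotheses (hip1 : is_inner_product ip1) (hip2 : is_inner_product ip2).
Variables (K : {linear H1 -> H2}) (KT : {linear H2 -> H1}).
Hypothesis K_adj : is_adjoint ip1 ip2 K KT.
Variable e : nat -> H1.
Hypothesis e_onb : orthonormal_basis ip1 e.
Variable kappa : nat -> R.
Hypothesis kappa_gt0 : forall i, 0 < kappa i.
Hypothesis K_eigen : forall i, KT (K (e i)) = kappa i ^+ 2 *: e i.
Variables (n : nat) (Lam Half : {linear H1 -> H1}) (lam : nat -> R).
Hypothesis n_gt0 : (0 < n)%N.
Hypothesis Half_sqrt : is_sqrt_operator ip1 Lam Half.
Hypothesis lam_gt0 : forall i, 0 < lam i.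
Hypothesis Lam_e : forall i, Lam (e i) = lam i *: e i.
Variables (A : {linear H2 -> H1}) (AT : {linear H1 -> H2}).
Hypothesis A_gain : is_posterior_gain n K KT Lam A.
Hypothesis A_adj : is_adjoint ip2 ip1 A AT.

Local Notation M := (marginal_cov n K KT Lam).
Let Lam_sym := sqrt_selfadjoint hip1 Half_sqrt.

Let K_adjr y x : ip2 y (K x) = ip1 (KT y) x.
Proof. by rewrite (ipC hip2) K_adj (ipC hip1). Qed.

Lemma marginal_form y :
  ip2 (M y) y = n%:R^-1 * ip2 y y + ip1 (Lam (KT y)) (KT y).
Proof. by rewrite /marginal_cov (ipDl hip2) (ipZl hip2) K_adj. Qed.

Lemma marginal_selfadjoint x y : ip2 (M x) y = ip2 x (M y).
Proof.
rewrite /marginal_cov (ipDl hip2) (ipDr hip2) (ipZl hip2) (ipZr hip2) K_adj K_adjr.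
by rewrite Lam_sym.
Qed.

Lemma gain_marginal y : A (M y) = Lam (KT y).
Proof. by case: A_gain => Minv [_ MK ->]; rewrite MK. Qed.

(** That is, [A^T = M^-1 K Lam], by symmetry of [M] and [Lam]. *)
Lemma marginal_gain_adj h : M (AT h) = K (Lam h).
Proof.
suff E y : ip2 (M (AT h) - K (Lam h)) y = 0.
  by have := ipxx_eq0 hip2 (E _) => /eqP; rewrite subr_eq0 => /eqP.
rewrite (ipBl hip2) marginal_selfadjoint (ipC hip2) -A_adj gain_marginal.
by rewrite K_adj Lam_sym (ipC hip1) subrr.
Qed.

Lemma gain_forward_adj x h : ip1 (A (K x)) h = ip1 x (KT (AT h)).
Proof. by rewrite A_adj K_adj. Qed.

(** The weight of the data in the posterior mean of the [i]th coordinate. *)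
Definition shrinkage i : R := n%:R * lam i * kappa i ^+ 2 / (1 + n%:R * lam i * kappa i ^+ 2).

Let x_gt0 i : 0 < n%:R * lam i * kappa i ^+ 2.
Proof. by rewrite !mulr_gt0 ?exprn_gt0// ltr0n. Qed.

Let marginal_e i : M (K (e i)) = (n%:R^-1 + lam i * kappa i ^+ 2) *: K (e i).
Proof.
by rewrite /marginal_cov K_eigen linearZ/= Lam_e scalerA linearZ/= -scalerDl [kappa i ^+ 2 * _]mulrC.
Qed.

Let marginal_scale a y : M (a *: y) = a *: M y.
Proof.
rewrite /marginal_cov [KT _]linearZ/= [Lam _]linearZ/= [K _]linearZ/= scalerDr.
by rewrite !scalerA mulrC.
Qed.

(** [K (e i)] is an eigenvector of [M], so the equation [M (A^T e_i) = K Lam e_i]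
    is solved by a multiple of it. *)
Lemma gain_adj_e i : AT (e i) = (shrinkage i / kappa i ^+ 2) *: K (e i).
Proof.
case: A_gain => Minv [_ MK _]; apply: (can_inj MK).
rewrite marginal_gain_adj Lam_e linearZ/=.
rewrite marginal_scale marginal_e scalerA; congr (_ *: _); rewrite /shrinkage.
have n0 : n%:R != 0 :> R by rewrite pnatr_eq0 -lt0n.
have k0 : kappa i != 0 by rewrite gt_eqF.
field; rewrite n0 k0 gt_eqF// ltr_wpDl//.
Qed.

Lemma gain_forward_coord x i : ip1 (A (K x)) (e i) = shrinkage i * ip1 x (e i).
Proof.
rewrite A_adj gain_adj_e (ipZr hip2) K_adj K_eigen (ipZr hip1).
by field; rewrite gt_eqF.
Qed.

Lemma gain_adj_coord h i : ip1 (KT (AT h)) (e i) = shrinkage i * ip1 h (e i).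
Proof.
rewrite (ipC hip1) -gain_forward_adj.
have -> : A (K (e i)) = shrinkage i *: e i.
  apply: (onb_ext e_onb) => j; rewrite gain_forward_coord (ipZl hip1) (onb_ip e_onb).
  by have [->|_] := eqVneq i j; rewrite ?mulr0.
by rewrite (ipZl hip1) (ipC hip1).
Qed.

(** The mean of the posterior mean lies where [full_subspace_cov] and
    [functional_cov_cvg] apply. *)
Lemma gain_range x : exists y, A (K x) = Lam y.
Proof. by case: A_gain => Minv [_ _ ->]; exists (KT (Minv (K x))). Qed.

Local Notation S := (posterior_cov n K KT Lam A AT).

Let posterior_form h : ip1 (S h) h = ip1 (Lam h) h - ip2 (M (AT h)) (AT h).
Proof. by rewrite /posterior_cov (ipBl hip1) A_adj. Qed.

(** With [y = A^T h], the subtracted variance is [<M y, y> = <Lam h, K^T y>],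
    which dominates [<Lam K^T y, K^T y>]; Cauchy-Schwarz for the form of [Lam]
    then bounds it by [<Lam h, h>]. *)
Lemma posterior_form_ge0 h : 0 <= ip1 (S h) h.
Proof.
rewrite posterior_form subr_ge0.
have cE : ip2 (M (AT h)) (AT h) = ip1 (Half h) (Half (KT (AT h))).
  by rewrite marginal_gain_adj K_adj (sqrt_form Half_sqrt).
have bc : ip1 (Half (KT (AT h))) (Half (KT (AT h))) <= ip2 (M (AT h)) (AT h).
  rewrite marginal_form -(sqrt_form Half_sqrt) lerDr mulr_ge0 ?invr_ge0 ?ler0n//.
  exact: ipxx_ge0.
have := ip_norm_le hip1 (Half h) (Half (KT (AT h))).
move: bc; rewrite -cE (sqrt_form Half_sqrt) !(ipxx hip1).
set c := ip2 _ _; set u := `|Half h|; set v := `|Half (KT (AT h))|.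
move=> bc /(le_trans (ler_norm _)) cuv.
have u0 : 0 <= u by exact: normr_ge0.
have v0 : 0 <= v by exact: normr_ge0.
have vu : v <= u.
  have [->//|v1] := eqVneq v 0; have vp : 0 < v by rewrite lt_neqAle eq_sym v1.
  by rewrite -(ler_pM2r vp) -expr2 (le_trans bc).
by rewrite (le_trans cuv)// expr2 ler_wpM2l.
Qed.

(** Variance of the error of the posterior: the posterior spread plus the
    sampling variance of the posterior mean. *)
Definition error_cov (h : H1) : H1 := Lam h - A (K (Lam (KT (AT h)))).

Lemma error_form h :
  n%:R^-1 * ip2 (AT h) (AT h) + ip1 (S h) h = ip1 (error_cov h) h.
Proof.
rewrite posterior_form marginal_form /error_cov (ipBl hip1) gain_forward_adj; ring.
Qed.

(** The prior is the law of the error plus an independent shrunken copy of the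
    parameter. *)
Lemma prior_form_split h :
  ip1 (Lam h) h = ip1 (error_cov h) h + ip1 (Lam (KT (AT h))) (KT (AT h)).
Proof. by rewrite /error_cov (ipBl hip1) gain_forward_adj subrK. Qed.

Definition error_eigenvalue i : R := lam i - shrinkage i ^+ 2 * lam i.

Lemma error_coord h i : ip1 (error_cov h) (e i) = error_eigenvalue i * ip1 h (e i).
Proof.
rewrite /error_cov (ipBl hip1) gain_forward_coord.
rewrite !(sqrt_coord hip1 Half_sqrt Lam_e) gain_adj_coord /error_eigenvalue; ring.
Qed.

End gain.

(** * The law of the posterior error *)

Section error_law.
Context {R : realType} {H1 H2 : completeNormedModType R}.
Variables (ip1 : H1 -> H1 -> R) (ip2 : H2 -> H2 -> R).
Hypotheses (hip1 : is_inner_product ip1) (hip2 : is_inner_product ip2).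
Hypothesis sepH1 : separable_space H1.
Variables (K : {linear H1 -> H2}) (KT : {linear H2 -> H1}).
Hypothesis K_adj : is_adjoint ip1 ip2 K KT.
Variable e : nat -> H1.
Hypothesis e_onb : orthonormal_basis ip1 e.
Variable kappa : nat -> R.
Hypothesis kappa_gt0 : forall i, 0 < kappa i.
Hypothesis K_eigen : forall i, KT (K (e i)) = kappa i ^+ 2 *: e i.
Variables (n : nat) (Lam Half : {linear H1 -> H1}) (lam : nat -> R).
Hypothesis n_gt0 : (0 < n)%N.
Hypothesis Half_sqrt : is_sqrt_operator ip1 Lam Half.
Hypothesis lam_gt0 : forall i, 0 < lam i.
Hypothesis Lam_e : forall i, Lam (e i) = lam i *: e i.
Variable prior : probability (borel H1) R.
Hypothesis prior_gaussian : is_gaussian ip1 prior 0 Lam.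
Variables (d : measure_display) (Omega : measurableType d) (mu0 : H1).
Variables (P : probability Omega R) (Y : H2 -> {mfun Omega >-> R}).
Hypothesis Y_law : is_signal_in_white_noise ip2 P n (K mu0) (fun h => Y h).
Variables (A : {linear H2 -> H1}) (AT : {linear H1 -> H2}).
Hypothesis A_gain : is_posterior_gain n K KT Lam A.
Hypothesis A_adj : is_adjoint ip2 ip1 A AT.
Variable AY : {mfun Omega >-> borel H1}.
Hypothesis AY_repr : represents_process ip1 P (fun h => Y h) AT AY.
Variable Pi : R.-pker Omega ~> (borel H1).
Hypothesis Pi_posterior : {ae P, forall w, is_gaussian ip1 (Pi w) (AY w)
        (posterior_cov n K KT Lam A AT)}.

Local Notation S := (posterior_cov n K KT Lam A AT).
Local Notation D := (error_cov K KT Lam A AT).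
Local Notation m0 := (A (K mu0)).

Let noise_cos g th :
  \int[P]_w cos (Y g w + th) =
  cos (ip2 (K mu0) g + th) * expR (- (n%:R^-1 * ip2 g g / 2)).
Proof.
case: Y_law => gp EY covY.
have [m [v]] := gp 1%N (fun=> 1) (fun=> g).
under eq_fun do rewrite big_ord1 mul1r.
move=> hv.
(* A negative [v] encodes a point mass, like [v = 0]. *)
have {}hv : has_normal_law P (Y g) m (Num.max v 0).
  move=> B mB; apply: etrans (hv B mB) _; rewrite /normal_law.
  by have [v0|v0] := ltP 0 v; rewrite ?v0 ?ltxx.
have v0 : 0 <= Num.max v 0 by rewrite le_max lexx orbT.
have mY : measurable_fun setT (Y g) by exact: measurable_funPT.
have [mE vE] := normal_law_moments mY v0 hv (EY g) (covY g g).
rewrite -mE -vE; have := normal_law_cos th 1 mY v0 hv.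
rewrite mul1r expr1n mul1r => <-.
by apply: eq_Rintegral => w _; rewrite mul1r.
Qed.

Let posterior_mean_cos h th :
  \int[P]_w cos (ip1 (AY w) h + th) =
  cos (ip1 m0 h + th) * expR (- (n%:R^-1 * ip2 (AT h) (AT h) / 2)).
Proof.
rewrite A_adj -noise_cos; apply: Rintegral_ae_eq.
- apply: (measurableT_comp (measurable_cos_ip hip1 h th)); exact: measurable_funPT.
- apply: measurableT_comp; first exact: continuous_measurable_fun (@continuous_cos R).
  by apply: measurable_funD => //; exact: measurable_funPT.
- by apply: filterS (AY_repr h) => w ->.
Qed.

Let Pi_prob w : exists pr : probability (borel H1) R,
  forall B, measurable B -> pr B = Pi w B.
Proof.
exists (mixture (dirac w) Pi) => B mB; rewrite /= /mixture integral_dirac//.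
  by rewrite diracT mul1e.
exact: measurable_kernel.
Qed.

Let posterior_cos w h th : is_gaussian ip1 (Pi w) (AY w) S ->
  (\int[Pi w]_z (1 + cos (ip1 z h + th))%:E =
   (1 + cos (ip1 (AY w) h + th) * expR (- (ip1 (S h) h / 2)))%:E)%E.
Proof.
move=> gw; have [pr prE] := Pi_prob w.
have mcos : measurable_fun setT (fun z : borel H1 => cos (ip1 z h + th)).
  exact: measurable_cos_ip.
have gpr : is_gaussian ip1 pr (AY w) S.
  move=> g B mB; rewrite prE; first exact: gw.
  by have := measurable_ip hip1 g measurableT mB; rewrite setTI.
have S0 := posterior_form_ge0 hip1 hip2 K_adj Half_sqrt A_gain A_adj.
rewrite -(is_gaussian_cf hip1 S0 gpr) -(integral_1D pr (c := 1))//; last first.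
  by move=> z; exact: cos_max.
by apply: eq_measure_integral => B mB _; exact/esym/prE.
Qed.

(** The law, averaged over the data, of a parameter drawn from the posterior. *)
Local Notation Q := (mixture P Pi).

Let Q_cf : gaussian_cf ip1 Q m0 (fun h => ip1 (D h) h).
Proof.
move=> h th.
have mcos : measurable_fun setT (fun z : borel H1 => cos (ip1 z h + th)).
  exact: measurable_cos_ip.
have cos1 (x : R) : 0 <= 1 + cos x.
  by have := cos_max x; rewrite ler_norml -lerBlDl sub0r => /andP[].
have m1cos : measurable_fun setT (fun z : borel H1 => (1 + cos (ip1 z h + th))%:E).
  exact/measurable_EFinP/measurable_funD.
pose k := expR (- (ip1 (S h) h / 2)).
have mAY : measurable_fun setT (fun w => cos (ip1 (AY w) h + th)).
  apply: (measurableT_comp mcos); exact: measurable_funPT.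
have := integral_1D Q (c := 1) mcos (fun=> cos_max _).
rewrite integral_mixture//.
have kc (w : Omega) : `|cos (ip1 (AY w) h + th) * k| <= k.
  by rewrite normrM (ger0_norm (expR_ge0 _)) ler_piMl ?expR_ge0// cos_max.
have -> : (\int[P]_w \int[Pi w]_z (1 + cos (ip1 z h + th))%:E =
    \int[P]_w (1 + cos (ip1 (AY w) h + th) * k)%:E)%E.
  apply: ae_eq_integral => //.
  - apply: measurable_fun_integral_kernel => // B mB; exact: measurable_kernel.
  - by apply/measurable_EFinP/measurable_funD => //; exact: measurable_funM.
  - by apply: filterS Pi_posterior => w gw _; rewrite posterior_cos.
rewrite (integral_1D _ (c := k))//; last exact: measurable_funM.
rewrite RintegralZr//; last exact: (bounded_integrable _ mAY (fun x => cos_max _)).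
rewrite posterior_mean_cos => -[] /addrI <-.
rewrite /k -[LHS]mulrA; congr (_ * _); rewrite -expRD; congr expR.
by rewrite -(error_form hip1 hip2 K_adj n Lam A_adj); field; rewrite pnatr_eq0 -lt0n.
Qed.

Let mcenter : measurable_fun setT (fun z : borel H1 => (z : H1) - m0 : borel H1).
Proof.
apply: (measurable_fun_borel hip1 e_onb sepH1) => i.
under eq_fun do rewrite (ipBl hip1).
by apply: measurable_funB => //; exact: measurable_ip.
Qed.

Let Q0 : probability (borel H1) R := image_probability Q mcenter.

Let Q0_cf : gaussian_cf ip1 Q0 0 (fun h => ip1 (D h) h).
Proof.
have := gaussian_cf_affine hip1 mcenter (phiT := id) (a := - m0) _ Q_cf.
by rewrite subrr; apply => x h; rewrite (ipBl hip1) (ipNl hip1).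
Qed.

Let D_coord := error_coord hip1 hip2 K_adj e_onb kappa_gt0 K_eigen n_gt0 Half_sqrt lam_gt0 Lam_e A_gain A_adj.

Variables (L : H1 -> R).
Hypothesis L_linear : is_measurable_linear_functional prior L.

Lemma representer_basis i : representer e Half lam L i = L (e i).
Proof.
by case: L_linear => _ [V [mV pV V0 V_lin L_lin]]; exact: (representerE hip1 e_onb sepH1 Half_sqrt lam_gt0 Lam_e prior_gaussian mV pV V0 V_lin L_lin).
Qed.

(** Chebyshev's inequality for the value of [L] at a point drawn from the
    averaged posterior.  [bias] is the mean of that value, and becomes a bias
    when [c] is the value to be estimated. *)
Lemma posterior_deviation_le : exists bias : R,
  (fun N => \sum_(i < N) L (e i) * (shrinkage kappa n lam i * ip1 mu0 (e i))) @ \oo --> bias /\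
  forall s c t : R, 0 < t ->
    (forall N, \sum_(i < N) L (e i) ^+ 2 * error_eigenvalue kappa n lam i <= s) ->
    (\int[P]_w Pi w [set mu : H1 | t <= `|L mu - c|]%R <=
      (2 * (s + (bias - c) ^+ 2) / t ^+ 2)%:E)%E.
Proof.
case: L_linear => mL [V [mV pV V0 V_lin L_lin]].
have Ve := full_subspace_e hip1 e_onb sepH1 Half_sqrt lam_gt0 Lam_e prior_gaussian mV pV V0 V_lin.
exists (L m0); split.
  have [y m0y] := gain_range A_gain mu0.
  have := functional_cov_cvg hip1 e_onb sepH1 Half_sqrt lam_gt0 Lam_e prior_gaussian
    mL mV pV V0 V_lin L_lin (y := y).
  rewrite -m0y; apply: cvg_trans; apply: near_eq_cvg; apply: nearW => N.
  apply: eq_bigr => i _.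
  by rewrite (gain_forward_coord hip1 hip2 K_adj kappa_gt0 K_eigen n_gt0 Half_sqrt lam_gt0 Lam_e A_gain A_adj).
move=> s c t t0 hs.
have Vm0 : V m0.
  have [y ->] := gain_range A_gain mu0.
  exact: (full_subspace_cov hip1 e_onb sepH1 Half_sqrt prior_gaussian mV pV V0 V_lin).
have Q0V : Q0 V = 1%E.
  apply: (convolution_full_subspace hip1 e_onb sepH1 (T := fun x => A (K x))
    (gain_forward_adj K_adj A_adj) (prior_cf hip1 Half_sqrt prior_gaussian) Q0_cf
    _ _ mV pV V_lin) => h.
  - exact: (prior_form_split hip1 K_adj).
  - by have := diagonal_scale hip1 e_onb D_coord (-1) h; rewrite scaleN1r sqrrN expr1n mul1r.
have L2 : (\int[Q0]_x (L x ^+ 2)%:E <= s%:E)%E.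
  apply: (functional_second_moment hip1 e_onb sepH1 Q0_cf
    (diagonal_refl hip1 e_onb D_coord) (diagonal_scale hip1 e_onb D_coord)
    mL mV Q0V V0 V_lin L_lin Ve) => N.
  have := diagonal_sum hip1 e_onb D_coord N (fun i => L (e i)) => h.
  by rewrite [leLHS]h.
set b := L m0 - c.
pose E : set (borel H1) := [set mu | t <= `|L mu - c|]%R.
have mE : measurable E.
  have : measurable_fun setT (fun mu : borel H1 => `|L mu - c|).
    by apply: measurableT_comp => //; exact: measurable_funB.
  move=> /(_ measurableT _ (measurable_itv `[t, +oo[)); rewrite setTI.
  by congr measurable; apply/seteqP; split => x; rewrite /E/= in_itv/= andbT.
have mE0 : measurable ([set z | E ((z : H1) + m0)] : set (borel H1)).
  have mshift : measurable_fun setT (fun z : borel H1 => (z : H1) + m0 : borel H1).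
    apply: (measurable_fun_borel hip1 e_onb sepH1) => i.
    under eq_fun do rewrite (ipDl hip1).
    by apply: measurable_funD => //; exact: measurable_ip.
  by have := mshift measurableT _ mE; rewrite setTI.
set E0 := [set z | _] in mE0.
have -> : (\int[P]_w Pi w E)%E = Q0 E0.
  rewrite image_probabilityE -[LHS]/(Q E); congr (Q _).
  by apply/seteqP; split => z; rewrite /E0/= subrK.
have Q0E0 : Q0 E0 \is a fin_num by exact: fin_num_measure.
rewrite -(fineK Q0E0) lee_fin ler_pdivlMr ?exprn_gt0// mulrC -lee_fin EFinM (fineK Q0E0).
have -> : ((t ^+ 2)%:E * Q0 E0 = \int[Q0]_z (t ^+ 2 * \1_E0 z)%:E)%E.
  under eq_integral do rewrite EFinM.
  rewrite ge0_integralZl//; last by rewrite lee_fin sqr_ge0.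
    by rewrite integral_indic// setIT.
  exact/measurable_EFinP.
apply: (@le_trans _ _ (\int[Q0]_z ((2 * L z ^+ 2)%:E + (2 * b ^+ 2)%:E))%E).
  apply: ae_ge0_le_integral => //.
  - by move=> z _; rewrite lee_fin mulr_ge0 ?sqr_ge0.
  - exact/measurable_EFinP/measurable_funM.
  - by move=> z _; rewrite -EFinD lee_fin addr_ge0// mulr_ge0 ?sqr_ge0.
  - apply: emeasurable_funD => //; apply/measurable_EFinP/measurable_funM => //.
    exact: measurable_funX.
  - apply: filterS (probability_one_ae mV Q0V) => z Vz _.
    rewrite -EFinD lee_fin indicE; case: (boolP (z \in E0)) => [|_]; last first.
      by rewrite mulr0 addr_ge0// mulr_ge0 ?sqr_ge0.
    rewrite inE /E0 /E/= (functional_add L_lin)// -addrA -/b mulr1 => tz.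
    apply: (@le_trans _ _ ((L z + b) ^+ 2)).
      by rewrite -(real_normK (num_real (L z + b))) ler_pXn2r ?nnegrE// ltW.
    by have := sqr_ge0 (L z - b); nra.
rewrite ge0_integralD//; last 3 first.
- by move=> z _; rewrite lee_fin mulr_ge0 ?sqr_ge0.
- by apply/measurable_EFinP/measurable_funM => //; exact: measurable_funX.
- by move=> z _; rewrite lee_fin mulr_ge0 ?sqr_ge0.
rewrite integral_cst// [X in (_ + _ * X)%E]probability_setT mule1 mulrDr EFinD leeD2r//.
under eq_integral do rewrite EFinM.
rewrite ge0_integralZl//; last 2 first.
- exact/measurable_EFinP/measurable_funX.
- by move=> z _; rewrite lee_fin sqr_ge0.
by rewrite EFinM; apply: lee_pmul => //; apply: integral_ge0 => z _; rewrite lee_fin sqr_ge0.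
Qed.

End error_law.

(** * Sobolev sequences *)

Section sobolev_sequences.
Context {R : realType}.
Implicit Types (u v : nat -> R) (s r : R).

Lemma powRS_gt0 (i : nat) s : 0 < i.+1%:R `^ s :> R.
Proof. by rewrite powR_gt0// ltr0n. Qed.

Lemma sobolev_norm_le_partial s r u : (sobolev_norm s u <= r%:E)%E ->
  forall N, \sum_(i < N) u i ^+ 2 * i.+1%:R `^ (2 * s) <= r ^+ 2.
Proof.
move=> ur N.
pose f i := ((u i ^+ 2 * i.+1%:R `^ (2 * s))%:E)%E.
have f0 i : (0 <= f i)%E by rewrite lee_fin mulr_ge0 ?sqr_ge0 ?powR_ge0.
have S0 : (0 <= \sum_(0 <= i <oo) f i)%E by exact: nneseries_ge0.
have r0 : 0 <= r by rewrite -lee_fin; apply: le_trans ur; exact: sqrte_ge0.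
rewrite -lee_fin -sumEFin -(big_mkord xpredT f).
apply: (@le_trans _ _ (\sum_(0 <= i <oo) f i)%E); first exact: nneseries_lim_ge.
rewrite -(sqr_sqrte S0) EFin_expe.
by rewrite !expe2; apply: lee_pmul => //; exact: sqrte_ge0.
Qed.

Lemma sobolev_norm_finite s u : sobolev s u ->
  exists r, (sobolev_norm s u <= r%:E)%E.
Proof.
rewrite /sobolev/= => uoo; exists (fine (sobolev_norm s u)).
by rewrite fineK// ge0_fin_numE// sqrte_ge0.
Qed.

(** Term by term, [|l u| w^(q + beta) <= (l^2 w^(2 q) + u^2 w^(2 beta)) / 2] with
    [w = i + 1]. *)
Lemma sobolev_pairing_le q beta (l u c : nat -> R) (a b k : R) :
  0 <= k -> (forall N, \sum_(i < N) l i ^+ 2 * i.+1%:R `^ (2 * q) <= a) ->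
  (forall N, \sum_(i < N) u i ^+ 2 * i.+1%:R `^ (2 * beta) <= b) ->
  (forall i, `|c i| <= k * i.+1%:R `^ (q + beta)) ->
  forall N, \sum_(i < N) `|c i * (l i * u i)| <= k * ((a + b) / 2).
Proof.
move=> k0 la ub ck N.
apply: (@le_trans _ _ (\sum_(i < N) k * ((l i ^+ 2 * i.+1%:R `^ (2 * q) +
    u i ^+ 2 * i.+1%:R `^ (2 * beta)) / 2))); last first.
  rewrite -mulr_sumr -mulr_suml big_split/=; apply: ler_wpM2l => //.
  by rewrite ler_pM2r ?invr_gt0//; exact: lerD (la N) (ub N).
apply: ler_sum => i _; rewrite !normrM.
have w0 : (i.+1%:R : R) != 0 by rewrite pnatr_eq0.
have sq z : (i.+1%:R : R) `^ (2 * z) = (i.+1%:R `^ z) ^+ 2.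
  by rewrite mulrC powRrM powR_mulrn// powR_ge0.
rewrite !sq; set x := i.+1%:R `^ q; set y := i.+1%:R `^ beta.
have x0 : 0 < x by exact: powRS_gt0.
have y0 : 0 < y by exact: powRS_gt0.
have := ck i; rewrite powRD ?w0 ?implybT// -/x -/y => h.
rewrite -[l i ^+ 2]real_normK ?num_real// -[u i ^+ 2]real_normK ?num_real//.
have l0 : 0 <= `|l i| by []. have u0 : 0 <= `|u i| by [].
set L := `|l i| in l0 *; set U := `|u i| in u0 *.
apply: (@le_trans _ _ (k * (x * y) * (L * U))).
  by rewrite ler_wpM2r// mulr_ge0.
rewrite -mulrA ler_wpM2l//.
by have := sqr_ge0 (L * x - U * y); nra.
Qed.

Lemma series_cvg_of_partial (f : nat -> R) (b : R) :
  (forall N, \sum_(i < N) `|f i| <= b) -> cvgn (series f).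
Proof.
move=> fb; apply: normed_cvg; apply: nondecreasing_is_cvgn.
  by apply: nondecreasing_series => i _ _; exact: normr_ge0.
exists b => /= _ [N _ <-].
by rewrite /series/= big_mkord; exact: fb.
Qed.

End sobolev_sequences.

(** * Bias and variance of the posterior *)

Section bias_variance.
Context {R : realType}.
Variables (alpha p beta C q tau : R) (n : nat) (kappa : nat -> R).
Hypotheses (alpha_gt0 : 0 < alpha) (p_ge0 : 0 <= p).
Hypotheses (C_ge1 : 1 <= C) (tau_gt0 : 0 < tau) (n_gt0 : (0 < n)%N).
Hypotheses (kappa_gt0 : forall i, 0 < kappa i) (q_ge : - beta <= q).
Hypothesis kappa_bounds : forall i,
  C^-1 * i.+1%:R `^ (- p) <= kappa i <= C * i.+1%:R `^ (- p).

Local Notation D := (1 + 2 * alpha + 2 * p).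
Local Notation x := (n%:R * tau ^+ 2).
Local Notation lam := (prior_eigenvalue alpha tau).
Local Notation shr := (shrinkage kappa n lam).

Let D_gt0 : 0 < D.
Proof. by rewrite ltr_wpDr ?mulr_ge0// ltr_wpDr// mulr_ge0 // ltW. Qed.

Let x_gt0 : 0 < x. Proof. by rewrite mulr_gt0 ?ltr0n// exprn_gt0. Qed.

Lemma prior_eigenvalue_gt0 i : 0 < lam i.
Proof. by rewrite mulr_gt0 ?powRS_gt0 ?exprn_gt0. Qed.

Let y i := n%:R * lam i * kappa i ^+ 2.

Let y_gt0 i : 0 < y i.
Proof. by rewrite !mulr_gt0 ?exprn_gt0 ?prior_eigenvalue_gt0 ?ltr0n. Qed.

Let y_ge i : C ^- 2 * x * i.+1%:R `^ (- D) <= y i.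
Proof.
have k := kappa_bounds i; have w0 : (i.+1%:R : R) != 0 by rewrite pnatr_eq0.
have -> : - D = (- 1 - 2 * alpha) + (- p + - p) by ring.
rewrite (@powRD _ _ (- 1 - 2 * alpha)) ?w0 ?implybT// (@powRD _ _ (- p)) ?w0 ?implybT// /y /prior_eigenvalue.
set W := i.+1%:R `^ (-1 - 2 * alpha); set z := i.+1%:R `^ (- p) in k *.
have W0 : 0 < W by exact: powRS_gt0.
have z0 : 0 < z by exact: powRS_gt0.
have -> : C ^- 2 * x * (W * (z * z)) = n%:R * (tau ^+ 2 * W) * (C^-1 * z) ^+ 2.
  by rewrite exprMn exprVn; ring.
have t0 := ltW tau_gt0; have {}W0 := ltW W0.
rewrite ler_wpM2l ?mulr_ge0 ?ler0n//.
case/andP : k => k _; rewrite ler_pXn2r// nnegrE ?(ltW (kappa_gt0 i))//.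
by rewrite mulr_ge0 ?invr_ge0 ?(ltW z0)// (le_trans ler01).
Qed.

(** [1 - shr i = (1 + y i)^-1], and [1 + y >= y^th] for [0 <= th <= 1]. *)
Lemma onem_shrinkage_le th i : 0 <= th <= 1 ->
  0 <= 1 - shr i <= C ^+ 2 * x `^ (- th) * i.+1%:R `^ (D * th).
Proof.
move=> /andP[th0 th1].
have y1 : 0 < 1 + y i by rewrite addr_gt0.
have -> : 1 - shr i = (1 + y i)^-1.
  by rewrite /shrinkage -/(y i); field; rewrite gt_eqF.
rewrite invr_ge0 (ltW y1)/=.
have yth : y i `^ th <= 1 + y i.
  apply: (@le_trans _ _ ((1 + y i) `^ th)).
    by apply: ge0_ler_powR; rewrite ?nnegrE ?(ltW y1) ?(ltW (y_gt0 i))// lerDr.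
  by apply: ler1_powR => //; rewrite lerDl ltW.
have C0 : 0 < C by rewrite (lt_le_trans ltr01).
have C2 : 0 < C ^- 2 by rewrite invr_gt0 exprn_gt0.
have := y_ge i; have := x_gt0; set X := x => X0 yge.
have b0 : 0 < C ^- 2 * X * i.+1%:R `^ (- D) by rewrite mulr_gt0 ?powRS_gt0// mulr_gt0.
have : (C ^- 2 * X * i.+1%:R `^ (- D)) `^ th <= 1 + y i.
  by apply: le_trans yth; apply: ge0_ler_powR => //; rewrite ?nnegrE ltW.
rewrite powRM ?powR_ge0 ?(ltW (mulr_gt0 C2 X0))// powRM ?(ltW C2) ?(ltW X0)//.
rewrite -powRrM mulNr !powRN => h.
have C2th : C ^- 2 <= (C ^- 2) `^ th.
  by apply: ger1_powR => //; rewrite C2/= invf_le1 ?exprn_gt0// exprn_ege1.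
have xp : 0 < X `^ th by rewrite powR_gt0.
have wp := powRS_gt0 i (D * th).
rewrite -[leRHS]invrK lef_pV2 ?posrE ?invr_gt0//; last first.
  by rewrite mulr_gt0// mulr_gt0 ?exprn_gt0// invr_gt0.
apply: le_trans h; rewrite 2!invfM invrK.
by rewrite ler_wpM2r ?invr_ge0 ?(ltW wp)// ler_wpM2r// ltW.
Qed.

Lemma error_eigenvalue_le i : 0 <= error_eigenvalue kappa n lam i <= 2 * lam i * (1 - shr i).
Proof.
have /andP[s0 _] := @onem_shrinkage_le 0 i (introT andP (conj (lexx 0) ler01)).
have s1 : 0 <= shr i.
  by rewrite /shrinkage -/(y i) divr_ge0 ?addr_ge0 ?(ltW (y_gt0 i)).
have l0 := prior_eigenvalue_gt0 i; rewrite /error_eigenvalue.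
have -> : lam i - shr i ^+ 2 * lam i = lam i * ((1 - shr i) * (1 + shr i)) by ring.
apply/andP; split.
  by apply: mulr_ge0; [exact: ltW|apply: mulr_ge0 => //; exact: addr_ge0].
by have := mulr_ge0 (ltW l0) (sqr_ge0 (1 - shr i)); nra.
Qed.

Local Notation eps := (rate alpha p beta q (fun=> tau) n).
Local Notation th := (Num.min ((beta + q) / D) 1).
Local Notation vt := (Num.min ((2^-1 + alpha + q) / D) 2^-1).

Variables (l : nat -> R) (S : R).
Hypothesis l_q : forall N, \sum_(i < N) l i ^+ 2 * i.+1%:R `^ (2 * q) <= S.
Hypothesis l_prior : forall N, \sum_(i < N) l i ^+ 2 * i.+1%:R `^ (- 1 - 2 * alpha) <= S.

Let C_gt0 : 0 < C. Proof. exact: lt_le_trans ltr01 C_ge1. Qed.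

(** The exponent [2 vt] is nonpositive when [2^-1 + alpha + q <= 0]; the prior
    variance of [L] alone is then the right bound, because [1 <= x]. *)
Lemma error_variance_le N : 1 <= x ->
  \sum_(i < N) l i ^+ 2 * error_eigenvalue kappa n lam i <=
  2 * C ^+ 2 * S * (tau * x `^ (- vt)) ^+ 2.
Proof.
move=> x1.
have S0 : 0 <= S by have := l_q 0; rewrite big_ord0.
have C0 := ltW C_gt0; have t0 := ltW tau_gt0.
have x2 z : x `^ (2 * z) = (x `^ z) ^+ 2.
  by rewrite [2 * z]mulrC powRrM powR_mulrn// powR_ge0.
have D0 : D != 0 by rewrite gt_eqF.
have gen (f : nat -> R) (th' : R) : 0 <= th' <= 1 -> th' >= 2 * vt ->
    (forall N, \sum_(i < N) l i ^+ 2 * f i <= S) ->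
    (forall i, i.+1%:R `^ (- 1 - 2 * alpha + D * th') <= f i) ->
    \sum_(i < N) l i ^+ 2 * error_eigenvalue kappa n lam i <=
      2 * C ^+ 2 * S * (tau * x `^ (- vt)) ^+ 2.
  move=> th01 thv lf wf.
  have xth : x `^ (- th') <= (x `^ (- vt)) ^+ 2.
    by rewrite -x2; apply: ler_powR => //; rewrite mulrN lerN2.
  apply: (@le_trans _ _ (\sum_(i < N) (2 * C ^+ 2 * tau ^+ 2 * (x `^ (- vt)) ^+ 2) * (l i ^+ 2 * f i))).
    apply: ler_sum => i _; rewrite mulrCA ler_wpM2l ?sqr_ge0//.
    have /andP[_ h] := error_eigenvalue_le i; apply: le_trans h _.
    have /andP[_ h] := onem_shrinkage_le i th01.
    apply: (@le_trans _ _ (2 * lam i * (C ^+ 2 * x `^ (- th') * i.+1%:R `^ (D * th')))).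
      by rewrite ler_wpM2l// mulr_ge0// ltW// prior_eigenvalue_gt0.
    rewrite /prior_eigenvalue.
    have w0 : (i.+1%:R : R) != 0 by rewrite pnatr_eq0.
    have := wf i; rewrite powRD ?w0 ?implybT//.
    set W := _ `^ (-1 - _); set W' := _ `^ (D * th'); move=> ww.
    have -> : 2 * (tau ^+ 2 * W) * (C ^+ 2 * x `^ (- th') * W') =
      2 * C ^+ 2 * tau ^+ 2 * (x `^ (- th') * (W * W')) by ring.
    rewrite -[leRHS]mulrA ler_wpM2l ?mulr_ge0//.
    by apply: ler_pM => //; [exact: powR_ge0|rewrite mulr_ge0// powR_ge0].
  rewrite -mulr_sumr.
  have -> : 2 * C ^+ 2 * S * (tau * x `^ (- vt)) ^+ 2 =
    2 * C ^+ 2 * tau ^+ 2 * (x `^ (- vt)) ^+ 2 * S by rewrite exprMn; ring.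
  by rewrite ler_wpM2l// !mulr_ge0// ?powR_ge0.
have [q0|q0] := leP 0 (2^-1 + alpha + q).
  apply: (gen (fun i => i.+1%:R `^ (2 * q)) (2 * vt)) => //.
    rewrite mulr_ge0 ?le_min ?divr_ge0 ?(ltW D_gt0) ?invr_ge0//=.
    by rewrite -ler_pdivlMl// mulr1 ge_min lexx orbT.
  move=> i; apply: ler_powR; first by rewrite ler1n.
  have : D * vt <= 2^-1 + alpha + q.
    by rewrite mulrC -ler_pdivlMr// ge_min lexx.
  lra.
apply: (gen (fun i => i.+1%:R `^ (- 1 - 2 * alpha)) 0) => //.
- by rewrite lexx ler01.
- rewrite pmulr_rle0// ge_min; apply/orP; left.
  by rewrite ler_pdivrMr// mul0r ltW.
- by move=> i; rewrite mulr0 addr0.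
Qed.

Lemma pairing_cvg (u : nat -> R) b :
  (forall N, \sum_(i < N) u i ^+ 2 * i.+1%:R `^ (2 * beta) <= b) ->
  (fun N => \sum_(i < N) l i * u i) @ \oo --> pairing l u.
Proof.
move=> ub.
have : cvgn (series (fun i => l i * u i)).
  apply: (@series_cvg_of_partial _ _ (1 * ((S + b) / 2))) => N.
  under eq_bigr do rewrite -[l _ * u _]mul1r.
  apply: (@sobolev_pairing_le _ q beta l u (fun=> 1)) => // i.
  rewrite normr1 mul1r.
  have := @ler_powR R i.+1%:R _ 0 (q + beta); rewrite powRr0; apply; first by rewrite ler1n.
  by rewrite -lerBlDr sub0r.
by rewrite /pairing /series; under eq_fun do rewrite big_mkord.
Qed.

(** [th] is the largest exponent at most 1 for which the growth of
    [i ^ (D th)] is absorbed by the smoothness of [l] and [u] together. *)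
Lemma bias_le (u : nat -> R) b bias :
  (forall N, \sum_(i < N) u i ^+ 2 * i.+1%:R `^ (2 * beta) <= b) ->
  (fun N => \sum_(i < N) l i * (shr i * u i)) @ \oo --> bias ->
  `|bias - pairing l u| <= C ^+ 2 * ((S + b) / 2) * x `^ (- th).
Proof.
move=> ub biasE.
have h : (fun N => `|\sum_(i < N) l i * (shr i * u i) - \sum_(i < N) l i * u i|) @ \oo -->
    `|bias - pairing l u|.
  by apply: cvg_norm; apply: cvgB => //; exact: pairing_cvg ub.
rewrite -(cvg_lim _ h)//; apply: limr_le; first by apply/cvg_ex; eexists; exact: h.
apply: nearW => N; rewrite -sumrB; apply: le_trans (ler_norm_sum _ _ _) _.
have th01 : 0 <= th <= 1.
  rewrite le_min ler01 divr_ge0 ?(ltW D_gt0)//=; last by rewrite -lerBlDl sub0r.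
  by rewrite ge_min lexx orbT.
have -> : C ^+ 2 * ((S + b) / 2) * x `^ (- th) = (C ^+ 2 * x `^ (- th)) * ((S + b) / 2) by ring.
have := @sobolev_pairing_le _ q beta l u (fun i => 1 - shr i) S b (C ^+ 2 * x `^ (- th)).
have k0 : 0 <= C ^+ 2 * x `^ (- th) by rewrite mulr_ge0 ?sqr_ge0 ?powR_ge0.
move=> /(_ k0 l_q ub) h1; apply: le_trans (h1 _ N).
  by apply: ler_sum => i _; rewrite -normrN; rewrite (_ : - _ = (1 - shr i) * (l i * u i))//; ring.
move=> i; have /andP[s0 s1] := onem_shrinkage_le i th01.
rewrite ger0_norm//; apply: le_trans s1 _; rewrite ler_wpM2l//.
apply: ler_powR; first by rewrite ler1n.
by rewrite mulrC -ler_pdivlMr// ge_min addrC lexx.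
Qed.

Lemma rate_gt0 : 0 < eps.
Proof. by rewrite /rate addr_gt0 ?mulr_gt0 ?powR_gt0. Qed.

(** Chebyshev's inequality at distance [m * eps], with squared bias and
    variance both of the order [eps ^ 2]. *)
Lemma chebyshev_rate_le (u : nat -> R) b bias m : 0 < m ->
  (forall N, \sum_(i < N) u i ^+ 2 * i.+1%:R `^ (2 * beta) <= b) ->
  (fun N => \sum_(i < N) l i * (shr i * u i)) @ \oo --> bias ->
  2 * (2 * C ^+ 2 * S * (tau * x `^ (- vt)) ^+ 2 + (bias - pairing l u) ^+ 2) / (m * eps) ^+ 2 <=
  2 * (2 * C ^+ 2 * S + (C ^+ 2 * ((S + b) / 2)) ^+ 2) / m ^+ 2.
Proof.
move=> m0 ub biasE.
have S0 : 0 <= S by have := l_q 0; rewrite big_ord0.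
have b0 : 0 <= b by have := ub 0; rewrite big_ord0.
have e0 := rate_gt0; have bl := bias_le ub biasE.
set k := C ^+ 2 * ((S + b) / 2) in bl *.
have k0 : 0 <= k by rewrite mulr_ge0 ?sqr_ge0// divr_ge0// addr_ge0.
have C0 := ltW C_gt0.
have A0 : 0 <= tau * x `^ (- vt) by rewrite mulr_ge0 ?powR_ge0// ltW.
have Ae : tau * x `^ (- vt) <= eps by rewrite /rate lerDr powR_ge0.
have Be : x `^ (- th) <= eps by rewrite /rate lerDl.
have A2 : (tau * x `^ (- vt)) ^+ 2 <= eps ^+ 2 by rewrite ler_pXn2r ?nnegrE// ltW.
have B2 : (bias - pairing l u) ^+ 2 <= k ^+ 2 * eps ^+ 2.
  rewrite -[leLHS]real_normK ?num_real// -exprMn ler_pXn2r// ?nnegrE; last first.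
    by apply: mulr_ge0 => //; exact: ltW.
  by apply: le_trans bl _; rewrite ler_wpM2l.
rewrite ler_pdivrMr ?exprn_gt0 ?mulr_gt0//.
have -> : 2 * (2 * C ^+ 2 * S + k ^+ 2) / m ^+ 2 * (m * eps) ^+ 2 =
    2 * (2 * C ^+ 2 * S * eps ^+ 2 + k ^+ 2 * eps ^+ 2).
  by field; rewrite gt_eqF.
rewrite ler_wpM2l// lerD// ler_wpM2l// !mulr_ge0//.
Qed.

End bias_variance.

(** * Comparison of the rate with powers of the sample size *)

Section rates.
Context {R : realType}.
Implicit Types (a b : nat -> R) (x y s t : R).

Lemma asymp_eqI a b c C : 0 < c ->
  (\forall n \near \oo, 0 < b n /\ c * b n <= a n <= C * b n) -> asymp_eq a b.
Proof.
move=> c0 h; exists c, C; split => //; apply: filterS h => n [b0 /andP[h1 h2]].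
have a0 : 0 <= a n by apply: le_trans h1; rewrite mulr_ge0// ltW.
by rewrite ger0_norm ?divr_ge0 ?(ltW b0)// ler_pdivlMr// ler_pdivrMr// h1.
Qed.

(** The sign of the exponent decides which of the two bounds becomes the lower
    one. *)
Lemma powR_comparable s c C : 0 < c -> 0 < C -> exists k K, 0 < k /\
  forall x y, 0 < y -> c * y <= x <= C * y -> k * y `^ s <= x `^ s <= K * y `^ s.
Proof.
move=> c0 C0; have [s0|s0] := leP 0 s.
  exists (c `^ s), (C `^ s); rewrite powR_gt0//; split => // x y y0 /andP[h1 h2].
  have cy : 0 < c * y by rewrite mulr_gt0.
  rewrite -!powRM ?(ltW c0) ?(ltW C0) ?(ltW y0)//.
  by apply/andP; split; apply: ge0_ler_powR => //; rewrite nnegrE;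
    do ?[exact: ltW]; rewrite ltW// (lt_le_trans cy)// (le_trans h1).
exists (C `^ s), (c `^ s); rewrite powR_gt0//; split => // x y y0 /andP[h1 h2].
have cy : 0 < c * y by rewrite mulr_gt0.
have x0 : 0 < x by exact: lt_le_trans h1.
rewrite -!powRM ?(ltW c0) ?(ltW C0) ?(ltW y0)//.
have neg u v : 0 < u -> u <= v -> v `^ s <= u `^ s.
  move=> u0 uv; have v0 := lt_le_trans u0 uv.
  rewrite -[s]opprK !(powRN _ (- s)) lef_pV2 ?posrE ?powR_gt0//.
  by apply: ge0_ler_powR => //; rewrite ?nnegrE ?oppr_ge0 ltW.
by rewrite !neg.
Qed.

Lemma near_ge1 : \forall n \near \oo, 1 <= (n%:R : R).
Proof. by exists 1%N => // n n1; rewrite ler1n. Qed.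

Lemma powR_harmonic_cvg0 s : 0 < s -> n%:R `^ (- s) @[n --> \oo] --> (0 : R).
Proof.
move=> s0; apply/cvgr0Pnorm_le => e e0.
have [N Ne] : exists N : nat, e^-1 `^ s^-1 <= N%:R.
  by exists (Num.Def.archi_bound (e^-1 `^ s^-1)); rewrite ltW// archi_boundP// powR_ge0.
exists N.+1 => // n /= Nn.
have n0 : (0 : R) < n%:R by rewrite ltr0n (leq_trans _ Nn).
rewrite ger0_norm ?powR_ge0// powRN invf_ple ?posrE ?powR_gt0//.
have -> : e^-1 = (e^-1 `^ s^-1) `^ s.
  by rewrite -powRrM mulVf ?gt_eqF// powRr1// invr_ge0 ltW.
apply: ge0_ler_powR; rewrite ?nnegrE ?powR_ge0 ?(ltW s0) ?(ltW n0)//.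
by apply: le_trans Ne _; rewrite ler_nat ltnW.
Qed.

Variables (alpha p beta q : R) (tau : nat -> R).
Hypotheses (alpha_gt0 : 0 < alpha) (p_ge0 : 0 <= p) (beta_gt0 : 0 < beta).
Hypotheses (tau_gt0 : forall n, (0 < n)%N -> 0 < tau n).
Local Notation D := (1 + 2 * alpha + 2 * p).
Local Notation eps := (rate alpha p beta q tau).

Let D_gt0 : 0 < D.
Proof. by rewrite ltr_wpDr ?mulr_ge0// ltr_wpDr// mulr_ge0 // ltW. Qed.

(** For [n >= 1] a maximum of powers of [n] is the power with the largest
    exponent, and the maximum is within a factor 2 of the sum. *)
Lemma rate_constant_scaling : (forall n, (0 < n)%N -> tau n = 1) ->
  asymp_eq eps (fun n => Num.max
       (n%:R `^ (- ((Num.min beta (2^-1 + alpha) + q) / D))) (n%:R `^ (- 2^-1))).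
Proof.
move=> tau1; apply: (@asymp_eqI _ _ 1 2) => //; apply: filterS near_ge1 => n n1.
have n0 : (0 < n)%N by rewrite -(ltr0n R) (lt_le_trans ltr01).
rewrite lt_max !powR_gt0 ?ltr0n//; split => //.
rewrite /rate tau1// expr1n mulr1 !mul1r.
have mono u v : u <= v -> (n%:R : R) `^ (- v) <= n%:R `^ (- u).
  by move=> uv; apply: ler_powR => //; rewrite lerN2.
have mx u v : Num.max (n%:R `^ (- u)) (n%:R `^ (- v)) = n%:R `^ (- Num.min u v) :> R.
  by have [uv|/ltW uv] := leP u v; [apply/max_idPl|apply/max_idPr]; exact: mono.
have Dm u v : Num.min u v / D = Num.min (u / D) (v / D).
  by rewrite minr_pMl// invr_ge0 ltW.
have h2 : (2^-1 : R) <= 1 by rewrite invf_le1// ler1n.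
rewrite mx addr_minl Dm.
set u := (beta + q) / D; set v := (2^-1 + alpha + q) / D.
have -> : Num.min (Num.min u v) 2^-1 = Num.min (Num.min u 1) (Num.min v 2^-1).
  by rewrite minACA [Num.min 1 _]minC (min_idPl h2).
set U := Num.min u 1; set V := Num.min v 2^-1.
have [UV|/ltW UV] := leP U V.
  by rewrite lerDl powR_ge0/= mulr_natl mulr2n lerD2l; exact: mono.
by rewrite lerDr powR_ge0/= mulr_natl mulr2n lerD2r; exact: mono.
Qed.

Let vmin_le : q <= p -> Num.min ((2^-1 + alpha + q) / D) 2^-1 = (2^-1 + alpha + q) / D.
Proof. by move=> qp; apply/min_idPl; rewrite ler_pdivrMr//; lra. Qed.

Let vmin_ge : p <= q -> Num.min ((2^-1 + alpha + q) / D) 2^-1 = 2^-1.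
Proof. by move=> qp; apply/min_idPr; rewrite ler_pdivlMr//; lra. Qed.

(** Here [x = n tau ^ 2] is of the order [n ^ (D / (2 beta + 2 p))], and this
    choice gives both terms of the rate the same order. *)
Lemma rate_balanced_scaling : q <= p -> beta + q <= D ->
  asymp_eq tau (fun n => n%:R `^ ((2^-1 + alpha - beta) / (2 * beta + 2 * p))) ->
  asymp_eq eps (fun n => n%:R `^ (- ((beta + q) / (2 * beta + 2 * p)))).
Proof.
move=> qp bqD [c [C [c0 tauE]]].
have bp : 0 < 2 * beta + 2 * p by rewrite ltr_wpDr ?mulr_ge0// mulr_gt0.
pose t := (2^-1 + alpha - beta) / (2 * beta + 2 * p).
have C0 : 0 < C.
  have [n /= [h _]] := filter_ex (filterI tauE near_ge1).
  by case/andP: h => h1 h2; rewrite (lt_le_trans c0)// (le_trans h1).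
have [k1 [K1 [k10 h1]]] := @powR_comparable (- ((beta + q) / D)) (c ^+ 2) (C ^+ 2)
  (exprn_gt0 _ c0) (exprn_gt0 _ C0).
have [k2 [K2 [k20 h2]]] := @powR_comparable (- ((2^-1 + alpha + q) / D)) (c ^+ 2) (C ^+ 2)
  (exprn_gt0 _ c0) (exprn_gt0 _ C0).
apply: (@asymp_eqI _ _ k1 (K1 + C * K2)) => //.
apply: filterS (filterI tauE near_ge1) => n [/andP[tc tC] n1].
have n0 : (0 < n)%N by rewrite -(ltr0n R) (lt_le_trans ltr01).
have nR : 0 < n%:R :> R by rewrite ltr0n.
have tau0 := tau_gt0 n0.
split; first by rewrite powR_gt0.
have g0 : 0 < (n%:R : R) `^ t by rewrite powR_gt0.
rewrite -/t in tc tC.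
rewrite ger0_norm ?divr_ge0 ?(ltW g0) ?(ltW tau0)// in tc tC.
rewrite ler_pdivlMr// in tc; rewrite ler_pdivrMr// in tC.
rewrite /rate vmin_le//.
have -> : Num.min ((beta + q) / D) 1 = (beta + q) / D.
  by apply/min_idPl; rewrite ler_pdivrMr// mul1r.
set x := n%:R * tau n ^+ 2.
have nn : (n%:R : R) != 0 by rewrite gt_eqF.
have yE : n%:R * (n%:R `^ t) ^+ 2 = n%:R `^ (D / (2 * beta + 2 * p)) :> R.
  rewrite -powR_mulrn ?powR_ge0// -powRrM -[X in X * _](powRr1 (ltW nR)).
  rewrite -powRD ?nn ?implybT//; congr (_ `^ _); rewrite /t; field; rewrite gt_eqF//.
have y0 : 0 < (n%:R : R) `^ (D / (2 * beta + 2 * p)) by rewrite powR_gt0.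
have xy : c ^+ 2 * n%:R `^ (D / (2 * beta + 2 * p)) <= x <= C ^+ 2 * n%:R `^ (D / (2 * beta + 2 * p)).
  rewrite -yE !(mulrCA _ n%:R) -!exprMn !ler_pM2l//.
  by rewrite !ler_pXn2r ?tc ?tC// nnegrE ltW// mulr_gt0.
have /andP[h11 h12] := h1 _ _ y0 xy; have /andP[_ h22] := h2 _ _ y0 xy.
rewrite -!powRrM in h11 h12 h22.
have e1 : D / (2 * beta + 2 * p) * - ((beta + q) / D) = - ((beta + q) / (2 * beta + 2 * p)).
  by field; rewrite !gt_eqF.
rewrite e1 in h11 h12.
apply/andP; split.
  by apply: le_trans h11 _; rewrite lerDl mulr_ge0 ?powR_ge0 ?(ltW tau0).
rewrite [leRHS]mulrDl; apply: lerD => //.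
apply: (@le_trans _ _ ((C * n%:R `^ t) * (K2 * n%:R `^ (D / (2 * beta + 2 * p) * - ((2^-1 + alpha + q) / D))))).
  by apply: ler_pM; rewrite ?(ltW tau0) ?powR_ge0.
rewrite mulrACA -powRD ?nn ?implybT//.
rewrite le_eqVlt; apply/orP; left; apply/eqP; congr (_ * _ `^ _).
by rewrite /t; field; rewrite !gt_eqF.
Qed.

(** With [x = n tau ^ 2] the rate is [x^-1 + n^(-1/2) x^g], where
    [g = (p - q) / D]; whatever [x], one of the terms is at least their common
    value at the balancing point. *)
Let rate_lower n : q <= p -> D < beta + q -> (0 < n)%N ->
  n%:R `^ (- (D / (2 * (D + p - q)))) <= eps n.
Proof.
move=> qp bqD n0; rewrite /rate vmin_le//.
have nR : 0 < n%:R :> R by rewrite ltr0n.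
have tau0 := tau_gt0 n0.
have nn : (n%:R : R) != 0 by rewrite gt_eqF.
have -> : Num.min ((beta + q) / D) 1 = 1.
  by apply/min_idPr; rewrite ler_pdivlMr// mul1r ltW.
set x := n%:R * tau n ^+ 2.
have x0 : 0 < x by rewrite mulr_gt0// exprn_gt0.
have xx : x != 0 by rewrite gt_eqF.
have tauE : tau n = n%:R `^ (- 2^-1) * x `^ 2^-1.
  rewrite powRN !powR12_sqrt ?(ltW x0) ?ler0n// /x sqrtrM ?ler0n// sqrtr_sqr.
  by rewrite ger0_norm ?(ltW tau0)// mulKf// gt_eqF// sqrtr_gt0.
have Dq : 0 < D + p - q by rewrite -addrA ltr_wpDr// subr_ge0.
pose y : R := n%:R `^ (D / (2 * (D + p - q))).
have y0 : 0 < y by rewrite powR_gt0.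
rewrite powRN -/y.
have [xy|/ltW yx] := leP x y.
  apply: (@le_trans _ _ (x `^ (- 1))).
    by rewrite powR_inv1 ?(ltW x0)// lef_pV2 ?posrE.
  by rewrite lerDl mulr_ge0 ?powR_ge0 ?(ltW tau0).
apply: (@le_trans _ _ (tau n * x `^ (- ((2^-1 + alpha + q) / D)))); last by rewrite lerDr powR_ge0.
rewrite tauE -mulrA -powRD ?xx ?implybT//.
have -> : 2^-1 - (2^-1 + alpha + q) / D = (p - q) / D.
  by field; rewrite gt_eqF.
apply: (@le_trans _ _ (n%:R `^ (- 2^-1) * y `^ ((p - q) / D))).
  rewrite /y -powRrM -powRN -powRD ?nn ?implybT// le_eqVlt; apply/orP; left; apply/eqP.
  by congr (_ `^ _); field; rewrite !gt_eqF.
rewrite ler_wpM2l ?powR_ge0//; apply: ge0_ler_powR => //; rewrite ?nnegrE ?(ltW x0) ?(ltW y0)//.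
by rewrite divr_ge0 ?subr_ge0// ltW.
Qed.

Let exponent_gap : beta + q != 0 -> D + p - q != 0 -> beta + p != 0 ->
  (beta + q) / (2 * beta + 2 * p) - D / (2 * (D + p - q)) =
  (p - q) * (beta + q - D) / (2 * (beta + p) * (D + p - q)).
Proof. by move=> h1 h2 h3; field; rewrite h2 h3/= -mulrDr mulf_neq0// pnatr_eq0. Qed.

Let gap_ge n : q <= p -> D < beta + q -> (0 < n)%N ->
  `|n%:R `^ (- ((beta + q) / (2 * beta + 2 * p))) / eps n| <=
  n%:R `^ (- ((p - q) * (beta + q - D) / (2 * (beta + p) * (D + p - q)))).
Proof.
move=> qp bqD n0; have lo := rate_lower qp bqD n0.
have nR : 0 < n%:R :> R by rewrite ltr0n.
have nn : (n%:R : R) != 0 by rewrite gt_eqF.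
have e0 : 0 < eps n by rewrite (lt_le_trans _ lo)// powR_gt0.
rewrite ger0_norm ?divr_ge0 ?powR_ge0 ?(ltW e0)// ler_pdivrMr//.
have Dq : 0 < D + p - q by rewrite -addrA ltr_wpDr// subr_ge0.
rewrite -exponent_gap; last 3 first.
- by rewrite gt_eqF// (lt_trans D_gt0).
- by rewrite gt_eqF.
- by rewrite gt_eqF// ltr_wpDr.
apply: le_trans (ler_wpM2l (powR_ge0 _ _) lo).
by rewrite -powRD ?nn ?implybT// le_eqVlt; apply/orP; left; apply/eqP; congr (_ `^ _); ring.
Qed.

Lemma rate_saturated_ge : q <= p -> D < beta + q ->
  asymp_gtrsim eps (fun n => n%:R `^ (- ((beta + q) / (2 * beta + 2 * p)))).
Proof.
move=> qp bqD; exists 1; apply: filterS near_ge1 => n n1.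
have n0 : (0 < n)%N by rewrite -(ltr0n R) (lt_le_trans ltr01).
apply: le_trans (gap_ge qp bqD n0) _.
rewrite powRN invf_le1 ?powR_gt0 ?ltr0n//.
have := @ler_powR R n%:R n1 0; rewrite powRr0; apply.
have Dq : 0 < D + p - q by rewrite -addrA ltr_wpDr// subr_ge0.
have bp : 0 < beta + p by rewrite ltr_wpDr.
apply: divr_ge0; first by rewrite mulr_ge0 ?subr_ge0// ltW.
by rewrite mulr_ge0 ?(ltW Dq)// mulr_ge0// ltW.
Qed.

Lemma rate_saturated_gg : q < p -> D < beta + q ->
  asymp_gg eps (fun n => n%:R `^ (- ((beta + q) / (2 * beta + 2 * p)))).
Proof.
move=> qp bqD; rewrite /asymp_gg.
have Dq : 0 < D + p - q by rewrite -addrA ltr_wpDr// subr_ge0 ltW.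
have g0 : 0 < (p - q) * (beta + q - D) / (2 * (beta + p) * (D + p - q)).
  have bp : 0 < beta + p by rewrite ltr_wpDr.
  by apply: divr_gt0; [rewrite mulr_gt0 ?subr_gt0|rewrite mulr_gt0// mulr_gt0].
have gc := powR_harmonic_cvg0 g0.
have gcN : (fun n : nat => - n%:R `^ (- ((p - q) * (beta + q - D) / (2 * (beta + p) * (D + p - q))))) @ \oo --> (0 : R).
  by rewrite -[X in _ --> X]oppr0; exact: cvgN.
apply: squeeze_cvgr gcN gc; apply: filterS near_ge1 => n n1.
have n0 : (0 < n)%N by rewrite -(ltr0n R) (lt_le_trans ltr01).
by rewrite -ler_norml; exact: gap_ge (ltW qp) bqD n0.
Qed.

(** The second term is exactly [n ^ (- 1 / 2)], as [tau x ^ (- 1 / 2)] does not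
    depend on [tau]; the condition on [tau] keeps the first one below a multiple
    of it. *)
Lemma rate_smooth_functional : p <= q ->
  let betat := Num.min beta (D - q) in
  asymp_gtrsim tau (fun n => n%:R `^ ((2^-1 + alpha - betat + p - q) / (2 * betat + 2 * q))) ->
  asymp_eq eps (fun n => n%:R `^ (- 2^-1)).
Proof.
move=> pq betat [C tauE].
pose t := (2^-1 + alpha - betat + p - q) / (2 * betat + 2 * q).
have bqE : betat + q = Num.min (beta + q) D by rewrite /betat addr_minl subrK.
have bq0 : 0 < betat + q.
  by rewrite bqE lt_min D_gt0 andbT ltr_wpDr// (le_trans p_ge0).
have C0 : 0 < C.
  have [n /= [h n1]] := filter_ex (filterI tauE near_ge1).
  have n0 : (0 < n)%N by rewrite -(ltr0n R) (lt_le_trans ltr01).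
  apply: lt_le_trans h; rewrite normr_gt0 mulf_neq0 ?invr_eq0 ?gt_eqF ?tau_gt0 ?powR_gt0 ?ltr0n//.
pose th := (betat + q) / D.
have th0 : 0 <= th by rewrite divr_ge0 ?ltW.
apply: (@asymp_eqI _ _ 1 ((C ^+ 2) `^ th + 1)) => //.
apply: filterS (filterI tauE near_ge1) => n [tC n1].
have n0 : (0 < n)%N by rewrite -(ltr0n R) (lt_le_trans ltr01).
have nR : 0 < n%:R :> R by rewrite ltr0n.
have nn : (n%:R : R) != 0 by rewrite gt_eqF.
have tau0 := tau_gt0 n0.
split; first by rewrite powR_gt0.
rewrite /rate vmin_ge//.
have -> : Num.min ((beta + q) / D) 1 = th.
  by rewrite /th bqE minr_pMl ?invr_ge0 ?(ltW D_gt0)// divff ?gt_eqF.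
set x := n%:R * tau n ^+ 2.
have x0 : 0 < x by rewrite mulr_gt0// exprn_gt0.
have -> : tau n * x `^ (- 2^-1) = n%:R `^ (- 2^-1).
  rewrite !powRN !powR12_sqrt ?(ltW x0) ?ler0n// /x sqrtrM ?ler0n// sqrtr_sqr.
  rewrite ger0_norm ?(ltW tau0)// invfM mulrCA divff ?mulr1//.
  by rewrite gt_eqF.
rewrite mul1r lerDr powR_ge0/= mulrDl mul1r lerD2r.
rewrite ger0_norm ?divr_ge0 ?powR_ge0 ?(ltW tau0)// ler_pdivrMr// -/t in tC.
have nE : n%:R `^ 2^-1 = (n%:R * (n%:R `^ t) ^+ 2) `^ th.
  rewrite -powR_mulrn ?powR_ge0// -powRrM -[X in X * _](powRr1 (ltW nR)).
  rewrite -powRD ?nn ?implybT// -powRrM; congr (_ `^ _); rewrite /t /th.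
  by field; rewrite gt_eqF//= -mulrDr mulf_neq0 ?gt_eqF.
rewrite !powRN ler_pdivlMr ?powR_gt0// mulrC ler_pdivrMr ?powR_gt0//.
rewrite nE -powRM ?sqr_ge0 ?(ltW x0)//.
have C0' := ltW C0.
apply: ge0_ler_powR => //; rewrite ?nnegrE.
- by apply: mulr_ge0; rewrite ?ler0n// exprn_ge0// powR_ge0.
- by apply: mulr_ge0; [rewrite exprn_ge0|rewrite ltW].
rewrite /x [leRHS]mulrCA ler_wpM2l ?ler0n// -exprMn ler_pXn2r ?nnegrE ?powR_ge0//.
by rewrite mulr_ge0 ?ltW.
Qed.

End rates.

(** * Posterior contraction for linear functionals *)

Unset Implicit Arguments.
Set Strict Implicit.
Set Printing Implicit Defensive.

Theorem theorem5p1 (R : realType)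
  (* Hilbert spaces *)
  (H1 H2 : completeNormedModType R)
  (ip1 : H1 -> H1 -> R) (ip2 : H2 -> H2 -> R)
  (hip1 : is_inner_product ip1) (hip2 : is_inner_product ip2)
  (sepH1 : separable_space H1) (sepH2 : separable_space H2)
  (* the operator K *)
  (K : {linear H1 -> H2}) (KT : {linear H2 -> H1})
  (K_cont : continuous K) (K_inj : injective K)
  (K_adj : is_adjoint ip1 ip2 K KT)
  (* parameters *)
  (alpha p beta C : R) (alpha_gt0 : 0 < alpha) (p_ge0 : 0 <= p)
  (beta_gt0 : 0 < beta) (C_ge1 : 1 <= C)
  (tau : nat -> R) (tau_gt0 : forall n, (0 < n)%N -> 0 < tau n)
  (ntau : n%:R * tau n ^+ 2 @[n --> \oo] --> +oo)
  (* eigenstructure of K^T K and of the prior covariance *)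
  (e : nat -> H1) (e_onb : orthonormal_basis ip1 e)
  (kappa : nat -> R) (kappa_gt0 : forall i, 0 < kappa i)
  (K_eigen : forall i, KT (K (e i)) = kappa i ^+ 2 *: e i)
  (kappa_bounds : forall i,
     C^-1 * i.+1%:R `^ (- p) <= kappa i <= C * i.+1%:R `^ (- p))
  (Lam Lam_half : nat -> {linear H1 -> H1})
  (Lam_cont : forall n, (0 < n)%N -> continuous (Lam n))
  (Lam_eigen : forall n, (0 < n)%N -> forall i,
     Lam n (e i) = prior_eigenvalue alpha (tau n) i *: e i)
  (Lam_half_cont : forall n, (0 < n)%N -> continuous (Lam_half n))
  (Lam_half_sqrt : forall n, (0 < n)%N ->
     is_sqrt_operator ip1 (Lam n) (Lam_half n))
  (prior : nat -> probability (borel H1) R)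
  (prior_gaussian : forall n, (0 < n)%N ->
     is_gaussian ip1 (prior n) 0 (Lam n))
  (* observation: Y has law P n mu when the parameter is mu *)
  (d : measure_display) (Omega : nat -> measurableType d)
  (P : forall n, H1 -> probability (Omega n) R)
  (Y : forall n, H2 -> {mfun Omega n >-> R})
  (Y_law : forall n, (0 < n)%N -> forall mu : H1,
     is_signal_in_white_noise ip2 (P n mu) n (K mu) (fun h => Y n h))
  (* posterior N(AY, S_n) *)
  (A : nat -> {linear H2 -> H1}) (AT : nat -> {linear H1 -> H2})
  (A_cont : forall n, (0 < n)%N -> continuous (A n))
  (A_gain : forall n, (0 < n)%N -> is_posterior_gain n K KT (Lam n) (A n))
  (A_adj : forall n, (0 < n)%N -> is_adjoint ip2 ip1 (A n) (AT n))
  (AY : forall n, {mfun Omega n >-> borel H1})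
  (AY_repr : forall n, (0 < n)%N -> forall mu0 : H1,
     represents_process ip1 (P n mu0) (fun h => Y n h) (AT n) (AY n))
  (Pi : forall n, R.-pker (Omega n) ~> (borel H1))
  (Pi_posterior : forall n, (0 < n)%N -> forall mu0 : H1,
     {ae P n mu0, forall w, is_gaussian ip1 (Pi n w) (AY n w)
        (posterior_cov n K KT (Lam n) (A n) (AT n))})
  (* the functional L with representer l *)
  (L : H1 -> R)
  (L_linear : forall n, (0 < n)%N ->
     is_measurable_linear_functional (prior n) L)
  (l : nat -> R)
  (l_repr : forall n, (0 < n)%N -> forall i,
     l i = representer e (Lam_half n) (prior_eigenvalue alpha (tau n)) L i)
  (q : R) (q_ge : - beta <= q) (l_sobolev : sobolev q l) :
  let eps := rate alpha p beta q tau in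
  let risk (M : nat -> R) (n : nat) (mu0 : H1) : \bar R :=
    (\int[P n mu0]_w Pi n w
       [set mu : H1 | M n * eps n <= `|L mu - pairing l (basis_coord ip1 e mu0)|]%R)%E
  in
  (forall M : nat -> R, M n @[n --> \oo] --> +oo ->
     (forall mu0 : H1, sobolev beta (basis_coord ip1 e mu0) ->
        risk M n mu0 @[n --> \oo] --> 0%E) /\
     (forall r : R, 0 < r ->
        ereal_sup [set risk M n mu0 | mu0 in
          [set mu0 : H1 | (sobolev_norm beta (basis_coord ip1 e mu0) <= r%:E)%E]]
        @[n --> \oo] --> 0%E)) /\
  (* (i) *)
  ((forall n, (0 < n)%N -> tau n = 1) ->
     asymp_eq eps (fun n => Num.max
       (n%:R `^ (- ((Num.min beta (2^-1 + alpha) + q)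
                      / (1 + 2 * alpha + 2 * p))))
       (n%:R `^ (- 2^-1)))) /\
  (* (ii) *)
  (q <= p -> beta + q <= 1 + 2 * alpha + 2 * p ->
   asymp_eq tau
     (fun n => n%:R `^ ((2^-1 + alpha - beta) / (2 * beta + 2 * p))) ->
     asymp_eq eps (fun n => n%:R `^ (- ((beta + q) / (2 * beta + 2 * p))))) /\
  (* (iii), strict domination for q < p; only the nonstrict one can hold at
     q = p *)
  (q <= p -> 1 + 2 * alpha + 2 * p < beta + q ->
     asymp_gtrsim eps (fun n => n%:R `^ (- ((beta + q) / (2 * beta + 2 * p))))
     /\ (q < p ->
     asymp_gg eps (fun n => n%:R `^ (- ((beta + q) / (2 * beta + 2 * p)))))) /\
  (* (iv) *)
  (p <= q ->
   let betat := Num.min beta (1 + 2 * alpha + 2 * p - q) in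
   asymp_gtrsim tau
     (fun n => n%:R `^ ((2^-1 + alpha - betat + p - q)
                          / (2 * betat + 2 * q))) ->
     asymp_eq eps (fun n => n%:R `^ (- 2^-1))).
Proof.
move=> eps risk.
have lam_gt0 n : (0 < n)%N -> forall i, 0 < prior_eigenvalue alpha (tau n) i.
  by move=> n0 i; exact: (prior_eigenvalue_gt0 alpha (tau_gt0 _ n0)).
have lE i : l i = L (e i).
  rewrite (l_repr 1%N isT).
  exact: (representer_basis hip1 sepH1 e_onb (Lam_half_sqrt 1%N isT)
    (lam_gt0 1%N isT) (Lam_eigen 1%N isT) (prior_gaussian 1%N isT)
    (L_linear 1%N isT)).
(* [l] is the same for all [n], so one prior suffices to bound
   [sum l_i^2 i^(- 1 - 2 alpha)]. *)
have [S [l_q l_prior]] : exists S,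
    (forall N, \sum_(i < N) l i ^+ 2 * i.+1%:R `^ (2 * q) <= S) /\
    (forall N, \sum_(i < N) l i ^+ 2 * i.+1%:R `^ (- 1 - 2 * alpha) <= S).
  have [r lr] := sobolev_norm_finite l_sobolev.
  have [mL [V [mV pV V0 V_lin L_lin]]] := L_linear 1%N isT.
  have [s ls] := prior_variance_bounded hip1 e_onb sepH1 (Lam_half_sqrt 1%N isT)
    (lam_gt0 1%N isT) (Lam_eigen 1%N isT) (prior_gaussian 1%N isT)
    mL mV pV V0 V_lin L_lin.
  exists (Num.max (r ^+ 2) (s / tau 1%N ^+ 2)); split => N; rewrite le_max; apply/orP.
    by left; exact: sobolev_norm_le_partial.
  right; rewrite ler_pdivlMr ?exprn_gt0 ?(tau_gt0 1%N)//; apply: le_trans (ls N).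
  rewrite mulr_suml le_eqVlt; apply/orP; left; apply/eqP; apply: eq_bigr => i _.
  by rewrite lE /prior_eigenvalue; ring.
pose Kr r : R := 2 * (2 * C ^+ 2 * S + (C ^+ 2 * ((S + r ^+ 2) / 2)) ^+ 2).
have bound (M : nat -> R) n mu0 (r : R) : (0 < n)%N -> 1 <= n%:R * tau n ^+ 2 -> 0 < M n ->
    (sobolev_norm beta (basis_coord ip1 e mu0) <= r%:E)%E ->
    (risk M n mu0 <= (Kr r / M n ^+ 2)%:E)%E.
  move=> n0 x1 m0 mur.
  have ub := sobolev_norm_le_partial mur.
  have e0 : 0 < eps n by exact: (rate_gt0 alpha p beta q (tau_gt0 _ n0) n0).
  have [bias [biasE dev]] := posterior_deviation_le hip1 hip2 sepH1 K_adj e_onb kappa_gt0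
    K_eigen n0 (Lam_half_sqrt _ n0) (lam_gt0 n n0) (Lam_eigen _ n0) (prior_gaussian _ n0)
    (Y_law _ n0 mu0) (A_gain _ n0) (A_adj _ n0) (AY_repr _ n0 mu0) (Pi_posterior _ n0 mu0) (L_linear _ n0).
  apply: le_trans (dev (2 * C ^+ 2 * S * (tau n * (n%:R * tau n ^+ 2)
     `^ (- Num.min ((2^-1 + alpha + q) / (1 + 2 * alpha + 2 * p)) 2^-1)) ^+ 2) _ _ _ _) _.
  - exact: mulr_gt0.
  - move=> N; under eq_bigr do rewrite -lE.
    exact: (error_variance_le alpha_gt0 p_ge0 C_ge1 (tau_gt0 _ n0) n0 kappa_gt0 kappa_bounds l_q l_prior).
  - rewrite lee_fin.
    have lbias : (fun N => \sum_(i < N) l i * (shrinkage kappa n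
        (prior_eigenvalue alpha (tau n)) i * basis_coord ip1 e mu0 i)) @ \oo --> bias.
      apply: cvg_trans biasE; apply: near_eq_cvg; apply: nearW => N.
      by apply: eq_bigr => i _; rewrite lE.
    exact: (chebyshev_rate_le alpha_gt0 p_ge0 C_ge1 (tau_gt0 _ n0) n0 kappa_gt0 q_ge
      kappa_bounds l_q m0 ub lbias).
have bound0 (M : nat -> R) (r : R) : M n @[n --> \oo] --> +oo -> (fun n => (Kr r / M n ^+ 2)%:E) @ \oo --> 0%E.
  move=> Moo; apply: cvg_EFin; first exact: nearW.
  have Mgt0 : \forall n \near \oo, 0 < M n by move/cvgryPgt : Moo; exact.
  have MV : (fun n => (M n)^-1) @ \oo --> (0 : R) by apply/gtr0_cvgV0.
  rewrite -[X in _ --> X](mulr0 (Kr r)); apply: cvgM; first exact: cvg_cst.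
  rewrite -[X in _ --> X](mulr0 0).
  by under eq_fun do rewrite -exprVn expr2; exact: cvgM.
have near0 (M : nat -> R) : M n @[n --> \oo] --> +oo -> \forall n \near \oo, 
    [/\ (0 < n)%N, 1 <= n%:R * tau n ^+ 2 & 0 < M n].
  move=> Moo.
  have Mgt0 : \forall n \near \oo, 0 < M n by move/cvgryPgt : Moo; exact.
  have x1 : \forall n \near \oo, 1 <= n%:R * tau n ^+ 2 by move/cvgryPge : ntau; exact.
  have n1 : \forall n \near \oo, (0 < n)%N by exists 1%N.
  by apply: filterS3 n1 x1 Mgt0.
split.
  move=> M Moo; split => [mu0 mub|r r0].
    have [r mur] := sobolev_norm_finite mub.
    apply: (squeeze_cvge _ (cvg_cst 0%E) (bound0 M r Moo)).
    apply: filterS (near0 M Moo) => n [n0 x1 m0].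
    by rewrite integral_ge0//=; exact: bound.
  apply: (squeeze_cvge _ (cvg_cst 0%E) (bound0 M r Moo)).
  apply: filterS (near0 M Moo) => n [n0 x1 m0]; apply/andP; split.
    apply: (@le_trans _ _ (risk M n 0)); first exact: integral_ge0.
    apply: ereal_sup_ubound; exists 0 => //=.
    rewrite /sobolev_norm eseries0 ?sqrte0 ?lee_fin ?(ltW r0)// => i _ _.
    by rewrite /basis_coord (ip0l hip1) expr0n/= mul0r.
  by apply: ge_ereal_sup => _ [mu0 mur <-]; exact: bound.
split; first exact: rate_constant_scaling.
split; first exact: rate_balanced_scaling.
split.
  move=> qp bqD; split; first exact: rate_saturated_ge.
  by move=> qp'; exact: rate_saturated_gg.
exact: rate_smooth_functional.
Qed.
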